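(* Let $\varphi\colon\mathbb{R}^n\to\overline{\mathbb{R}}$ admit the representation $\varphi=\vartheta\circ f$ locally around $\bar x$, where $\vartheta\colon\mathbb{R}^m\to\overline{\mathbb{R}}$ is convex piecewise linear-quadratic, and where $f\colon\mathbb{R}^n\to\mathbb{R}^m$ is $\mathcal{C}^2$-smooth around $\bar x$ with $f(\bar x)\in\operatorname{dom}\vartheta$, and let the metric subregularity qualification condition (MSQC) for $\vartheta\circ f$ hold at $\bar x$. Assume that $(\bar x,\bar v)\in\operatorname{gph}\partial\varphi$. Then the subgradient mapping $\partial\varphi$ is proto-differentiable at $\bar x$ for $\bar v$, and whenever $w\in K_\varphi(\bar x,\bar v)$ the proto-derivative of $\partial\varphi$ is calculated by $$\big(D\partial\varphi\big)(\bar x,\bar v)(w)=\big\{\nabla^2\langle\lambda,f\rangle(\bar x)w\mid\lambda\in\Lambda(\bar x,\bar v,w)\big\}+\nabla f(\bar x)^*\big[\big(D\partial\vartheta\big)\big(f(\bar x),\bar\lambda\big)\big(\nabla f(\bar x)w\big)\big],$$ where $\Lambda(\bar x,\bar v,w)$ is the set of optimal solutions to the linear program $$\max_{\lambda\in\Lambda(\bar x,\bar v)}\langle\lambda,\nabla^2f(\bar x)(w,w)\rangle,$$ and where $\bar\lambda$ is an arbitrary vector from $\Lambda(\bar x,\bar v)$. Furthermore, $\operatorname{dom}(D\partial\varphi)(\bar x,\bar v)=K_\varphi(\bar x,\bar v)$.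
   Context: $\overline{\mathbb{R}}:=(-\infty,\infty]$, $\operatorname{dom}\varphi:=\{x\mid\varphi(x)<\infty\}$, $\operatorname{epi}\varphi:=\{(x,\alpha)\mid\alpha\ge\varphi(x)\}$; $^*$ denotes transpose; $\nabla^2f(\bar x)(w,v):=(\langle\nabla^2f_1(\bar x)w,v\rangle,\ldots,\langle\nabla^2f_m(\bar x)w,v\rangle)$. $\vartheta$ is piecewise linear-quadratic if $\operatorname{dom}\vartheta=\bigcup_{i=1}^s\Omega_i$ with polyhedral convex sets $\Omega_i$ and $\vartheta(y)=\frac12\langle A_iy,y\rangle+\langle a_i,y\rangle+\alpha_i$ for $y\in\Omega_i$, with symmetric matrices $A_i$, $a_i\in\mathbb{R}^m$, $\alpha_i\in\mathbb{R}$. MSQC for $\vartheta\circ f$ at $\bar x$: there are $\kappa\ge0$ and a neighborhood $U$ of $\bar x$ with $\operatorname{dist}(x;\Omega)\le\kappa\operatorname{dist}(f(x);\operatorname{dom}\vartheta)$ for all $x\in U$, where $\Omega:=\{x\mid f(x)\in\operatorname{dom}\vartheta\}$. Regular normal cone: $\widehat N_\Omega(\bar x):=\{v\mid\limsup_{x\to\bar x,\,x\in\Omega}\frac{\langle v,x-\bar x\rangle}{\|x-\bar x\|}\le 0\}$; limiting normal cone $N_\Omega(\bar x)$: all limits of $v_k\in\widehat N_\Omega(x_k)$ with $x_k\to\bar x$, $x_k\in\Omega$. Limiting subdifferential: $\partial\varphi(\bar x):=\{v\mid(v,-1)\in N_{\operatorname{epi}\varphi}(\bar x,\varphi(\bar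 x))\}$ (the usual subdifferential for convex functions). Multiplier set: $\Lambda(\bar x,\bar v):=\{\lambda\in\mathbb{R}^m\mid\nabla f(\bar x)^*\lambda=\bar v,\ \lambda\in\partial\vartheta(f(\bar x))\}$. Subderivative: $\mathrm{d}\varphi(\bar x)(\bar w):=\liminf_{t\downarrow 0,\,w\to\bar w}\frac{\varphi(\bar x+tw)-\varphi(\bar x)}{t}$. Critical cone: $K_\varphi(\bar x,\bar v):=\{w\mid\mathrm{d}\varphi(\bar x)(w)=\langle\bar v,w\rangle\}$. Tangent cone: $T_\Omega(\bar x):=\{w\mid\exists\,t_k\downarrow0,\ w_k\to w,\ \bar x+t_kw_k\in\Omega\}$. $\Omega$ is geometrically derivable at $\bar x$ if for every $w\in T_\Omega(\bar x)$ there are $\varepsilon>0$ and $\xi\colon[0,\varepsilon]\to\Omega$ with $\xi(0)=\bar x$ and right derivative $\xi'_+(0)=w$. For a set-valued mapping $S$ and $\bar y\in S(\bar x)$, the graphical derivative is $DS(\bar x,\bar y)(u):=\{v\mid(u,v)\in T_{\operatorname{gph}S}(\bar x,\bar y)\}$, with domain $\{u\mid DS(\bar x,\bar y)(u)\neq\emptyset\}$. $S$ is proto-differentiable at $\bar x$ for $\bar y$ if $\operatorname{gph}S$ is geometrically derivable at $(\bar x,\bar y)$, in which case $DS(\bar x,\bar y)$ is called the proto-derivative. *)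

(* Defs.v *)
From HB Require Import structures.
From mathcomp Require Import all_boot all_order all_algebra.
From mathcomp Require Import all_classical all_reals all_analysis.
Set Implicit Arguments.
Unset Strict Implicit.
Unset Printing Implicit Defensive.
Import Order.TTheory GRing.Theory Num.Theory.
Import numFieldNormedType.Exports.
Local Open Scope classical_set_scope.
Local Open Scope ring_scope.

(* Vectors of R^k are row vectors 'rV[R]_k. The library norm on 'rV[R]_k is
   the sup norm, hence the Euclidean structure below; limits and
   neighborhoods are those of the library topology, which is the usual one.
   Points of a product R^k x R^l are encoded by row_mx in R^(k + l), so that
   normal and tangent cones are only needed for subsets of some R^k. *)

Section Euclidean.
Context {R : realType} {k : nat}.

Definition dotv (u v : 'rV[R]_k) : R := \sum_(i < k) u 0 i * v 0 i.

Definition enorm (u : 'rV[R]_k) : R := Num.sqrt (dotv u u).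

Definition dist (x : 'rV[R]_k) (A : set 'rV[R]_k) : R :=
  inf [set enorm (x - y) | y in A].

End Euclidean.

Section VariationalGeometry.
Context {R : realType} {k : nat}.

(* If x is isolated in Om, the limsup is -oo, so every v is a normal. *)
Definition regular_normal (Om : set 'rV[R]_k) (x : 'rV[R]_k) : set 'rV[R]_k :=
  [set v | (limf_esup (fun y : 'rV[R]_k => (dotv v (y - x) / enorm (y - x))%:E)
              (within (Om `\ x) (nbhs x)) <= 0)%E].

Definition limiting_normal (Om : set 'rV[R]_k) (x : 'rV[R]_k) :
    set 'rV[R]_k :=
  [set v | exists x_ v_ : nat -> 'rV[R]_k,
    [/\ forall i, Om (x_ i), forall i, regular_normal Om (x_ i) (v_ i),
        x_ @ \oo --> x & v_ @ \oo --> v]].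

Definition tangent (Om : set 'rV[R]_k) (x : 'rV[R]_k) : set 'rV[R]_k :=
  [set w | exists (t_ : nat -> R) (w_ : nat -> 'rV[R]_k),
    [/\ forall i, 0 < t_ i, t_ @ \oo --> (0 : R), w_ @ \oo --> w &
        forall i, Om (x + t_ i *: w_ i)]].

Definition geometrically_derivable (Om : set 'rV[R]_k) (x : 'rV[R]_k) : Prop :=
  forall w, tangent Om x w ->
  exists (e : R) (xi : R -> 'rV[R]_k),
    [/\ 0 < e, forall t, 0 <= t <= e -> Om (xi t), xi 0 = x &
        t^-1 *: (xi t - xi 0) @[t --> 0^'+] --> w].

Definition polyhedral (A : set 'rV[R]_k) : Prop :=
  exists (p : nat) (b : 'I_p -> 'rV[R]_k) (c : 'I_p -> R),
    A = [set y | forall i, dotv (b i) y <= c i].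

End VariationalGeometry.

Section SetValued.
Context {R : realType} {k l : nat}.
Implicit Type S : 'rV[R]_k -> set 'rV[R]_l.

Definition gph S : set 'rV[R]_(k + l) := [set z | S (lsubmx z) (rsubmx z)].

Definition graphical_derivative S (x : 'rV[R]_k) (y : 'rV[R]_l) :
    'rV[R]_k -> set 'rV[R]_l :=
  fun u => [set v | tangent (gph S) (row_mx x y) (row_mx u v)].

Definition svdom S : set 'rV[R]_k := [set u | S u !=set0].

Definition proto_differentiable S (x : 'rV[R]_k) (y : 'rV[R]_l) : Prop :=
  geometrically_derivable (gph S) (row_mx x y).

End SetValued.

Section ExtendedRealFunctions.
Context {R : realType} {k : nat}.
Implicit Type phi : 'rV[R]_k -> \bar R.

Definition edom phi : set 'rV[R]_k := [set x | (phi x < +oo)%E].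

Definition epi phi : set 'rV[R]_(k + 1) :=
  [set z | (phi (lsubmx z) <= (rsubmx z 0 0)%:E)%E].

(* Empty outside of the domain. *)
Definition subdifferential phi (x : 'rV[R]_k) : set 'rV[R]_k :=
  [set v | edom phi x /\
     limiting_normal (epi phi) (row_mx x (const_mx (fine (phi x))))
       (row_mx v (const_mx (-1)))].

Definition subderivative phi (x w : 'rV[R]_k) : \bar R :=
  limf_einf (fun q : R * 'rV[R]_k =>
               (phi (x + q.1 *: q.2)%R - phi x) * (q.1^-1)%:E)%E
    (filter_prod (0^'+) (nbhs w)).

Definition critical_cone phi (x v : 'rV[R]_k) : set 'rV[R]_k :=
  [set w | subderivative phi x w = (dotv v w)%:E].

(* For functions with values in (-oo, +oo]. *)
Definition econvex phi : Prop :=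
  forall (x y : 'rV[R]_k) (t : R), 0 < t < 1 ->
    (phi (t *: x + (1 - t) *: y)%R
       <= t%:E * phi x + (1 - t)%:E * phi y)%E.

Definition piecewise_linear_quadratic phi : Prop :=
  exists (s : nat) (Om : 'I_s -> set 'rV[R]_k) (A : 'I_s -> 'M[R]_k)
         (a : 'I_s -> 'rV[R]_k) (alpha : 'I_s -> R),
    [/\ forall i, polyhedral (Om i), forall i, (A i)^T = A i,
        edom phi = \bigcup_i Om i &
        forall i y, Om i y ->
          phi y = (2^-1 * dotv (y *m A i) y + dotv (a i) y + alpha i)%:E].

End ExtendedRealFunctions.

Section Derivatives.
Context {R : realType} {n : nat}.

Definition grad (g : 'rV[R]_n -> R) (x : 'rV[R]_n) : 'rV[R]_n :=
  \row_j 'D_(delta_mx 0 j) g x.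

(* The library Jacobian acts on row vectors from the right, i.e. it is the
   transpose of the usual one: the derivative of f at x in direction w is
   w *m 'J f x. In particular w *m hess g x is (nabla^2 g)(x) w. *)
Definition hess (g : 'rV[R]_n -> R) (x : 'rV[R]_n) : 'M[R]_n := 'J (grad g) x.

Context {m : nat}.
Implicit Type f : 'rV[R]_n -> 'rV[R]_m.

Definition component f (i : 'I_m) : 'rV[R]_n -> R := fun x => f x 0 i.

Definition C2_around f (xb : 'rV[R]_n) : Prop :=
  \forall x \near xb, differentiable f x /\
    forall i, differentiable (grad (component f i)) x /\
              {for x, continuous (hess (component f i))}.

Definition nabla_app f (x w : 'rV[R]_n) : 'rV[R]_m := w *m 'J f x.

Definition nabla_adj f (x : 'rV[R]_n) (lam : 'rV[R]_m) : 'rV[R]_n :=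
  lam *m ('J f x)^T.

Definition nabla2 f (x w v : 'rV[R]_n) : 'rV[R]_m :=
  \row_i dotv (w *m hess (component f i) x) v.

End Derivatives.

Section Composite.
Context {R : realType} {n m : nat}.
Implicit Types (theta : 'rV[R]_m -> \bar R) (f : 'rV[R]_n -> 'rV[R]_m).

Definition MSQC theta f (xb : 'rV[R]_n) : Prop :=
  exists2 kappa : R, 0 <= kappa &
    \forall x \near xb,
      dist x (f @^-1` edom theta) <= kappa * dist (f x) (edom theta).

Definition multipliers theta f (xb vb : 'rV[R]_n) : set 'rV[R]_m :=
  [set lam | nabla_adj f xb lam = vb /\ subdifferential theta (f xb) lam].

Definition max_multipliers theta f (xb vb w : 'rV[R]_n) : set 'rV[R]_m :=
  [set lam | multipliers theta f xb vb lam /\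
     forall mu, multipliers theta f xb vb mu ->
       dotv mu (nabla2 f xb w w) <= dotv lam (nabla2 f xb w w)].

End Composite.

(* Main.v *)
Require Import Defs.
From HB Require Import structures.
From mathcomp Require Import all_boot all_order all_algebra.
From mathcomp Require Import all_classical all_reals all_analysis.
From mathcomp Require Import ring lra.
Set Implicit Arguments.
Unset Strict Implicit.
Unset Printing Implicit Defensive.
Import Order.TTheory GRing.Theory Num.Theory.
Import numFieldNormedType.Exports.
Local Open Scope classical_set_scope.
Local Open Scope ring_scope.

(** Near xb every subgradient v of phi = theta o f has, thanks to the
    subregularity condition, a multiplier lam of bounded norm: the coupling
    y = f x is an exact penalty, and a quadratic penalization yields
    approximate multipliers. The graph of the convex subdifferential of theta
    is a finite union of polyhedra (Fourier-Motzkin elimination), so its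
    tangent vectors are rays contained in it, and limits of difference
    quotients of (v, lam) show that every vector tangent to the graph of the
    subdifferential of phi has the form given by the formula.

    Conversely, for z given by the formula in direction w, small r > 0 and
    t > 0, minimize phi (xb + d) - <vb, d> + |d - t (w + r z)|^2 / (2r). The
    minimizers d_t provide the subgradients vb + (t (w + r z) - d_t) / r. Any
    cluster point w' of d_t / t gives a tangent vector, hence is again
    described by the formula; monotonicity of the rays, optimality of the
    multipliers and symmetry of the Hessians force w' = w. So t |-> d_t is a
    curve in the graph with the prescribed derivative. The same problem with
    z = 0 and r tending to 0 shows that every critical direction belongs to
    the domain of the proto-derivative. *)

(** * Scalar product, sup norm and limits along ultrafilters *)

(** MSQC leaves the multiplier set possibly unbounded, and along moving points even convergent
    multipliers may have unbounded difference quotients. Two devices compensate. A single bound [M],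
    valid for some multiplier of every subgradient near [vb], is carried along; it allows the
    parameter r to be fixed before the cluster point w' is known. And since only the adjoint images
    of the quotients converge, an actual [eta] is produced by the closedness of linear images of
    polyhedra, applied on one polyhedral piece of the graph.

    The formula has to hold for every [lamb], whereas limits deliver rays at some other multiplier.
    [ray_exchange] moves a ray between multipliers with the same adjoint image, by a second
    penalization argument instead of duality.

    Compactness is used along ultrafilters: a bounded family converges without passing to a
    subsequence, and membership in a finite union is settled once for the whole limit. Estimates use
    the sup norm and quadratic terms the scalar product; the factors [n%:R] and [m%:R] in the
    constants come from comparing the two. *)

Section Dot.
Context {R : realType} {k : nat}.
Implicit Types u v w : 'rV[R]_k.

Lemma dotvE u v : dotv u v = (u *m v^T) 0 0.
Proof. by rewrite mxE; apply: eq_bigr => i _; rewrite mxE. Qed.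

Lemma dotvC u v : dotv u v = dotv v u.
Proof. by apply: eq_bigr => i _; rewrite mulrC. Qed.

Lemma dotvDl u v w : dotv (u + v) w = dotv u w + dotv v w.
Proof. by rewrite !dotvE mulmxDl mxE. Qed.

Lemma dotvZl a u v : dotv (a *: u) v = a * dotv u v.
Proof. by rewrite !dotvE -scalemxAl mxE. Qed.

Lemma dotvNl u v : dotv (- u) v = - dotv u v.
Proof. by rewrite !dotvE mulNmx mxE. Qed.

Lemma dotvBl u v w : dotv (u - v) w = dotv u w - dotv v w.
Proof. by rewrite dotvDl dotvNl. Qed.

Lemma dot0v u : dotv 0 u = 0.
Proof. by rewrite dotvE mul0mx mxE. Qed.

Lemma dotvDr u v w : dotv u (v + w) = dotv u v + dotv u w.
Proof. by rewrite dotvC dotvDl !(dotvC u). Qed.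

Lemma dotvZr a u v : dotv u (a *: v) = a * dotv u v.
Proof. by rewrite dotvC dotvZl dotvC. Qed.

Lemma dotvNr u v : dotv u (- v) = - dotv u v.
Proof. by rewrite dotvC dotvNl dotvC. Qed.

Lemma dotvBr u v w : dotv u (v - w) = dotv u v - dotv u w.
Proof. by rewrite dotvDr dotvNr. Qed.

Lemma dotv0 u : dotv u 0 = 0.
Proof. by rewrite dotvC dot0v. Qed.

Lemma dotv_deltar u i : dotv u (delta_mx 0 i) = u 0 i.
Proof.
rewrite /dotv (bigD1 i)//= !mxE !eqxx mulr1 big1 ?addr0// => j /negPf ji.
by rewrite mxE eqxx ji mulr0.
Qed.

Lemma dotvP u v : (forall w, dotv u w = dotv v w) -> u = v.
Proof. by move=> h; apply/rowP => i; rewrite -!dotv_deltar. Qed.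

Lemma dotv_ge0 u : 0 <= dotv u u.
Proof. by apply: sumr_ge0 => i _; rewrite -expr2 sqr_ge0. Qed.

Lemma coord_norm_le u i : `|u 0 i| <= `|u|.
Proof.
have : mx_norm u = `|u| by []; rewrite mx_normrE => <-.
exact: (le_bigmax _ (fun ij : 'I_1 * 'I_k => `|u ij.1 ij.2|) (0, i)).
Qed.

Lemma norm_le_coord u (c : R) : 0 <= c -> (forall i, `|u 0 i| <= c) -> `|u| <= c.
Proof.
move=> c0 h; have : mx_norm u = `|u| by []; rewrite mx_normrE => <-.
by apply/bigmax_leP; split => // -[i j] _ /=; rewrite ord1.
Qed.

Lemma normr_dotv u v : `|dotv u v| <= k%:R * `|u| * `|v|.
Proof.
apply: le_trans (ler_norm_sum _ _ _) _.
apply: (@le_trans _ _ (\sum_(i < k) `|u| * `|v|)).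
  by apply: ler_sum => i _; rewrite normrM ler_pM// coord_norm_le.
by rewrite sumr_const card_ord -[_ *+ k]mulr_natl mulrA.
Qed.

Lemma dotv_le u v : dotv u v <= k%:R * `|u| * `|v|.
Proof. by apply: le_trans (normr_dotv u v); rewrite ler_norm. Qed.

Lemma dotv_ge u v : - (k%:R * `|u| * `|v|) <= dotv u v.
Proof. by rewrite lerNl; apply: le_trans (normr_dotv u v); rewrite ler_normr lexx orbT. Qed.

Lemma sqr_norm_le u : `|u| ^+ 2 <= dotv u u.
Proof.
rewrite -[leRHS]sqr_sqrtr ?dotv_ge0// ler_sqr ?nnegrE ?sqrtr_ge0//.
apply: norm_le_coord; rewrite ?sqrtr_ge0// => i.
rewrite -sqrtr_sqr ler_wsqrtr// /dotv (bigD1 i)//= expr2 lerDl.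
by apply: sumr_ge0 => j _; rewrite -expr2 sqr_ge0.
Qed.

Lemma norm_le_enorm u : `|u| <= enorm u.
Proof.
by rewrite -[leLHS]ger0_norm// -sqrtr_sqr ler_wsqrtr// sqr_norm_le.
Qed.

Lemma enorm_le u : enorm u <= k.+1%:R * `|u|.
Proof.
rewrite -[leRHS]ger0_norm ?mulr_ge0// -sqrtr_sqr ler_wsqrtr//.
apply: le_trans (dotv_le _ _) _; rewrite expr2 -!mulrA mulrCA [leRHS]mulrCA.
rewrite ler_wpM2l// !mulrA ler_wpM2r// -natrM ler_nat.
by rewrite mulSn mulnS; apply: leq_trans (leq_addl _ _); rewrite leq_addr.
Qed.

Lemma dotv_eq0 u : dotv u u <= 0 -> u = 0.
Proof.
move=> h; apply/eqP; rewrite -normr_eq0 -sqrf_eq0 eq_le sqr_ge0 andbT.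
exact: le_trans (sqr_norm_le u) h.
Qed.

End Dot.

Lemma dotv_mulmxl {R : realType} (k l : nat) (u : 'rV[R]_k) (M : 'M[R]_(k, l))
    (v : 'rV[R]_l) :
  dotv (u *m M) v = dotv u (v *m M^T).
Proof. by rewrite !dotvE trmx_mul trmxK mulmxA. Qed.

Lemma dotv_row_mx {R : realType} (k l : nat) (u u' : 'rV[R]_k) (v v' : 'rV[R]_l) :
  dotv (row_mx u v) (row_mx u' v') = dotv u u' + dotv v v'.
Proof. by rewrite !dotvE tr_row_mx mul_row_col mxE. Qed.

Lemma norm_row_mx_le {R : realType} (k l : nat) (u : 'rV[R]_k) (v : 'rV[R]_l) c :
  (`|row_mx u v| <= c) = (`|u| <= c) && (`|v| <= c).
Proof.
apply/idP/andP => [h|[hu hv]].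
  split; apply: norm_le_coord; rewrite ?(le_trans _ h)// => i; apply: le_trans h.
    by apply: le_trans (coord_norm_le _ (lshift l i)); rewrite row_mxEl.
  by apply: le_trans (coord_norm_le _ (rshift k i)); rewrite row_mxEr.
apply: norm_le_coord => [|i]; first exact: le_trans hu.
rewrite -(splitK i); case: (fintype.split i) => j /=; rewrite ?row_mxEl ?row_mxEr.
  exact: le_trans (coord_norm_le _ _) hu.
exact: le_trans (coord_norm_le _ _) hv.
Qed.

Section Mulmx.
Context {R : realType}.

Lemma norm_mulmx_le (k l : nat) (M : 'M[R]_(k, l)) :
  exists2 c, 0 < c & forall u : 'rV[R]_k, `|u *m M| <= c * `|u|.
Proof.
exists (k%:R * `|M^T| + 1) => [|u]; first by rewrite ltr_wpDl// mulr_ge0.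
apply: norm_le_coord => [|j]; first by rewrite !mulr_ge0// addr_ge0// mulr_ge0.
rewrite mxE; apply: le_trans (ler_norm_sum _ _ _) _.
apply: (@le_trans _ _ (\sum_(i < k) `|u| * `|M^T|)).
  apply: ler_sum => i _; rewrite normrM ler_pM// ?coord_norm_le//.
  have : mx_norm M^T = `|M^T| by []; rewrite mx_normrE => <-.
  have -> : M i j = M^T j i by rewrite mxE.
  exact: (le_bigmax _ (fun ij : 'I_l * 'I_k => `|M^T ij.1 ij.2|) (j, i)).
rewrite sumr_const card_ord -[_ *+ k]mulr_natl mulrDl mul1r.
by rewrite [`|u| * _]mulrC mulrA lerDl.
Qed.

Lemma cvg_dotv {T : Type} (F : set_system T) {FF : Filter F} (k : nat)
    (u v : T -> 'rV[R]_k) (a b : 'rV[R]_k) :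
  u @ F --> a -> v @ F --> b -> (fun x => dotv (u x) (v x)) @ F --> dotv a b.
Proof.
move=> ua vb; rewrite /dotv.
elim: (index_enum _) => [|i s IHs].
  by under eq_fun do rewrite big_nil; rewrite big_nil; exact: cvg_cst.
under eq_fun do rewrite big_cons; rewrite big_cons; apply: cvgD => //.
apply: cvgM.
  exact: cvg_comp ua (@coord_continuous _ _ _ _ _ _).
exact: cvg_comp vb (@coord_continuous _ _ _ _ _ _).
Qed.

Lemma cvg_mulmx {T : Type} (F : set_system T) {FF : Filter F} (k l : nat)
    (u : T -> 'rV[R]_k) (M : 'M[R]_(k, l)) (a : 'rV[R]_k) :
  u @ F --> a -> (fun x => u x *m M) @ F --> a *m M.
Proof.
have [c c0 hc] := norm_mulmx_le M.
move=> ua; apply/cvgrPdist_le => e e0.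
have : \forall x \near F, `|a - u x| <= e / c.
  by move/cvgrPdist_le : ua; apply; rewrite divr_gt0.
apply: filterS => x; rewrite -mulmxBl => h.
apply: le_trans (hc _) _; apply: le_trans (ler_wpM2l (ltW c0) h) _.
by rewrite mulrC divfK ?gt_eqF.
Qed.

Lemma cvg_row_mx {T : Type} (F : set_system T) {FF : Filter F} (k l : nat)
    (u : T -> 'rV[R]_k) (v : T -> 'rV[R]_l) (a : 'rV[R]_k) (b : 'rV[R]_l) :
  (fun x => row_mx (u x) (v x)) @ F --> row_mx a b <->
  u @ F --> a /\ v @ F --> b.
Proof.
split.
  move=> h; split; apply/cvgrPdist_le => e e0; move/cvgrPdist_le : h => /(_ e e0);
  by apply: filterS => x; rewrite opp_row_mx add_row_mx norm_row_mx_le => /andP[].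
move=> [ua vb]; apply/cvgrPdist_le => e e0.
move/cvgrPdist_le : ua => /(_ e e0) => h1.
move/cvgrPdist_le : vb => /(_ e e0); apply: filterS2 h1 => x h1 h2.
by rewrite opp_row_mx add_row_mx norm_row_mx_le h1.
Qed.

End Mulmx.

Lemma norm_ball_compact {R : realType} (k : nat) (c : R) : compact [set w : 'rV[R]_k | `|w| <= c].
Proof.
apply: bounded_closed_compact.
  exists c; split; first by rewrite num_real.
  by move=> x cx y /= yc; apply: le_trans yc (ltW cx).
by apply: closed_comp (@closed_le _ c) => z _; exact: norm_continuous.
Qed.

Section Ultra.
Context {R : realType} {T : Type}.

(** The image of an ultrafilter is an ultrafilter and closed balls are compact, so boundedness alone
    yields a limit. This takes the place of extracting subsequences. *)
Lemma ultra_bounded_cvg (U : set_system T) {UU : UltraFilter U} (N : nat)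
    (h : T -> 'rV[R]_N) (M : R) :
  (\forall x \near U, `|h x| <= M) -> exists2 l, h @ U --> l & `|l| <= M.
Proof.
move=> hM.
have cB := @norm_ball_compact R N M.
have UI : UltraFilter (h @ U).
  split; first exact: fmap_proper_filter.
  move=> G GF UG; rewrite predeqE => A; split => [GA|]; last exact: UG.
  have [//|nA] := in_ultra_setVsetC (h @^-1` A) UU.
  have /UG GnA : (h @ U) (~` A) by [].
  by have /filter_ex[? []] : G (A `&` ~` A) by exact: filterI.
move: cB; rewrite compact_ultra => /(_ _ UI hM)[l [lM hl]].
by exists l.
Qed.

(** An ultrafilter contains a member of every finite cover of one of its sets. It serves to stay in
    a single polyhedral piece along a whole limit. *)
Lemma ultra_pigeonhole (U : set_system T) {UU : UltraFilter U} (I : finType)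
    (P : I -> T -> Prop) :
  (\forall x \near U, exists i, P i x) -> exists i, \forall x \near U, P i x.
Proof.
move=> h; apply: contrapT => /forallNP nP.
have nP' i : \forall x \near U, ~ P i x.
  by have [|//] := in_ultra_setVsetC [set x | P i x] UU => /nP.
have : \forall x \near U, forall i, ~ P i x.
  exact: filter_forall.
move=> /(filterI h)/filter_ex[x [[i Pi] nPi]]; exact: (nPi i).
Qed.

(** If convergence failed for some [e], the traces of [F] on the set of bad points would generate a
    proper filter, and an ultrafilter above it would contradict the hypothesis. Limits can thus be
    identified one ultrafilter at a time. *)
Lemma cvg_ultra (V : normedModType R) (F : set_system T) {FF : Filter F}
    (h : T -> V) (l : V) :
  (forall U, UltraFilter U -> F `<=` U -> h @ U --> l) -> h @ F --> l.
Proof.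
move=> hU; apply/cvgrPdist_le => e e0; apply: contrapT => nF.
pose A := [set x | `|l - h x| <= e].
have PF : ProperFilter (filter_from F (fun B => B `&` ~` A)).
  apply: filter_from_proper.
    apply: filter_from_filter; first by exists setT; exact: filterT.
    by move=> B C FB FC; exists (B `&` C); [exact: filterI|move=> x [[? ?] ?]].
  move=> B FB; apply: contrapT => /set0P/negP/negPn/eqP B0; apply: nF.
  apply: filterS FB => x Bx; apply: contrapT => nAx.
  by have : (B `&` ~` A) x by []; rewrite B0.
have [G [GU FG]] := ultraFilterLemma PF.
have : h @ G --> l.
  by apply: hU => // B FB; apply: FG; exists B => // x [].
move/cvgrPdist_le => /(_ e e0) GA.
have GnA : G (~` A) by apply: FG; exists setT; [exact: filterT|move=> x []].
by have [x []] := @filter_ex _ G _ _ (@filterI _ G _ _ _ GA GnA).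
Qed.

End Ultra.

(** [tangent] asks for sequences: choosing, for each i, an index where all errors are below 1/(i+1)
    extracts one from a limit along any proper filter. *)
Lemma tangent_filter {R : realType} {T : Type} (k : nat) (Om : set 'rV[R]_k)
    (x : 'rV[R]_k) (F : set_system T) {FF : ProperFilter F}
    (t : T -> R) (w : T -> 'rV[R]_k) (l : 'rV[R]_k) :
  (\forall a \near F, 0 < t a) -> t @ F --> (0 : R) -> w @ F --> l ->
  (\forall a \near F, Om (x + t a *: w a)) -> tangent Om x l.
Proof.
move=> t0 t0' wl hOm.
have ex (i : nat) : exists a, [/\ 0 < t a, `|t a| <= i.+1%:R^-1,
    `|l - w a| <= i.+1%:R^-1 & Om (x + t a *: w a)].
  have i0 : 0 < i.+1%:R^-1 :> R by rewrite invr_gt0.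
  move/cvgrPdist_le : t0' => /(_ _ i0) h1.
  move/cvgrPdist_le : wl => /(_ _ i0) h2.
  have [a [[? +] [? ?]]] := filter_ex (filterI (filterI t0 h1) (filterI h2 hOm)).
  by rewrite sub0r normrN; exists a.
have [a ha] := choice ex.
have lim0 : (fun i : nat => i.+1%:R^-1 : R) @ \oo --> 0 by exact: cvg_harmonic.
exists (t \o a), (w \o a); split => /=.
- by move=> i; case: (ha i).
- apply/cvgrPdist_le => e e0; move/cvgrPdist_le : lim0 => /(_ e e0).
  apply: filterS => i; rewrite !sub0r !normrN => h; apply: le_trans h.
  by case: (ha i) => _ h1 _ _; rewrite [leRHS]ger0_norm.
- apply/cvgrPdist_le => e e0; move/cvgrPdist_le : lim0 => /(_ e e0).
  apply: filterS => i; rewrite sub0r normrN => h; apply: le_trans h.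
  by case: (ha i) => _ _ h1 _; rewrite [leRHS]ger0_norm.
- by move=> i; case: (ha i).
Qed.

Lemma cvg_le {R : realType} {T : Type} (F : set_system T) {FF : ProperFilter F}
    (f g : T -> R) (a b : R) :
  f @ F --> a -> g @ F --> b -> (\forall x \near F, f x <= g x) -> a <= b.
Proof.
move=> fa gb h; rewrite -subr_ge0.
apply: (@cvgr_to_ge _ F _ _ (fun x => g x - f x)); first exact: cvgB.
by apply: filterS h => x; rewrite subr_ge0.
Qed.

(** * Fourier-Motzkin elimination *)

Section Polyhedra.
Context {R : realType}.

Definition psat {l : nat} (L : seq ('rV[R]_l * R)) (z : 'rV[R]_l) : Prop :=
  forall e, e \in L -> dotv e.1 z <= e.2.

Definition sat2 {l k : nat} (L : seq ('rV[R]_l * 'rV[R]_k * R))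
    (z : 'rV[R]_l) (y : 'rV[R]_k) : Prop :=
  forall e, e \in L -> dotv e.1.1 z + dotv e.1.2 y <= e.2.

Lemma separating_point (lo up : seq R) :
  (forall a b, a \in lo -> b \in up -> a <= b) ->
  exists x, (forall a, a \in lo -> a <= x) /\ (forall b, b \in up -> x <= b).
Proof.
elim: lo => [_|a lo IH h].
  elim: up => [|b up [x [_ IH]]]; first by exists 0.
  exists (Num.min b x); split => // c.
  by rewrite inE => /predU1P[->|/IH cx]; rewrite ge_min ?lexx// cx orbT.
have [|x [xlo xup]] := IH.
  by move=> b c blo; apply: h; rewrite inE blo orbT.
exists (Num.max a x); split => [b|b bup].
  by rewrite inE => /predU1P[->|/xlo bx]; rewrite le_max ?lexx// bx orbT.
by rewrite ge_max xup// h// mem_head.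
Qed.

(** The first coordinate [s] is eliminated. Constraints without it are kept; a constraint of [Lp]
    bounds [s] above, one of [Ln] bounds it below, and each pair is combined with the positive
    weights that cancel [s]. *)
Lemma fourier_motzkin_step (l k : nat) (L : seq ('rV[R]_l * 'rV[R]_(1 + k) * R)) :
  exists L' : seq ('rV[R]_l * 'rV[R]_k * R), forall z y,
    (exists s : R, sat2 L z (row_mx s%:M y)) <-> sat2 L' z y.
Proof.
pose c0 (e : 'rV[R]_l * 'rV[R]_(1 + k) * R) := lsubmx e.1.2 0 0.
pose r (e : 'rV[R]_l * 'rV[R]_(1 + k) * R) := rsubmx e.1.2.
pose comb p q := (c0 p *: q.1.1 - c0 q *: p.1.1, c0 p *: r q - c0 q *: r p,
                  c0 p * q.2 - c0 q * p.2).
pose L0 := [seq (e.1.1, r e, e.2) | e <- L & c0 e == 0].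
pose Lp := [seq e <- L | 0 < c0 e].
pose Ln := [seq e <- L | c0 e < 0].
exists (L0 ++ [seq comb p q | p <- Lp, q <- Ln]) => z y.
have dE e s : dotv e.1.2 (row_mx s%:M y) = c0 e * s + dotv (r e) y.
  by rewrite -{1}[e.1.2]hsubmxK dotv_row_mx [X in X + _]/dotv big_ord1 [s%:M _ _]mxE mulr1n.
pose gap (e : 'rV[R]_l * 'rV[R]_(1 + k) * R) := e.2 - dotv e.1.1 z - dotv (r e) y.
have satE s : sat2 L z (row_mx s%:M y) <-> forall e, e \in L -> c0 e * s <= gap e.
  by split=> h e eL; move: (h e eL); rewrite dE /gap => ?; lra.
split.
  move=> [s /satE hs] e; rewrite mem_cat => /orP[/mapP[e']|/allpairsP[[p q]] /=].
    rewrite mem_filter => /andP[/eqP c0e' e'L] -> /=.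
    by move: (hs _ e'L); rewrite c0e' mul0r /gap => ?; lra.
  rewrite !mem_filter => -[/andP[p0 pL] /andP[q0 qL] ->] /=.
  rewrite !dotvBl !dotvZl.
  have := ler_wpM2l (ltW p0) (hs _ qL).
  have := ler_wnM2l (ltW q0) (hs _ pL).
  by rewrite /gap => ? ?; nra.
move=> h.
have [|x [xlo xup]] := @separating_point
    [seq gap e / c0 e | e <- Ln] [seq gap e / c0 e | e <- Lp].
  move=> _ _ /mapP[q + ->] /mapP[p + ->]; rewrite !mem_filter.
  move=> /andP[q0 qL] /andP[p0 pL].
  have : comb p q \in L0 ++ [seq comb p q | p <- Lp, q <- Ln].
    rewrite mem_cat; apply/orP; right; apply/allpairsP; exists (p, q).
    by rewrite !mem_filter /= p0 q0 pL qL.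
  move/h => /=; rewrite !dotvBl !dotvZl => hpq.
  rewrite ler_pdivlMr// mulrAC ler_ndivrMr//.
  by rewrite /gap; lra.
exists x; apply/satE => e eL; have [e0|e0|e0] := ltgtP (c0 e) 0.
- have : gap e / c0 e <= x.
    by apply: xlo; apply: (map_f (fun e => gap e / c0 e)); rewrite mem_filter e0.
  by rewrite ler_ndivrMr// mulrC.
- have : x <= gap e / c0 e.
    by apply: xup; apply: (map_f (fun e => gap e / c0 e)); rewrite mem_filter e0.
  by rewrite ler_pdivlMr// mulrC.
- have : (e.1.1, r e, e.2) \in L0 ++ [seq comb p q | p <- Lp, q <- Ln].
    rewrite mem_cat; apply/orP; left; apply/mapP; exists e => //.
    by rewrite mem_filter e0 eqxx.
  by move/h => /=; rewrite e0 mul0r /gap => ?; lra.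
Qed.

Lemma fourier_motzkin (k l : nat) (L : seq ('rV[R]_l * 'rV[R]_k * R)) :
  exists L' : seq ('rV[R]_l * R), forall z,
    (exists y, sat2 L z y) <-> psat L' z.
Proof.
elim: k L => [|k IH] L.
  exists [seq (e.1.1, e.2) | e <- L] => z; split.
    move=> [y hy] _ /mapP[e eL ->] /=.
    by have := hy _ eL; rewrite [dotv _ y]/dotv big_ord0 addr0.
  move=> h; exists 0 => e eL; rewrite dotv0 addr0.
  by apply: (h (e.1.1, e.2)); apply/mapP; exists e.
have [L1 hL1] := @fourier_motzkin_step l k L.
have [L' hL'] := IH L1.
exists L' => z; rewrite -hL'; split.
  move=> [y hy]; exists (rsubmx (y : 'rV_(1 + k))); apply/hL1.
  exists (lsubmx (y : 'rV_(1 + k)) 0 0).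
  by rewrite -mx11_scalar hsubmxK.
by move=> [y /hL1[s hs]]; exists (row_mx s%:M y).
Qed.

(** Farkas' lemma by elimination: [L] describes the pairs with [nu = mu *m M] and [mu] nonnegative,
    so eliminating [mu] presents the cone generated by the rows of [M] as a polyhedron. Each of its
    constraints is nonpositive on the rows, hence is itself an admissible test vector [u]. *)
Lemma polar_polyhedral (p l : nat) (M : 'M[R]_(p, l)) :
  exists L : seq ('rV[R]_l * R), forall nu,
    (forall u, (forall j, dotv (row j M) u <= 0) -> dotv nu u <= 0) <-> psat L nu.
Proof.
pose L := [seq ((delta_mx 0 i : 'rV[R]_l), - ((delta_mx 0 i : 'rV[R]_l) *m M^T), 0)
          | i <- enum 'I_l]
  ++ [seq (- (delta_mx 0 i : 'rV[R]_l), (delta_mx 0 i : 'rV[R]_l) *m M^T, 0) | i <- enum 'I_l]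
  ++ [seq ((0 : 'rV[R]_l), - (delta_mx 0 j : 'rV[R]_p), (0 : R)) | j <- enum 'I_p].
have satL nu mu : sat2 L nu mu <-> nu = mu *m M /\ forall j, 0 <= mu 0 j.
  split=> [h|[-> mu0] e].
    split.
      apply/rowP => i; apply/eqP; rewrite eq_le; apply/andP; split.
        have /h /= : ((delta_mx 0 i : 'rV[R]_l), - ((delta_mx 0 i : 'rV[R]_l) *m M^T), 0) \in L.
          by rewrite mem_cat; apply/orP; left; apply/map_f; rewrite mem_enum.
        rewrite dotvNl dotv_mulmxl trmxK ![dotv (delta_mx _ _) _]dotvC.
        by rewrite !dotv_deltar subr_le0.
      have /h /= : (- (delta_mx 0 i : 'rV[R]_l), (delta_mx 0 i : 'rV[R]_l) *m M^T, 0) \in L.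
        rewrite !mem_cat; apply/orP; right; apply/orP; left.
        by apply/map_f; rewrite mem_enum.
      rewrite dotvNl dotv_mulmxl trmxK ![dotv (delta_mx _ _) _]dotvC.
      by rewrite !dotv_deltar addrC subr_le0.
    move=> j; have /h /= : ((0 : 'rV[R]_l), - (delta_mx 0 j : 'rV[R]_p), (0 : R)) \in L.
      rewrite !mem_cat; apply/orP; right; apply/orP; right.
      by apply: (map_f (fun j => (0, - (delta_mx 0 j : 'rV[R]_p), 0))); rewrite mem_enum.
    by rewrite dot0v dotvNl dotvC dotv_deltar add0r oppr_le0.
  rewrite !mem_cat => /or3P[/mapP[i _ ->]|/mapP[i _ ->]|/mapP[j _ ->]] /=.
  - by rewrite dotvNl dotv_mulmxl trmxK subrr.
  - by rewrite dotvNl dotv_mulmxl trmxK addNr.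
  - by rewrite dot0v dotvNl dotvC dotv_deltar add0r oppr_le0.
have [L' hL'] := fourier_motzkin L.
have cone nu : psat L' nu <-> exists mu, nu = mu *m M /\ forall j, 0 <= mu 0 j.
  by rewrite -hL'; split=> -[mu] /satL; exists mu.
exists L' => nu; split.
  move=> hnu e eL'.
  have e0 : 0 <= e.2.
    suff /(_ e eL') : psat L' 0 by rewrite dotv0.
    by apply/cone; exists 0; rewrite mul0mx; split => // j; rewrite mxE.
  apply: (le_trans _ e0); rewrite dotvC; apply: hnu => j.
  rewrite leNgt; apply/negP => pos.
  (* The cone contains all positive multiples of a row; this multiple overshoots the constraint [e]
     by exactly 1. *)
  pose s := (e.2 + 1) / dotv (row j M) e.1.
  have s0 : 0 <= s by apply: divr_ge0; [lra|exact: ltW].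
  have /(_ e eL') : psat L' (s *: row j M).
    apply/cone; exists (s *: delta_mx 0 j); split.
      by rewrite -scalemxAl -rowE.
    by move=> j'; rewrite !mxE mulr_ge0.
  by rewrite dotvZr dotvC /s divfK ?gt_eqF// => ?; lra.
move=> /cone[mu [-> mu0]] u hu.
rewrite dotv_mulmxl /dotv; apply: sumr_le0 => j _.
rewrite mulr_ge0_le0//; have := hu j.
by rewrite rowE dotv_mulmxl dotvC dotv_deltar.
Qed.

Lemma psat_closed {T : Type} (F : set_system T) {FF : ProperFilter F} (l : nat)
    (L : seq ('rV[R]_l * R)) (z : T -> 'rV[R]_l) z0 :
  z @ F --> z0 -> (\forall a \near F, psat L (z a)) -> psat L z0.
Proof.
move=> zz0 h e eL.
apply: (@cvg_le _ _ F _ (fun a => dotv e.1 (z a)) (cst e.2)) => //.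
- by apply: cvg_dotv => //; exact: cvg_cst.
- exact: cvg_cst.
- by apply: filterS h => a; exact.
Qed.

Lemma sat2_closed {T : Type} (F : set_system T) {FF : ProperFilter F} (l k : nat)
    (L : seq ('rV[R]_l * 'rV[R]_k * R)) (z : T -> 'rV[R]_l) z0
    (y : T -> 'rV[R]_k) y0 :
  z @ F --> z0 -> y @ F --> y0 -> (\forall a \near F, sat2 L (z a) (y a)) ->
  sat2 L z0 y0.
Proof.
move=> zz0 yy0 h e eL.
apply: (@cvg_le _ _ F _ (fun a => dotv e.1.1 (z a) + dotv e.1.2 (y a))
  (cst e.2)) => //.
- by apply: cvgD; apply: cvg_dotv => //; exact: cvg_cst.
- exact: cvg_cst.
- by apply: filterS h => a; exact.
Qed.

(** The equation [y *m M = x] is added to [L] as two families of inequalities and [y] is eliminated,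
    which leaves a closed polyhedron in (z, x). The given [y] may be unbounded, and the one obtained
    in the limit need not be a limit of them. *)
Lemma image_polyhedral_closed {T : Type} (F : set_system T) {FF : ProperFilter F}
    (l k n : nat) (L : seq ('rV[R]_l * 'rV[R]_k * R)) (M : 'M[R]_(k, n))
    (z : T -> 'rV[R]_l) z0 (x : T -> 'rV[R]_n) x0 :
  z @ F --> z0 -> x @ F --> x0 ->
  (\forall a \near F, exists2 y, sat2 L (z a) y & y *m M = x a) ->
  exists2 y, sat2 L z0 y & y *m M = x0.
Proof.
move=> zz0 xx0 h.
pose L2 := [seq (row_mx e.1.1 (0 : 'rV[R]_n), e.1.2, e.2) | e <- L]
  ++ [seq (row_mx (0 : 'rV[R]_l) (- (delta_mx 0 i : 'rV[R]_n)), (delta_mx 0 i : 'rV[R]_n) *m M^T, 0)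
     | i <- enum 'I_n]
  ++ [seq (row_mx (0 : 'rV[R]_l) (delta_mx 0 i : 'rV[R]_n), - ((delta_mx 0 i : 'rV[R]_n) *m M^T), 0)
     | i <- enum 'I_n].
have satL2 a b y : sat2 L2 (row_mx a b) y <-> sat2 L a y /\ y *m M = b.
  split=> [h2|[hL <-] e].
    split.
      move=> e eL; have /h2 /= : (row_mx e.1.1 (0 : 'rV[R]_n), e.1.2, e.2) \in L2.
        by rewrite mem_cat; apply/orP; left; apply/mapP; exists e.
      by rewrite dotv_row_mx dot0v addr0.
    apply/rowP => i; apply/eqP; rewrite eq_le; apply/andP; split.
      have /h2 /= : (row_mx (0 : 'rV[R]_l) (- (delta_mx 0 i : 'rV[R]_n)),
          (delta_mx 0 i : 'rV[R]_n) *m M^T, 0)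
          \in L2.
        rewrite !mem_cat; apply/orP; right; apply/orP; left.
        apply: (map_f (fun i => (row_mx (0 : 'rV[R]_l) (- (delta_mx 0 i : 'rV[R]_n)),
          (delta_mx 0 i : 'rV[R]_n) *m M^T, 0))).
        by rewrite mem_enum.
      rewrite dotv_row_mx dot0v add0r dotvNl dotv_mulmxl trmxK.
      by rewrite ![dotv (delta_mx _ _) _]dotvC !dotv_deltar addrC subr_le0.
    have /h2 /= : (row_mx (0 : 'rV[R]_l) (delta_mx 0 i : 'rV[R]_n),
        - ((delta_mx 0 i : 'rV[R]_n) *m M^T), 0)
          \in L2.
      rewrite !mem_cat; apply/orP; right; apply/orP; right.
      apply: (map_f (fun i => (row_mx (0 : 'rV[R]_l) (delta_mx 0 i : 'rV[R]_n),
          - ((delta_mx 0 i : 'rV[R]_n) *m M^T), 0))).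
      by rewrite mem_enum.
    rewrite dotv_row_mx dot0v add0r dotvNl dotv_mulmxl trmxK.
    by rewrite ![dotv (delta_mx _ _) _]dotvC !dotv_deltar subr_le0.
  rewrite !mem_cat => /or3P[/mapP[e' e'L ->]|/mapP[i _ ->]|/mapP[j _ ->]] /=.
  - by rewrite dotv_row_mx dot0v addr0; exact: hL.
  - by rewrite dotv_row_mx dot0v dotvNl dotv_mulmxl trmxK add0r addNr.
  - by rewrite dotv_row_mx dot0v dotvNl dotv_mulmxl trmxK add0r subrr.
have [L' hL'] := fourier_motzkin L2.
suff /hL'[y /satL2[]] : psat L' (row_mx z0 x0) by exists y.
apply: (@psat_closed _ F _ _ _ (fun a => row_mx (z a) (x a))).
  by apply/cvg_row_mx.
apply: filterS h => a [y ya yx].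
by apply/hL'; exists y; apply/satL2.
Qed.

End Polyhedra.

(** * First and second order expansions *)

Section ScalarCalculus.
Context {R : realType} {n : nat}.
Implicit Types (g : 'rV[R]_n -> R) (x d h : 'rV[R]_n).

Lemma differentiable_expansion {V W : normedModType R} (g : V -> W) (x : V) :
  differentiable g x -> forall e : R, 0 < e ->
  \forall h \near (0 : V), `|g (x + h) - g x - 'd g x h| <= e * `|h|.
Proof.
move=> /diff_locally/eqaddoP dg e /dg; apply: filterS => h /=.
suff -> : g (x + h) - g x - 'd g x h = (g \o shift x - (cst (g x) + 'd g x)) h by [].
by rewrite -[RHS]/(g (h + x) - (g x + 'd g x h)) opprD addrA [h + x]addrC.
Qed.

Lemma derive_grad g x d : differentiable g x -> 'd g x d = dotv (grad g x) d.
Proof.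
move=> dg; rewrite {1}(row_sum_delta d) linear_sum /dotv.
by apply: eq_bigr => j _; rewrite linearZ mxE deriveE// [RHS]mulrC.
Qed.

Lemma is_derive_line g x d s : differentiable g (x + s *: d) ->
  is_derive s 1 (fun s : R => g (x + s *: d)) (dotv (grad g (x + s *: d)) d).
Proof.
move=> dg.
have E : (fun h : R => h^-1 *: (((fun s : R => g (x + s *: d)) \o shift s) (h *: 1)
     - (fun s : R => g (x + s *: d)) s)) =
   (fun h : R => h^-1 *: ((g \o shift (x + s *: d)) (h *: d) - g (x + s *: d))).
  apply/funext => h /=; congr (_ *: (g _ - _)).
  by rewrite [h *: 1]mulr1 scalerDl addrCA.
split; first by rewrite /derivable E; exact: diff_derivable.
by rewrite /derive E -derive_grad// -deriveE.
Qed.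

Lemma mvt01 (f df : R -> R) :
  (forall s : R, 0 <= s <= 1 -> is_derive s 1 f (df s)) ->
  exists2 s : R, 0 <= s <= 1 & f 1 - f 0 = df s.
Proof.
move=> h; have [|||s s01 E] := @MVT R f df 0 1 => //.
- by move=> s; rewrite in_itv/= => /andP[/ltW s0 /ltW s1]; apply: h; rewrite s0.
- apply: derivable_within_continuous => s; rewrite in_itv/= => s01.
  by have [] := h _ s01.
exists s; last by rewrite E subr0 mulr1.
by move: s01; rewrite in_itv/= => /andP[/ltW -> /ltW ->].
Qed.

Lemma mean_value g x d :
  (forall s : R, 0 <= s <= 1 -> differentiable g (x + s *: d)) ->
  exists2 s : R, 0 <= s <= 1 & g (x + d) - g x = dotv (grad g (x + s *: d)) d.
Proof.
move=> dg.
have [s s01 E] := @mvt01 (fun s => g (x + s *: d))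
  (fun s => dotv (grad g (x + s *: d)) d) (fun s s01 => is_derive_line (dg s s01)).
by exists s => //; rewrite -E scale1r scale0r addr0.
Qed.

Lemma near0_norm_ball (V : normedModType R) (P : V -> Prop) :
  (\forall k \near (0 : V), P k) ->
  exists2 e : R, 0 < e & forall k : V, `|k| <= e -> P k.
Proof.
move=> /nbhs_norm0P[e /= e0 he]; exists (e / 2); first by rewrite divr_gt0.
by move=> k hk; apply: he => /=; apply: le_lt_trans hk _; rewrite gtr_pMr//; lra.
Qed.

Lemma near_norm_ball (V : normedModType R) (a : V) (P : V -> Prop) :
  (\forall y \near a, P y) ->
  exists2 e : R, 0 < e & forall k : V, `|k| <= e -> P (a + k).
Proof.
by move=> /nbhs0P/near0_norm_ball[e e0 he]; exists e => // k /he.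
Qed.

Lemma near_of_ball (V : normedModType R) (a : V) (P : V -> Prop) (e : R) :
  0 < e -> (forall k : V, `|k| <= e -> P (a + k)) -> \forall y \near a, P y.
Proof.
by move=> e0 he; apply/nbhs0P/nbhs_norm0P; exists e => //= k /ltW; exact: he.
Qed.

Definition twice_diff g (x : 'rV[R]_n) : Prop :=
  (\forall y \near x, differentiable g y) /\ differentiable (grad g) x.

Lemma grad_expansion g x : twice_diff g x -> forall e : R, 0 < e ->
  exists2 r : R, 0 < r & forall h, `|h| <= r ->
  `|grad g (x + h) - grad g x - h *m hess g x| <= e * `|h|.
Proof.
move=> [_ dg] e e0; have /near0_norm_ball[r r0 hr] := differentiable_expansion dg e0.
by exists r => // h /hr; rewrite -deriveE// deriveEjacobian.
Qed.

(** The mean value theorem is applied to the difference between [g] and its second-order model along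
    the segment; the derivative of this difference is the first-order error of [grad g]. *)
Lemma taylor2 g x : twice_diff g x -> forall e : R, 0 < e ->
  exists2 r : R, 0 < r & forall h, `|h| <= r ->
  `|g (x + h) - g x - dotv (grad g x) h - 2^-1 * dotv (h *m hess g x) h|
    <= e * `|h| ^+ 2.
Proof.
move=> dg e e0; have n0 : (0 : R) < n.+1%:R by [].
have [r1 r10 hr1] := grad_expansion dg (divr_gt0 e0 n0).
have [r2 r20 hr2] := near_norm_ball dg.1.
exists (Num.min r1 r2) => [|h]; first by rewrite lt_min r10.
rewrite le_min => /andP[h1 h2].
have small (s c : R) : 0 <= s <= 1 -> `|h| <= c -> `|s *: h| <= c.
  move=> /andP[s0 s1]; apply: le_trans; rewrite normrZ ger0_norm//.
  by rewrite ler_piMl.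
pose a := dotv (grad g x) h; pose b := dotv (h *m hess g x) h.
have [|s s01 /= E] := @mvt01 (fun s => g (x + s *: h) - s * a - s ^+ 2 * (2^-1 * b))
   (fun s => dotv (grad g (x + s *: h)) h - a - s * b).
  move=> s s01.
  have D := is_derive_line (hr2 _ (small s r2 s01 h2)).
  by apply: is_derive_eq; rewrite /GRing.scale /=; field.
have -> : g (x + h) - g x - a - 2^-1 * b =
    dotv (grad g (x + s *: h) - grad g x - s *: h *m hess g x) h.
  rewrite !dotvBl -scalemxAl dotvZl -/a -/b -E scale1r scale0r addr0.
  by field.
apply: le_trans (normr_dotv _ _) _.
have := hr1 _ (small s r1 s01 h1).
move: s01 => /andP[s0 s1]; rewrite normrZ (ger0_norm s0) => H.
apply: (@le_trans _ _ (n%:R * (e / n.+1%:R * `|h|) * `|h|)).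
  rewrite ler_wpM2r// ler_wpM2l// (le_trans H)// ler_wpM2l//.
    by rewrite ltW ?divr_gt0.
  by rewrite ler_piMl.
rewrite expr2 [leRHS]mulrA ler_wpM2r// mulrA ler_wpM2r// mulrCA ler_piMr ?(ltW e0)//.
by rewrite ler_pdivrMr// mul1r ler_nat.
Qed.

(** Schwarz's theorem from differentiability of the gradient at [x]: the second difference [D] over
    the parallelogram spanned by [s *: u] and [s *: v] is computed by the mean value theorem along
    either side, and each computation gives one of the two mixed terms up to o(s^2). *)
Lemma hess_sym g x : twice_diff g x ->
  forall u v, dotv (u *m hess g x) v = dotv (v *m hess g x) u.
Proof.
move=> dg; suff le_sym u v (e : R) : 0 < e ->
    dotv (u *m hess g x) v <= dotv (v *m hess g x) u + e.
  by move=> u v; apply/eqP; rewrite eq_le; apply/andP; split;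
    apply/ler_addgt0Pr => e; exact: le_sym.
move=> e0.
pose K := `|u| + `|v| + 1.
have K0 : 0 < K by rewrite ltr_wpDl// addr_ge0.
(* Four gradient errors enter, two for each expression of [D]; this constant bounds each by
   [s * (e / 4)]. *)
pose e1 := e / (4 * (n%:R + 1) * K * K).
have n0 : 0 < (n%:R + 1 : R) by rewrite ltr_wpDl.
have e10 : 0 < e1 by rewrite divr_gt0// !mulr_gt0.
have [r1 r10 hr1] := grad_expansion dg e10.
have [r2 r20 hr2] := near_norm_ball dg.1.
pose s := Num.min r1 r2 / K.
have s0 : 0 < s by rewrite divr_gt0// lt_min r10.
have sK (c d : R) : `|c *: u + d *: v| <= K -> `|s *: (c *: u + d *: v)| <= Num.min r1 r2.
  move=> h; rewrite normrZ gtr0_norm// /s -[leRHS]mulr1 -mulrA.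
  rewrite ler_wpM2l ?le_min ?(ltW r10) ?(ltW r20)//.
  by rewrite mulrC ler_pdivrMr// mul1r.
have bK (c d : R) : 0 <= c <= 1 -> 0 <= d <= 1 -> `|c *: u + d *: v| <= K.
  move=> /andP[c0 c1] /andP[d0 d1]; apply: le_trans (ler_normD _ _) _.
  rewrite !normrZ (ger0_norm c0) (ger0_norm d0) /K.
  have := ler_piMl (normr_ge0 u) c1; have := ler_piMl (normr_ge0 v) d1; lra.
pose q (c d : R) := s *: (c *: u + d *: v).
have qin (c d : R) : 0 <= c <= 1 -> 0 <= d <= 1 ->
    differentiable g (x + q c d) /\
    `|grad g (x + q c d) - grad g x - q c d *m hess g x| <= e1 * (s * K).
  move=> c01 d01; have := sK _ _ (bK _ _ c01 d01); rewrite le_min => /andP[q1 q2].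
  split; first exact: hr2.
  apply: le_trans (hr1 _ q1) _; rewrite ler_wpM2l// ?(ltW e10)//.
  by rewrite normrZ gtr0_norm// ler_wpM2l ?(ltW s0)// bK.
pose D := g (x + q 1 1) - g (x + q 1 0) - g (x + q 0 1) + g (x + q 0 0).
have i01 : (0 : R) <= (1 : R) <= 1 by apply/andP; split.
have i00 : (0 : R) <= (0 : R) <= 1 by apply/andP; split.
have err (c d : R) (w : 'rV[R]_n) : 0 <= c <= 1 -> 0 <= d <= 1 -> `|w| <= K ->
    `|dotv (grad g (x + q c d) - grad g x - q c d *m hess g x) w|
       <= s * (e / 4).
  move=> c01 d01 wK; apply: le_trans (normr_dotv _ _) _.
  have [_ h] := qin _ _ c01 d01.
  apply: (@le_trans _ _ ((n%:R + 1) * (e1 * (s * K)) * K)).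
    by apply: ler_pM => //; rewrite ?mulr_ge0// ler_pM// lerDl.
  rewrite /e1 le_eqVlt; apply/orP; left; apply/eqP; field.
  by rewrite !gt_eqF.
have uK : `|u| <= K by rewrite /K -addrA lerDl addr_ge0.
have vK : `|v| <= K by rewrite /K addrAC addrC lerDl addr_ge0.
have D1 : exists2 c : R, 0 <= c <= 1 &
    D = s * dotv (grad g (x + q c 1) - grad g (x + q c 0)) u.
  have qE (c d : R) : x + q c d = x + q 0 d + c *: (s *: u).
    by rewrite /q scale0r add0r scalerDr !scalerA [s * c]mulrC addrA addrAC.
  have [|c c01 E] := @mvt01
    (fun c => g (x + q 0 1 + c *: (s *: u)) - g (x + q 0 0 + c *: (s *: u)))
    (fun c => dotv (grad g (x + q c 1)) (s *: u) - dotv (grad g (x + q c 0)) (s *: u)).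
    move=> c c01; rewrite !(qE c).
    have := (qin c 1 c01 i01).1; rewrite qE => /is_derive_line H1.
    have := (qin c 0 c01 i00).1; rewrite qE => /is_derive_line H2.
    exact: is_deriveB.
  exists c => //; move: E; rewrite -!qE /D dotvBl !dotvZr mulrBr => <-.
  by rewrite opprB; ring.
have D2 : exists2 c : R, 0 <= c <= 1 &
    D = s * dotv (grad g (x + q 1 c) - grad g (x + q 0 c)) v.
  have qE (c d : R) : x + q c d = x + q c 0 + d *: (s *: v).
    by rewrite /q scale0r addr0 scalerDr !scalerA [s * d]mulrC addrA.
  have [|c c01 E] := @mvt01
    (fun c => g (x + q 1 0 + c *: (s *: v)) - g (x + q 0 0 + c *: (s *: v)))
    (fun c => dotv (grad g (x + q 1 c)) (s *: v) - dotv (grad g (x + q 0 c)) (s *: v)).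
    move=> c c01; rewrite !(qE _ c).
    have := (qin 1 c i01 c01).1; rewrite qE => /is_derive_line H1.
    have := (qin 0 c i00 c01).1; rewrite qE => /is_derive_line H2.
    exact: is_deriveB.
  exists c => //; move: E; rewrite -!qE /D dotvBl !dotvZr mulrBr => <-.
  by rewrite opprB; ring.
case: D1 => c c01 D1; case: D2 => d d01 D2.
have := err c 1 u c01 i01 uK; have := err c 0 u c01 i00 uK.
have := err 1 d v i01 d01 vK; have := err 0 d v i00 d01 vK.
rewrite !dotvBl !ler_norml => /andP[a1 a2] /andP[a3 a4] /andP[a5 a6] /andP[a7 a8].
move: D1 D2; rewrite !dotvBl => D1 D2.
have Q1 : dotv (q c 1 *m hess g x) u = dotv (q c 0 *m hess g x) u
    + s * dotv (v *m hess g x) u.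
  by rewrite -dotvZl scalemxAl -dotvDl -mulmxDl /q -scalerDr scale1r scale0r addr0.
have Q2 : dotv (q 1 d *m hess g x) v = dotv (q 0 d *m hess g x) v
    + s * dotv (u *m hess g x) v.
  rewrite -dotvZl scalemxAl -dotvDl -mulmxDl /q -scalerDr scale1r scale0r add0r.
  by rewrite [u + _]addrC.
rewrite -(ler_pM2l s0) mulrDr.
have DD : dotv (grad g (x + q c 1)) u - dotv (grad g (x + q c 0)) u =
   dotv (grad g (x + q 1 d)) v - dotv (grad g (x + q 0 d)) v.
  by apply: (mulfI (lt0r_neq0 s0)); rewrite -D1 D2.
lra.
Qed.

End ScalarCalculus.

(** * Scalarized Hessians and expansions of [f] around [xb] *)

Section VectorCalculus.
Context {R : realType} {n m : nat}.
Implicit Types (f : 'rV[R]_n -> 'rV[R]_m) (x w : 'rV[R]_n) (lam : 'rV[R]_m).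

Lemma cvg_coord {T : Type} (F : set_system T) {FF : Filter F} (k : nat)
    (u : T -> 'rV[R]_k) (a : 'rV[R]_k) :
  (forall i : 'I_k, (fun z => u z 0 i) @ F --> a 0 i) -> u @ F --> a.
Proof.
move=> h; apply/cvgrPdist_le => e e0.
have : \forall z \near F, forall i, `|a 0 i - u z 0 i| <= e.
  by apply: filter_forall => i; move/cvgrPdist_le : (h i); apply.
apply: filterS => z hz; apply: norm_le_coord (ltW e0) _ => i.
by rewrite !mxE.
Qed.

Lemma derive_dotv f x w lam : differentiable f x ->
  'D_w (fun y => dotv lam (f y)) x = dotv lam (w *m 'J f x).
Proof.
move=> df; rewrite -deriveEjacobian//; apply: cvg_lim => //.
have /cvg_ex[l hl] := @diff_derivable _ _ _ f x w df.
have -> : 'D_w f x = l by exact: cvg_lim.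
have : (fun h : R => dotv lam (h^-1 *: ((f \o shift x) (h *: w) - f x)))
    @ 0^' --> dotv lam l.
  by apply: cvg_dotv => //; exact: cvg_cst.
by under eq_fun do rewrite dotvZr dotvBr.
Qed.

Lemma grad_dotv f x lam : differentiable f x ->
  grad (fun y => dotv lam (f y)) x = nabla_adj f x lam.
Proof.
move=> df; apply/rowP => j; rewrite mxE derive_dotv//.
by rewrite -dotv_deltar /nabla_adj dotv_mulmxl trmxK.
Qed.

Lemma dotv_adj f x lam w : dotv (nabla_adj f x lam) w = dotv lam (nabla_app f x w).
Proof. by rewrite /nabla_adj dotv_mulmxl trmxK. Qed.

Lemma componentE f i : component f i = fun x => dotv (delta_mx 0 i) (f x).
Proof. by apply/funext => x; rewrite dotvC dotv_deltar. Qed.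

Lemma grad_component f x i : differentiable f x ->
  grad (component f i) x = nabla_adj f x (delta_mx 0 i).
Proof. by move=> df; rewrite componentE grad_dotv. Qed.

Lemma nabla_adj_sum f x lam : differentiable f x ->
  nabla_adj f x lam = \sum_i lam 0 i *: grad (component f i) x.
Proof.
move=> df; rewrite {1}(row_sum_delta lam) /nabla_adj mulmx_suml.
by apply: eq_bigr => i _; rewrite -scalemxAl grad_component.
Qed.

Lemma nabla_adjB f x lam mu :
  nabla_adj f x (lam - mu) = nabla_adj f x lam - nabla_adj f x mu.
Proof. exact: mulmxBl. Qed.

Lemma nabla_adjZ f x a lam : nabla_adj f x (a *: lam) = a *: nabla_adj f x lam.
Proof. by rewrite /nabla_adj scalemxAl. Qed.

Lemma differentiable_component f x i : differentiable f x ->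
  differentiable (component f i) x.
Proof.
move=> df; apply: (@differentiable_comp _ _ _ _ f (fun N : 'rV[R]_m => N 0 i)) => //.
exact: differentiable_coord.
Qed.

Variables (f : 'rV[R]_n -> 'rV[R]_m) (xb : 'rV[R]_n).
Hypothesis f_C2 : C2_around f xb.

Lemma C2_near : \forall x \near xb, differentiable f x.
Proof. by apply: filterS f_C2 => x []. Qed.

Lemma C2_diff : differentiable f xb.
Proof. exact: nbhs_singleton C2_near. Qed.

Lemma C2_twice i : twice_diff (component f i) xb.
Proof.
split; last by have /(_ i)[] := (nbhs_singleton f_C2).2.
by apply: filterS C2_near => x; exact: differentiable_component.
Qed.

(** The Hessian of the scalarization [<lam, f>] at [xb], written so that it is visibly linear in
    [lam]. *)
Definition hess_mx lam : 'M[R]_n := \sum_i lam 0 i *: hess (component f i) xb.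

Lemma mul_hess_mx lam w :
  w *m hess_mx lam = \sum_i lam 0 i *: (w *m hess (component f i) xb).
Proof.
by rewrite /hess_mx mulmx_sumr; apply: eq_bigr => i _; rewrite scalemxAr.
Qed.

Lemma dotv_hess_mx lam w v :
  dotv (w *m hess_mx lam) v = dotv lam (nabla2 f xb w v).
Proof.
rewrite mul_hess_mx /dotv -/(dotv _ _).
rewrite -[LHS]/(dotv _ _) dotvE mulmx_suml summxE.
by apply: eq_bigr => i _; rewrite -scalemxAl mxE -dotvE [nabla2 _ _ _ _ _ _]mxE.
Qed.

Lemma nabla2_sym w v : nabla2 f xb w v = nabla2 f xb v w.
Proof. by apply/rowP => i; rewrite !mxE; apply: hess_sym; exact: C2_twice. Qed.

(** The radius is uniform in [lam]: the expansions of the component gradients are weighted by the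
    coordinates of [lam]. *)
Lemma adj_expansion (e : R) : 0 < e -> exists2 r : R, 0 < r &
  forall h lam, `|h| <= r ->
  `|nabla_adj f (xb + h) lam - nabla_adj f xb lam - h *m hess_mx lam|
    <= e * `|lam| * `|h|.
Proof.
move=> e0; have m0 : (0 : R) < m.+1%:R by [].
have em0 := divr_gt0 e0 m0.
have H (i : 'I_m) : exists r : R, 0 < r /\ forall h, `|h| <= r ->
    `|grad (component f i) (xb + h) - grad (component f i) xb
      - h *m hess (component f i) xb| <= e / m.+1%:R * `|h|.
  by have [r r0 hr] := grad_expansion (C2_twice i) em0; exists r.
have [r hr] := choice H.
have [r0 r00 hr0] := near_norm_ball C2_near.
have rmin : exists2 q : R, 0 < q & q <= r0 /\ forall i, q <= r i.
  exists (\big[Num.min/r0]_i r i).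
    elim/big_ind: _ => //[x y x0 y0|i _]; first by rewrite lt_min x0.
    by have [] := hr i.
  split; first by apply: bigmin_le_id.
  by move=> i; apply: bigmin_le_cond.
have [q q0 [qr0 qr]] := rmin; exists q => // h lam hq.
have dh := hr0 _ (le_trans hq qr0).
rewrite !nabla_adj_sum//; last exact: C2_diff.
rewrite mul_hess_mx -!sumrB; apply: le_trans (ler_norm_sum _ _ _) _.
apply: (@le_trans _ _ (\sum_(i < m) `|lam| * (e / m.+1%:R * `|h|))).
  apply: ler_sum => i _; rewrite -!scalerBr normrZ ler_pM// ?coord_norm_le//.
  by have [_] := hr i; apply; exact: le_trans (qr i).
rewrite sumr_const card_ord -[_ *+ m]mulr_natl.
rewrite (_ : e * `|lam| * `|h| = `|lam| * (e * `|h|)); last by ring.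
rewrite mulrCA ler_wpM2l// mulrA ler_wpM2r// mulrCA ler_piMr ?(ltW e0)//.
by rewrite ler_pdivrMr// mul1r ler_nat.
Qed.

(** By uniqueness of the differential: [adj_expansion] exhibits [hess_mx] as the derivative of the
    gradient of [<lam, f>]. This links [hess_mx] with the Hessian occurring in the theorem. *)
Lemma mul_hess_dotv lam w :
  w *m hess (fun x => dotv lam (f x)) xb = w *m hess_mx lam.
Proof.
rewrite /hess /jacobian mul_rV_lin1.
pose L : {linear 'rV[R]_n -> 'rV[R]_n} := mulmxr (hess_mx lam).
suff -> : 'd (grad (fun x => dotv lam (f x))) xb = L :> (_ -> _) by [].
apply: diff_unique.
  by move=> y; apply: (@cvg_mulmx R _ (nbhs y) _ n n id (hess_mx lam) y); exact: cvg_id.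
apply/eqaddoP => e e0.
have [r r0 hr] := @adj_expansion (e / (`|lam| + 1)) (divr_gt0 e0 (ltr_wpDl (normr_ge0 _) ltr01)).
have [r1 r10 hr1] := near_norm_ball C2_near.
have : \forall h \near (0 : 'rV[R]_n), `|h| <= Num.min r r1.
  apply/nbhs_norm0P; exists (Num.min r r1) => /=; first by rewrite lt_min r0.
  by move=> h /= /ltW.
apply: filterS => h; rewrite le_min => /andP[h1 h2].
rewrite -[X in `|X| <= _]/(grad (fun x => dotv lam (f x)) (h + xb)
  - (grad (fun x => dotv lam (f x)) xb + h *m hess_mx lam)).
rewrite !grad_dotv; [|exact: C2_diff|by rewrite addrC; exact: hr1].
rewrite opprD addrA [h + _]addrC; apply: le_trans (hr _ _ h1) _.
rewrite ler_wpM2r// mulrAC ler_pdivrMr ?ltr_wpDl// ler_wpM2l ?(ltW e0)//.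
by rewrite lerDl.
Qed.

Lemma nabla2Dl w w' v : nabla2 f xb (w + w') v = nabla2 f xb w v + nabla2 f xb w' v.
Proof. by apply/rowP => i; rewrite !mxE mulmxDl dotvDl. Qed.

Lemma nabla2Dr w w' v : nabla2 f xb v (w + w') = nabla2 f xb v w + nabla2 f xb v w'.
Proof. by apply/rowP => i; rewrite !mxE dotvDr. Qed.

Lemma nabla2_bound : exists2 C : R, 0 < C &
  forall w, `|nabla2 f xb w w| <= C * `|w| ^+ 2.
Proof.
have H (i : 'I_m) : exists c : R, 0 < c /\
    forall w, `|w *m hess (component f i) xb| <= c * `|w|.
  by have [c c0 hc] := norm_mulmx_le (hess (component f i) xb); exists c.
have [c hc] := choice H.
have sc0 : 0 <= \sum_i c i by apply: sumr_ge0 => i _; rewrite ltW// (hc i).1.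
exists (n%:R * (\sum_i c i) + 1); first by rewrite ltr_wpDl// mulr_ge0.
move=> w; apply: norm_le_coord => [|i].
  by rewrite mulr_ge0 ?sqr_ge0// addr_ge0// mulr_ge0.
rewrite mxE; apply: le_trans (normr_dotv _ _) _.
apply: (@le_trans _ _ (n%:R * ((\sum_i c i) * `|w|) * `|w|)); last first.
  by rewrite expr2 !mulrA ler_wpM2r// ler_wpM2r// lerDl.
rewrite ler_wpM2r// ler_wpM2l// (le_trans ((hc i).2 w))// ler_wpM2r//.
by rewrite (bigD1 i)//= lerDl; apply: sumr_ge0 => j _; rewrite ltW// (hc j).1.
Qed.

Section Limits.
Context {T : Type} (F : set_system T) {FF : ProperFilter F}.
Context (t : T -> R) (w : T -> 'rV[R]_n) (w0 : 'rV[R]_n).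
Hypothesis t_gt0 : \forall a \near F, 0 < t a.
Hypothesis t_cvg0 : t @ F --> (0 : R).
Hypothesis w_cvg : w @ F --> w0.

Lemma cvg_scaled0 : (fun a => t a *: w a) @ F --> (0 : 'rV[R]_n).
Proof. by rewrite -(scale0r w0); apply: cvgZ. Qed.

Lemma cvg_shifted : (fun a => xb + t a *: w a) @ F --> xb.
Proof.
by rewrite -[X in _ --> X]addr0; apply: cvgD cvg_scaled0; exact: cvg_cst.
Qed.

Lemma near_scaled (r : R) : 0 < r -> \forall a \near F, `|t a *: w a| <= r.
Proof.
move=> r0; move/cvgrPdist_le : cvg_scaled0 => /(_ r r0).
by apply: filterS => a; rewrite sub0r normrN.
Qed.

Lemma near_bounded : \forall a \near F, `|w a| <= `|w0| + 1.
Proof.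
move/cvgrPdist_le : w_cvg => /(_ 1 ltr01); apply: filterS => a h.
rewrite -[w a](subrK w0) addrC; apply: le_trans (ler_normD _ _) _.
by rewrite lerD2l distrC.
Qed.

(** The directions [w a] vary, so the linear term is subtracted along [w a] and not along the limit;
    otherwise the quotient by [t a ^+ 2] could diverge. *)
Lemma cvg_second_order :
  (fun a => (t a ^+ 2)^-1 *: (f (xb + t a *: w a) - f xb - t a *: nabla_app f xb (w a)))
    @ F --> 2^-1 *: nabla2 f xb w0 w0.
Proof.
apply: cvg_coord => i; rewrite mxE [nabla2 _ _ _ _ _ _]mxE.
pose H := hess (component f i) xb.
have c1 : (fun a => 2^-1 * dotv (w a *m H) (w a)) @ F --> 2^-1 * dotv (w0 *m H) w0.
  by apply: cvgM; [exact: cvg_cst|apply: cvg_dotv => //; exact: cvg_mulmx].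
rewrite -[X in _ --> X]addr0.
rewrite (_ : (fun _ => _) = (fun a => 2^-1 * dotv (w a *m H) (w a)) \+
  (fun a => ((t a ^+ 2)^-1 *: (f (xb + t a *: w a) - f xb - t a *: nabla_app f xb (w a))) 0 i
    - 2^-1 * dotv (w a *m H) (w a))); last first.
  by apply/funext => a /=; rewrite [RHS]addrC subrK.
apply: cvgD => //; apply/cvgrPdist_le => e e0.
have b0 : 0 < `|w0| + 1 by rewrite ltr_wpDl.
have [r r0 hr] := taylor2 (C2_twice i) (divr_gt0 e0 (exprn_gt0 2 b0)).
have := near_scaled r0; have := near_bounded; move: t_gt0.
apply: filterS3 => a ta wa /hr H1; rewrite sub0r normrN.
have ta2 : 0 < t a ^+ 2 by rewrite exprn_gt0.
rewrite -(ler_pM2l ta2) -{1}(gtr0_norm ta2) -normrM.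
move: H1; rewrite normrZ exprMn (gtr0_norm ta) => H1.
apply: le_trans (le_trans _ H1) _; last first.
  rewrite mulrCA ler_wpM2l ?(ltW ta2)// -mulrA ler_piMr ?(ltW e0)//.
  rewrite mulrC ler_pdivrMr ?exprn_gt0// mul1r.
  by rewrite ler_sqr ?nnegrE ?(ltW b0).
rewrite le_eqVlt; apply/orP; left; apply/eqP; congr (`|_|).
have Ai : nabla_app f xb (w a) 0 i = dotv (grad (component f i) xb) (w a).
  by rewrite grad_component; [rewrite dotv_adj [RHS]dotvC dotv_deltar|exact: C2_diff].
move: (nabla_app f xb (w a)) Ai => N Ai.
rewrite mulrBr !mxE mulrA mulfV ?gt_eqF// mul1r Ai.
by rewrite dotvZr -scalemxAl dotvZl dotvZr -/H /component; ring.
Qed.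

Lemma cvg_first_order :
  (fun a => (t a)^-1 *: (f (xb + t a *: w a) - f xb)) @ F --> nabla_app f xb w0.
Proof.
rewrite -[X in _ --> X]addr0 -(scale0r (2^-1 *: nabla2 f xb w0 w0)).
have c1 : (fun a => nabla_app f xb (w a)) @ F --> nabla_app f xb w0.
  exact: cvg_mulmx.
apply: cvg_trans (cvgD c1 (cvgZ t_cvg0 cvg_second_order)).
apply: near_eq_cvg; move: t_gt0; apply: filterS => a ta /=.
rewrite !fctE scalerA expr2 invfM mulrA mulfV ?gt_eqF// mul1r.
by rewrite scalerBr scalerA mulVf ?gt_eqF// scale1r addrC subrK.
Qed.

Lemma cvg_adj_first_order (lam : T -> 'rV[R]_m) lam0 : lam @ F --> lam0 ->
  (fun a => (t a)^-1 *: (nabla_adj f (xb + t a *: w a) (lam a) - nabla_adj f xb (lam a)))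
    @ F --> w0 *m hess_mx lam0.
Proof.
move=> lamc.
have c1 : (fun a => w a *m hess_mx (lam a)) @ F --> w0 *m hess_mx lam0.
  apply: cvg_coord => i.
  rewrite -dotv_deltar dotv_hess_mx.
  under eq_fun do rewrite -dotv_deltar dotv_hess_mx.
  apply: cvg_dotv => //; apply: cvg_coord => j; rewrite mxE.
  under eq_fun do rewrite mxE.
  by apply: cvg_dotv; [exact: cvg_mulmx|exact: cvg_cst].
rewrite -[X in _ --> X]addr0.
rewrite (_ : (fun _ => _) = (fun a => w a *m hess_mx (lam a)) \+
  (fun a => (t a)^-1 *: (nabla_adj f (xb + t a *: w a) (lam a) - nabla_adj f xb (lam a))
    - w a *m hess_mx (lam a))); last first.
  by apply/funext => a /=; rewrite [RHS]addrC subrK.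
apply: cvgD => //; apply/cvgrPdist_le => e e0.
have b0 : 0 < `|w0| + 1 by rewrite ltr_wpDl.
have l0 : 0 < `|lam0| + 1 by rewrite ltr_wpDl.
have [r r0 hr] := adj_expansion (divr_gt0 e0 (mulr_gt0 l0 b0)).
have lb : \forall a \near F, `|lam a| <= `|lam0| + 1.
  move/cvgrPdist_le : lamc => /(_ 1 ltr01); apply: filterS => a h.
  rewrite -[lam a](subrK lam0) addrC; apply: le_trans (ler_normD _ _) _.
  by rewrite lerD2l distrC.
have : \forall a \near F, `|lam a| <= `|lam0| + 1 /\ `|t a *: w a| <= r.
  by apply: filterI => //; exact: near_scaled.
have := near_bounded; move: t_gt0.
apply: filterS3 => a ta wa [la /(hr _ (lam a))]; rewrite sub0r normrN => H1.
rewrite -(ler_pM2l ta) -{1}(gtr0_norm ta) -normrZ.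
rewrite scalerBr scalerA mulfV ?gt_eqF// scale1r scalemxAl.
apply: le_trans H1 _; rewrite normrZ (gtr0_norm ta) mulrCA ler_wpM2l ?(ltW ta)//.
rewrite -!mulrA ler_piMr ?(ltW e0)// mulrC ler_pdivrMr ?mulr_gt0// mul1r.
exact: ler_pM.
Qed.

End Limits.

Lemma C2_lipschitz : exists L r : R, [/\ 0 < L, 0 < r &
  forall h h', `|h| <= r -> `|h'| <= r ->
    `|f (xb + h) - f (xb + h')| <= L * `|h - h'|].
Proof.
have H (i : 'I_m) : exists r : R, 0 < r /\ forall h, `|h| <= r ->
    `|grad (component f i) (xb + h)| <= `|grad (component f i) xb| + 1.
  have /differentiable_continuous/cvgrPdist_le/(_ 1 ltr01)/near_norm_ball[r r0 hr] :=
    (C2_twice i).2.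
  exists r; split=> // h /hr /= h1.
  rewrite -[X in `|X| <= _](subrK (grad (component f i) xb)) addrC.
  by apply: le_trans (ler_normD _ _) _; rewrite lerD2l distrC.
have [r hr] := choice H.
have [r0 r00 hr0] := near_norm_ball C2_near.
have rmin : exists2 q : R, 0 < q & q <= r0 /\ forall i, q <= r i.
  exists (\big[Num.min/r0]_i r i).
    elim/big_ind: _ => //[x y x0 y0|i _]; first by rewrite lt_min x0.
    by have [] := hr i.
  split; first by apply: bigmin_le_id.
  by move=> i; apply: bigmin_le_cond.
have [q q0 [qr0 qr]] := rmin.
pose S : R := \sum_i (`|grad (component f i) xb| + 1).
have S0 : 0 <= S by apply: sumr_ge0 => i _; rewrite addr_ge0.
exists (n%:R * S + 1), q; split => [|//|h h' hq h'q].
  by rewrite ltr_wpDl// mulr_ge0.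
have seg (s : R) : 0 <= s <= 1 -> `|h' + s *: (h - h')| <= q.
  move=> /andP[s0 s1].
  rewrite (_ : _ + _ = s *: h + (1 - s) *: h'); last first.
    by rewrite scalerBr scalerBl scale1r addrCA.
  apply: le_trans (ler_normD _ _) _; rewrite !normrZ (ger0_norm s0) ger0_norm ?subr_ge0//.
  have s1' : 0 <= 1 - s by rewrite subr_ge0.
  by have := ler_wpM2l s0 hq; have := ler_wpM2l s1' h'q; lra.
apply: norm_le_coord => [|i].
  by rewrite mulr_ge0// addr_ge0// mulr_ge0.
rewrite !mxE.
have [|s s01 E] := @mean_value _ _ (component f i) (xb + h') (h - h').
  move=> s s01; rewrite -addrA; apply/differentiable_component/hr0.
  exact: le_trans (seg _ s01) qr0.
move: E; rewrite -addrA [h' + _]addrC subrK /component => ->.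
apply: le_trans (normr_dotv _ _) _; rewrite ler_wpM2r//.
apply: (@le_trans _ _ (n%:R * S)); last by rewrite lerDl.
rewrite ler_wpM2l// -addrA (le_trans ((hr i).2 _ (le_trans (seg _ s01) (qr i))))//.
by rewrite /S (bigD1 i)//= lerDl; apply: sumr_ge0 => j _; rewrite addr_ge0.
Qed.

Lemma C2_quadratic : exists C r : R, [/\ 0 < C, 0 < r &
  forall h, `|h| <= r -> `|f (xb + h) - f xb - nabla_app f xb h| <= C * `|h| ^+ 2].
Proof.
have H (i : 'I_m) : exists r : R, 0 < r /\ forall h, `|h| <= r ->
   `|component f i (xb + h) - component f i xb - dotv (grad (component f i) xb) h
      - 2^-1 * dotv (h *m hess (component f i) xb) h| <= 1 * `|h| ^+ 2.
  by have [r r0 hr] := taylor2 (C2_twice i) ltr01; exists r.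
have [r hr] := choice H.
have rmin : exists2 q : R, 0 < q & forall i, q <= r i.
  exists (\big[Num.min/1]_i r i); last by move=> i; apply: bigmin_le_cond.
  elim/big_ind: _ => //[x y x0 y0|i _]; first by rewrite lt_min x0.
  by have [] := hr i.
have [q q0 qr] := rmin; have [C C0 hC] := nabla2_bound.
exists (C + 1), q; split => //[|h hq]; first by rewrite addr_gt0.
apply: norm_le_coord => [|i]; first by rewrite mulr_ge0 ?sqr_ge0// addr_ge0// ltW.
have := (hr i).2 _ (le_trans hq (qr i)).
have := le_trans (coord_norm_le (nabla2 f xb h h) i) (hC h).
have <- : nabla_app f xb h 0 i = dotv (grad (component f i) xb) h.
  by rewrite grad_component; [rewrite dotv_adj [RHS]dotvC dotv_deltar|exact: C2_diff].
rewrite [nabla2 _ _ _ _ _ _]mxE; move: (nabla_app f xb h) => N.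
rewrite !mxE /component !mul1r mulrDl mul1r.
set A := dotv _ _; rewrite !ler_norml => /andP[a1 a2] /andP[b1 b2].
have c0 : 0 <= C * `|h| ^+ 2 by rewrite mulr_ge0 ?sqr_ge0// ltW.
by apply/andP; split; lra.
Qed.

Lemma C2_adj_continuous : \forall x \near xb,
  forall (T : Type) (F : set_system T), ProperFilter F ->
  forall (y : T -> 'rV[R]_n) (lam : T -> 'rV[R]_m) lam0,
  (\forall a \near F, differentiable f (y a)) ->
  y @ F --> x -> lam @ F --> lam0 ->
  (fun a => nabla_adj f (y a) (lam a)) @ F --> nabla_adj f x lam0.
Proof.
apply: filterS f_C2 => x [dfx dgx] T F FF y lam lam0 dy yx lamc.
apply: cvg_trans (_ : (fun a => \sum_i lam a 0 i *: grad (component f i) (y a)) @ F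
   --> nabla_adj f x lam0).
  by apply: near_eq_cvg; apply: filterS dy => a da; rewrite nabla_adj_sum.
rewrite nabla_adj_sum//.
elim: (index_enum _) => [|i s IHs].
  by under eq_fun do rewrite big_nil; rewrite big_nil; exact: cvg_cst.
under eq_fun do rewrite big_cons; rewrite big_cons; apply: cvgD => //.
apply: cvgZ; first exact: cvg_comp lamc (@coord_continuous _ _ _ _ _ _).
by apply: cvg_comp yx _; apply: differentiable_continuous; have [] := dgx i.
Qed.

End VectorCalculus.

(** * Convex piecewise linear-quadratic functions *)

Section ActiveCone.
Context {R : realType}.

(* The constraints of [L] active at [z], made homogeneous: the tangent cone at [z]
   of the polyhedron defined by [L]. *)
Definition actp {l : nat} (L : seq ('rV[R]_l * R)) (z : 'rV[R]_l) :
  seq ('rV[R]_l * R) := [seq (e.1, 0) | e <- L & dotv e.1 z == e.2].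

Definition act2 {l k : nat} (L : seq ('rV[R]_l * 'rV[R]_k * R))
    (z : 'rV[R]_l) (y : 'rV[R]_k) : seq ('rV[R]_l * 'rV[R]_k * R) :=
  [seq (e.1, 0) | e <- L & dotv e.1.1 z + dotv e.1.2 y == e.2].

Definition pack {l k : nat} (L : seq ('rV[R]_l * 'rV[R]_k * R)) :
  seq ('rV[R]_(l + k) * R) := [seq (row_mx e.1.1 e.1.2, e.2) | e <- L].

Lemma psat_pack {l k : nat} (L : seq ('rV[R]_l * 'rV[R]_k * R)) z y :
  psat (pack L) (row_mx z y) <-> sat2 L z y.
Proof.
split=> [h e eL|h _ /mapP[e eL ->]] /=; last by rewrite dotv_row_mx; exact: h.
have /h /= : (row_mx e.1.1 e.1.2, e.2) \in pack L by apply/mapP; exists e.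
by rewrite dotv_row_mx.
Qed.

Lemma pack_act {l k : nat} (L : seq ('rV[R]_l * 'rV[R]_k * R)) z y :
  pack (act2 L z y) = actp (pack L) (row_mx z y).
Proof.
rewrite /pack /act2 /actp filter_map -!map_comp.
congr map; apply: eq_filter => e /=; by rewrite dotv_row_mx.
Qed.

Lemma psat_cone (l : nat) (L : seq ('rV[R]_l * R)) z z' c :
  psat L z' -> 0 <= c -> psat (actp L z) (c *: (z' - z)).
Proof.
move=> h c0 _ /mapP[e + ->] /=; rewrite mem_filter => /andP[/eqP ez eL].
by rewrite dotvZr dotvBr ez mulr_ge0_le0// subr_le0 h.
Qed.

(** Active constraints persist along [u], inactive ones have slack for a short time, and there are
    finitely many. This turns tangent directions of a polyhedron into feasible ones. *)
Lemma psat_cone_ray (l : nat) (L : seq ('rV[R]_l * R)) z u :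
  psat L z -> psat (actp L z) u ->
  exists2 r : R, 0 < r & forall s, 0 <= s <= r -> psat L (z + s *: u).
Proof.
move=> hz hu.
suff : forall L', {subset L' <= L} ->
    exists2 r : R, 0 < r & forall s, 0 <= s <= r -> psat L' (z + s *: u).
  by apply.
elim=> [_|e L' IH sub]; first by exists 1.
have [|r r0 hr] := IH; first by move=> x xL; apply: sub; rewrite inE xL orbT.
have eL : e \in L by apply: sub; rewrite mem_head.
suff [r' r'0 hr'] : exists2 r' : R, 0 < r' &
    forall s, 0 <= s <= r' -> dotv e.1 (z + s *: u) <= e.2.
  exists (Num.min r r') => [|s]; first by rewrite lt_min r0.
  rewrite le_min => /and3P[s0 sr sr'] x; rewrite inE => /predU1P[->|xL].
    by apply: hr'; rewrite s0.
  by apply: hr => //; rewrite s0.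
have := hz _ eL; rewrite le_eqVlt => /predU1P[ez|ez].
  exists 1 => // s /andP[s0 _]; rewrite dotvDr dotvZr ez gerDl mulr_ge0_le0//.
  apply: (hu (e.1, 0)); apply/mapP; exists e => //.
  by rewrite mem_filter ez eqxx.
have d0 : 0 < `|dotv e.1 u| + 1 by rewrite ltr_wpDl.
exists ((e.2 - dotv e.1 z) / (`|dotv e.1 u| + 1)).
  by rewrite divr_gt0// subr_gt0.
move=> s /andP[s0]; rewrite ler_pdivlMr// => hs.
rewrite dotvDr dotvZr -lerBrDl; apply: le_trans hs.
by rewrite ler_wpM2l// (le_trans (ler_norm _))// lerDl.
Qed.

Lemma psat_ray {T : Type} (F : set_system T) {FF : ProperFilter F} (l : nat)
    (L : seq ('rV[R]_l * R)) z u (t : T -> R) (w : T -> 'rV[R]_l) :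
  (\forall a \near F, 0 < t a) -> t @ F --> (0 : R) -> w @ F --> u ->
  (\forall a \near F, psat L (z + t a *: w a)) ->
  psat L z /\ psat (actp L z) u.
Proof.
move=> t0 t0' wu h; split.
  apply: (@psat_closed _ _ F _ _ _ (fun a => z + t a *: w a)) => //.
  rewrite -[X in _ --> X]addr0 -(scale0r u); apply: cvgD; first exact: cvg_cst.
  exact: cvgZ.
apply: (@psat_closed _ _ F _ _ _ w) => //.
apply: filterS2 t0 h => a ta h.
have := @psat_cone _ _ z _ (t a)^-1 h; rewrite [z + _]addrC addrK scalerA mulVf ?gt_eqF//.
by rewrite scale1r invr_ge0 (ltW ta); apply.
Qed.

(** The form in which step lengths are sent to 0 in the variational inequalities below: [X] collects
    first-order terms, [Y] is a fixed coefficient of the remainder. *)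
Lemma small_limit_ge0 (X Y r : R) : 0 < r ->
  (forall s, 0 < s <= r -> 0 <= X + s * Y) -> 0 <= X.
Proof.
move=> r0 h; rewrite leNgt; apply/negP => X0.
have d0 : 0 < `|Y| + 1 by rewrite ltr_wpDl.
pose s := Num.min r (- X / (2 * (`|Y| + 1))).
have s0 : 0 < s by rewrite lt_min r0 divr_gt0 ?oppr_gt0// mulr_gt0.
have := h s; rewrite s0 ge_min lexx /= => /(_ isT).
have : s * Y <= s * (`|Y| + 1).
  by rewrite ler_wpM2l ?(ltW s0)// (le_trans (ler_norm _))// lerDl.
have : s * (`|Y| + 1) <= - X / 2.
  have : s <= - X / (2 * (`|Y| + 1)) by rewrite ge_min lexx orbT.
  rewrite ler_pdivlMr ?mulr_gt0// => hs.
  by rewrite ler_pdivlMr// -mulrA [_ * 2]mulrC.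
move: X0; clear; lra.
Qed.

Lemma polar_psat (l : nat) (B : seq ('rV[R]_l * R)) :
  (forall e, e \in B -> e.2 = 0) ->
  exists Q : seq ('rV[R]_l * R), forall nu,
    (forall u, psat B u -> dotv nu u <= 0) <-> psat Q nu.
Proof.
move=> B0.
pose M := \matrix_(j < size B) (nth 0 B j).1.
have [Q hQ] := polar_polyhedral M; exists Q => nu; rewrite -hQ.
have E u : psat B u <-> forall j, dotv (row j M) u <= 0.
  split=> [h j|h e eB]; first by rewrite rowK; have eB := mem_nth 0 (ltn_ord j);
    have := h _ eB; rewrite (B0 _ eB).
  rewrite (B0 _ eB); have := h (Ordinal (etrans (index_mem e B) eB)).
  by rewrite rowK /= nth_index.
by split => h u /E; exact: h.
Qed.

(** The closure properties below make it unnecessary to write out the list of inequalities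
    describing [cell]. *)
Definition polyh2 {l k : nat} (S : 'rV[R]_l -> 'rV[R]_k -> Prop) : Prop :=
  exists C, forall z y, sat2 C z y <-> S z y.

Lemma polyh2_ext {l k : nat} (S S' : 'rV[R]_l -> 'rV[R]_k -> Prop) :
  (forall z y, S z y <-> S' z y) -> polyh2 S -> polyh2 S'.
Proof. by move=> SS' [C hC]; exists C => z y; rewrite hC. Qed.

Lemma polyh2_atom {l k : nat} (b : 'rV[R]_l) (d : 'rV[R]_k) c :
  polyh2 (fun z y => dotv b z + dotv d y <= c).
Proof.
exists [:: (b, d, c)] => z y; split=> [h|h e]; last by rewrite inE => /eqP ->.
by apply: (h (b, d, c)); rewrite mem_head.
Qed.

(** [B] does not depend on the point, so classically its consequence is imposed everywhere or
    nowhere. *)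
Lemma polyh2_imp {l k : nat} (B : Prop) (S : 'rV[R]_l -> 'rV[R]_k -> Prop) :
  polyh2 S -> polyh2 (fun z y => B -> S z y).
Proof.
move=> [C hC]; have [b|nb] := pselect B.
  by exists C => z y; rewrite hC; split => // /(_ b).
by exists [::] => z y; split.
Qed.

Lemma polyh2_and {l k : nat} (S S' : 'rV[R]_l -> 'rV[R]_k -> Prop) :
  polyh2 S -> polyh2 S' -> polyh2 (fun z y => S z y /\ S' z y).
Proof.
move=> [C hC] [C' hC']; exists (C ++ C') => z y; rewrite -hC -hC'; split.
  by move=> h; split=> e eC; apply: h; rewrite mem_cat eC ?orbT.
by move=> [h h'] e; rewrite mem_cat => /orP[/h|/h'].
Qed.

Lemma polyh2_seq {l k : nat} (T : eqType) (r : seq T)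
    (S : T -> 'rV[R]_l -> 'rV[R]_k -> Prop) :
  (forall e, e \in r -> polyh2 (S e)) ->
  polyh2 (fun z y => forall e, e \in r -> S e z y).
Proof.
elim: r => [_|e r IH h]; first by exists [::] => z y; split.
apply: (@polyh2_ext _ _ (fun z y => S e z y /\ forall x, x \in r -> S x z y)).
  move=> z y; split=> [[he hr] x|hr].
    by rewrite inE => /predU1P[->//|]; exact: hr.
  by split=> [|x xr]; apply: hr; rewrite ?mem_head// inE xr orbT.
apply: polyh2_and; first by apply: h; rewrite mem_head.
by apply: IH => x xr; apply: h; rewrite inE xr orbT.
Qed.

Lemma polyh2_fin {l k : nat} (I : finType) (S : I -> 'rV[R]_l -> 'rV[R]_k -> Prop) :
  (forall i, polyh2 (S i)) -> polyh2 (fun z y => forall i, S i z y).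
Proof.
move=> h; have [C hC] := @polyh2_seq l k I (enum I) S (fun i _ => h i).
by exists C => z y; rewrite hC; split=> H i; [apply: H; rewrite mem_enum|].
Qed.

End ActiveCone.

(** * Subgradients of convex piecewise quadratic functions and the polyhedral structure of their
    graph *)

Section ConvexPLQ.
Context {R : realType} {m : nat}.
Variables (D : set 'rV[R]_m) (th : 'rV[R]_m -> R) (s : nat).
Variables (L : 'I_s -> seq ('rV[R]_m * R)) (A : 'I_s -> 'M[R]_m).
Variables (a : 'I_s -> 'rV[R]_m) (alpha : 'I_s -> R).

Definition quad i y : R := 2^-1 * dotv (y *m A i) y + dotv (a i) y + alpha i.
Definition gquad i y : 'rV[R]_m := y *m A i + a i.

(** Real-valued data on an explicit domain [D], so that no extended arithmetic occurs; all
    conditions on [th] concern points of [D] only. *)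
Record convex_plq : Prop := ConvexPLQ {
  plq_convex : forall x y t, 0 < t < 1 -> D x -> D y ->
    D (t *: x + (1 - t) *: y) /\
    th (t *: x + (1 - t) *: y) <= t * th x + (1 - t) * th y;
  plq_sym : forall i, (A i)^T = A i;
  plq_dom : forall y, D y <-> exists i, psat (L i) y;
  plq_quad : forall i y, psat (L i) y -> th y = quad i y }.

Hypothesis plqP : convex_plq.
Let th_convex := plq_convex plqP.
Let A_sym := plq_sym plqP.
Let D_pieces := plq_dom plqP.
Let th_quad := plq_quad plqP.

Definition csub (y lam : 'rV[R]_m) : Prop :=
  D y /\ forall y', D y' -> th y + dotv lam (y' - y) <= th y'.

Lemma quadD i y u :
  quad i (y + u) = quad i y + dotv (gquad i y) u + 2^-1 * dotv (u *m A i) u.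
Proof.
rewrite /quad /gquad mulmxDl !dotvDl !dotvDr.
by rewrite [dotv (u *m _) y]dotv_mulmxl A_sym [dotv u _]dotvC; field.
Qed.

Lemma quad_cvg {T : Type} (F : set_system T) {FF : Filter F} i
    (y : T -> 'rV[R]_m) y0 : y @ F --> y0 -> (fun x => quad i (y x)) @ F --> quad i y0.
Proof.
move=> yc; apply: cvgD; last exact: cvg_cst.
apply: cvgD; last by apply: cvg_dotv => //; exact: cvg_cst.
by apply: cvgM; [exact: cvg_cst|apply: cvg_dotv => //; exact: cvg_mulmx].
Qed.

Lemma dom_closed {T : Type} (F : set_system T) {FF : ProperFilter F}
    (y : T -> 'rV[R]_m) y0 : y @ F --> y0 -> (\forall x \near F, D (y x)) ->
  D y0 /\ (fun x => th (y x)) @ F --> th y0.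
Proof.
move=> yc yD.
have H U : UltraFilter U -> F `<=` U ->
    D y0 /\ (fun x => th (y x)) @ U --> th y0.
  move=> UU FU; have ycU : y @ U --> y0 by apply: cvg_trans yc => B; exact: FU.
  have [i hi] : exists i, \forall x \near U, psat (L i) (y x).
    apply: ultra_pigeonhole; apply: filterS (FU _ yD) => x; exact: (D_pieces _).1.
  have iy0 : psat (L i) y0 by exact: psat_closed ycU hi.
  split; first exact: (D_pieces y0).2 (ex_intro _ i iy0).
  have qc : (fun x => quad i (y x)) @ U --> quad i y0 by exact: quad_cvg.
  rewrite (th_quad iy0); apply: cvg_trans qc.
  by apply: near_eq_cvg; apply: filterS hi => x /th_quad.
split; last by apply: cvg_ultra => U UU FU; have [] := H U UU FU.
by have [U [UU FU]] := ultraFilterLemma FF; have [] := H U UU FU.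
Qed.

Lemma right_small (e : R) : 0 < e -> \forall t \near (0 : R)^'+, 0 < t <= e.
Proof.
move=> e0; near=> t; apply/andP; split; near: t; first exact: nbhs_right_gt.
exact: nbhs_right_le.
Unshelve. all: by end_near. Qed.

Lemma cvg_right0 : (fun t : R => t) @ (0 : R)^'+ --> (0 : R).
Proof. by apply: cvg_within. Qed.

(** An ultrafilter at 0+ selects a piece met by the segment arbitrarily close to [y]; by
    [psat_cone_ray] this piece contains an initial part of the segment. The inequality compares the
    expansion of [quad i] there with convexity. *)
Lemma segment_piece y y' : D y -> D y' ->
  exists i, [/\ psat (L i) y, psat (actp (L i) y) (y' - y) &
    dotv (gquad i y) (y' - y) <= th y' - th y].
Proof.
move=> Dy Dy'; have [U [UU FU]] := @ultraFilterLemma _ (0 : R)^'+ _.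
have seg (t : R) : 0 < t < 1 -> D (y + t *: (y' - y)) /\
    th (y + t *: (y' - y)) <= t * th y' + (1 - t) * th y.
  move=> t01; have := th_convex t01 Dy' Dy.
  rewrite (_ : t *: y' + (1 - t) *: y = y + t *: (y' - y))//.
  by rewrite scalerBl scale1r scalerBr addrCA.
have t12 : \forall t \near (0 : R)^'+, 0 < t <= 2^-1 by exact: right_small.
have [i hi] : exists i, \forall t \near U, psat (L i) (y + t *: (y' - y)).
  apply: ultra_pigeonhole; apply: filterS (FU _ t12) => t /andP[t0 t1].
  apply/D_pieces; apply: (seg t _).1; rewrite t0 (le_lt_trans t1)//.
  by rewrite invf_lt1// ltr1n.
have tU : (fun t : R => t) @ U --> (0 : R).
  by apply: cvg_trans cvg_right0 => B; exact: FU.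
have tU0 : \forall t \near U, 0 < t.
  by apply: FU; apply: filterS t12 => t /andP[].
have [Ly Cy] : psat (L i) y /\ psat (actp (L i) y) (y' - y).
  by apply: (psat_ray tU0 tU _ hi); exact: cvg_cst.
exists i; split => //.
have [r r0 hr] := psat_cone_ray Ly Cy.
rewrite -subr_ge0; apply: (@small_limit_ge0 _ _ (- (2^-1 * dotv ((y' - y) *m A i) (y' - y)))
   (Num.min r 2^-1)); first by rewrite lt_min r0 /=.
move=> t /andP[t0]; rewrite le_min => /andP[tr t1].
have t01 : 0 < t < 1 by rewrite t0 (le_lt_trans t1)// invf_lt1// ltr1n.
have := (seg t t01).2.
rewrite (th_quad (hr t _)) ?(ltW t0)// quadD -(th_quad Ly) dotvZr -scalemxAl dotvZl dotvZr.
move: (dotv _ _) (dotv _ _) => X Y H.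
rewrite -(pmulr_rge0 _ t0); nra.
Qed.

(** The piece selected at [y] by [segment_piece] has slope at most [gquad i y], which is bounded on
    the ball. The estimate is one-sided; exchanging the points gives the other side. *)
Lemma dom_lipschitz (rho : R) : 0 <= rho -> exists2 l : R, 0 < l &
  forall y y', D y -> D y' -> `|y| <= rho -> `|y'| <= rho ->
  th y - th y' <= l * `|y' - y|.
Proof.
move=> rho0.
have H (i : 'I_s) : exists c : R, 0 < c /\ forall y, `|y| <= rho -> `|gquad i y| <= c.
  have [c c0 hc] := norm_mulmx_le (A i).
  exists (c * rho + `|a i| + 1); split.
    by rewrite ltr_wpDl// addr_ge0// mulr_ge0// ltW.
  move=> y yr; rewrite /gquad; apply: le_trans (ler_normD _ _) _.
  have := hc y; have := ler_wpM2l (ltW c0) yr; lra.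
have [c hc] := choice H.
exists (m%:R * (\sum_i c i) + 1) => [|y y' Dy Dy' yr y'r].
  by rewrite ltr_wpDl// mulr_ge0// sumr_ge0// => i _; rewrite ltW ?(hc i).1.
have [i [_ _]] := segment_piece Dy Dy'.
have := dotv_ge (gquad i y) (y' - y).
have : m%:R * `|gquad i y| * `|y' - y| <= (m%:R * (\sum_i c i) + 1) * `|y' - y|.
  rewrite ler_wpM2r// (@le_trans _ _ (m%:R * \sum_i c i)) ?lerDl//.
  rewrite ler_wpM2l// (le_trans ((hc i).2 _ yr))// (bigD1 i)//= lerDl.
  by apply: sumr_ge0 => j _; rewrite ltW ?(hc j).1.
lra.
Qed.

(** Locally, [lam] is a subgradient when [lam - gquad i y] is normal to every piece [i] containing
    [y]. The global inequality follows since [segment_piece] supplies, for each [y'], a piece whose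
    tangent cone contains [y' - y]. *)
Lemma csubP y lam : csub y lam <-> D y /\ forall i, psat (L i) y ->
  forall u, psat (actp (L i) y) u -> dotv (lam - gquad i y) u <= 0.
Proof.
split=> -[Dy h]; split=> //.
  move=> i iy u hu; have [r r0 hr] := psat_cone_ray iy hu.
  rewrite -oppr_ge0; apply: (@small_limit_ge0 _ _ (2^-1 * dotv (u *m A i) u) r) => // t tr.
  have /andP[t0 t1] := tr.
  have it : psat (L i) (y + t *: u) by apply: hr; rewrite (ltW t0).
  have := h _ ((D_pieces (y + t *: u)).2 (ex_intro _ i it)).
  rewrite (th_quad it) quadD -(th_quad iy) [y + _ - y]addrAC subrr add0r.
  rewrite !dotvZr -scalemxAl dotvZl dotvBl.
  move: (dotv _ _) (dotv _ _) (dotv _ _) => X Y Z H.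
  by rewrite -(pmulr_rge0 _ t0); nra.
move=> y' Dy'; have [i [iy hu hi]] := segment_piece Dy Dy'.
have := h i iy _ hu; rewrite dotvBl; lra.
Qed.

Lemma csub_closed {T : Type} (F : set_system T) {FF : ProperFilter F}
    (y lam : T -> 'rV[R]_m) y0 lam0 :
  y @ F --> y0 -> lam @ F --> lam0 -> (\forall x \near F, csub (y x) (lam x)) ->
  csub y0 lam0.
Proof.
move=> yc lc h.
have [Dy0 thc] : D y0 /\ (fun x => th (y x)) @ F --> th y0.
  by apply: dom_closed => //; apply: filterS h => x [].
split=> // y' Dy'.
apply: (@cvg_le _ _ F _ (fun x => th (y x) + dotv (lam x) (y' - y x)) (cst (th y'))).
- by apply: cvgD => //; apply: cvg_dotv => //; apply: cvgB => //; exact: cvg_cst.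
- exact: cvg_cst.
- by apply: filterS h => x [_]; exact.
Qed.

Lemma csub_monotone y lam y' lam' : csub y lam -> csub y' lam' ->
  0 <= dotv (lam - lam') (y - y').
Proof.
move=> [Dy h] [Dy' h']; have := h _ Dy'; have := h' _ Dy.
rewrite dotvBl -[y' - y]opprB dotvNr; lra.
Qed.

(** The premise is what minimality of [y] yields when a smooth term with gradient [- lam] is added
    to [th] and [y] is compared with points of a segment; [C] absorbs the quadratic remainder.
    Convexity makes the conclusion global. *)
Lemma csub_fermat y lam : D y ->
  (forall y', D y' -> exists C e : R, 0 < e /\ forall t, 0 < t <= e ->
    th y <= th (y + t *: (y' - y)) - t * dotv lam (y' - y) + t ^+ 2 * C) ->
  csub y lam.
Proof.
move=> Dy h; split=> // y' Dy'; have [C [e [e0 he]]] := h y' Dy'.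
rewrite -subr_ge0; apply: (@small_limit_ge0 _ _ C (Num.min e 2^-1)).
  by rewrite lt_min e0/=.
move=> t /andP[t0]; rewrite le_min => /andP[te t1].
have t01 : 0 < t < 1 by rewrite t0 (le_lt_trans t1)// invf_lt1// ltr1n.
have [_] := th_convex t01 Dy' Dy.
rewrite (_ : t *: y' + (1 - t) *: y = y + t *: (y' - y)); last first.
  by rewrite scalerBl scale1r scalerBr addrCA.
have := he t; rewrite t0 te => /(_ isT) H1 H2.
by rewrite -(pmulr_rge0 _ t0); nra.
Qed.

(** Weierstrass' theorem on the part of [C] where [th] is finite at [g x]: the sublevel sets
    generate a proper filter, an ultrafilter above it converges in [C], and [dom_closed] carries
    both feasibility and value to the limit. *)
Lemma min_exists {T : topologicalType} (C : set T) (g : T -> 'rV[R]_m)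
    (k : T -> R) (x0 : T) :
  compact C -> (forall x, C x -> {for x, continuous g}) ->
  (forall x, C x -> {for x, continuous k}) -> C x0 -> D (g x0) ->
  exists x, [/\ C x, D (g x) & forall x', C x' -> D (g x') ->
    th (g x) + k x <= th (g x') + k x'].
Proof.
move=> cC gc kc Cx0 Dx0.
pose E := [set x | C x /\ D (g x)].
pose val x := th (g x) + k x.
pose F := filter_from E (fun x => [set x' | E x' /\ val x' <= val x]).
have FF : ProperFilter F.
  apply: filter_from_proper; last by move=> x Ex; exists x.
  apply: filter_from_filter; first by exists x0.
  move=> x x' Ex Ex'; have [xx'|x'x] := leP (val x) (val x').
    by exists x => // z [Ez zx]; split; split => //; exact: le_trans xx'.
  by exists x' => // z [Ez zx]; split; split => //; exact: le_trans (ltW x'x).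
have [U [UU FU]] := ultraFilterLemma FF.
have UE : \forall x \near U, E x by apply: FU; exists x0 => // x [].
have : U C by apply: filterS UE => x [].
move: cC; rewrite compact_ultra => /[apply]; case=> p [Cp Up].
have gU : g @ U --> g p by apply: cvg_comp Up _; exact: gc.
have kU : k @ U --> k p by apply: cvg_comp Up _; exact: kc.
have [Dp thU] : D (g p) /\ (fun x => th (g x)) @ U --> th (g p).
  by apply: dom_closed gU _; apply: filterS UE => x [].
exists p; split=> // x Cx Dx.
apply: (@cvg_le _ _ U _ val (cst (val x))).
- exact: cvgD.
- exact: cvg_cst.
- by apply: FU; exists x => // z [].
Qed.

(** Recording both inequalities fixes the sign of every constraint of every piece, so the two points
    lie in the same pieces with the same active constraints. *)
Definition same_cell y y0 : Prop := forall i e, e \in L i ->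
  (dotv e.1 y <= e.2) = (dotv e.1 y0 <= e.2) /\
  (e.2 <= dotv e.1 y) = (e.2 <= dotv e.1 y0).

Lemma same_cell_act y y0 i : same_cell y y0 -> actp (L i) y = actp (L i) y0.
Proof.
move=> h; rewrite /actp; congr map; apply: eq_in_filter => e eL.
by rewrite !eq_le; have [-> ->] := h i e eL.
Qed.

Lemma same_cell_psat y y0 i : same_cell y y0 -> psat (L i) y <-> psat (L i) y0.
Proof.
by move=> h; split=> H e eL; have := H e eL; have [-> _] := h i e eL.
Qed.

Let N := \max_(i < s) size (L i).

(** A finite code for the cell of a point. One index range serves all pieces; indices beyond
    [size (L i)] read the default constraint [0], whose entry is the same for all points. *)
Definition pattern y : {ffun 'I_s * 'I_N -> bool * bool} :=
  [ffun ij : 'I_s * 'I_N => let e := nth 0 (L ij.1) ij.2 in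
              (dotv e.1 y <= e.2, e.2 <= dotv e.1 y)].

Lemma pattern_same_cell y y0 : pattern y = pattern y0 -> same_cell y y0.
Proof.
move=> h i e eL.
have jN : (index e (L i) < N)%N.
  apply: (@leq_trans (size (L i))); first by rewrite index_mem.
  exact: (@leq_bigmax _ (fun i => size (L i)) i).
have /ffunP/(_ (i, Ordinal jN)) := h.
by rewrite !ffunE /= nth_index// => -[-> ->].
Qed.

(* [cell y0] is a polyhedron; the points of the open segment from one of its
   points to [(y0, lam0)] satisfy exactly the same constraints as [y0], hence lie
   in the graph of [csub], and so does the cell by closedness. *)
Definition cell y0 y lam : Prop :=
  (forall i e, e \in L i -> (dotv e.1 y0 <= e.2 -> dotv e.1 y <= e.2) /\
     (e.2 <= dotv e.1 y0 -> e.2 <= dotv e.1 y)) /\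
  (forall i, psat (L i) y0 ->
     forall u, psat (actp (L i) y0) u -> dotv (lam - gquad i y) u <= 0).

Lemma cell_polyhedral y0 : polyh2 (cell y0).
Proof.
apply: polyh2_and; apply: polyh2_fin => i.
  apply: polyh2_seq => e eL; apply: polyh2_and; apply: polyh2_imp.
    by apply: polyh2_ext (polyh2_atom e.1 0 e.2) => z y; rewrite dot0v addr0.
  apply: polyh2_ext (polyh2_atom (- e.1) 0 (- e.2)) => z y.
  by rewrite dot0v addr0 dotvNl lerN2.
apply: polyh2_imp.
have [|Q hQ] := @polar_psat R m (actp (L i) y0).
  by move=> e /mapP[e' _ ->].
apply: (@polyh2_ext _ _ _ (fun y lam => forall e, e \in Q ->
    dotv e.1 (lam - gquad i y) <= e.2)) => [y lam|].
  by rewrite hQ.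
apply: polyh2_seq => e _.
apply: polyh2_ext (polyh2_atom (- (e.1 *m (A i)^T)) e.1 (e.2 + dotv e.1 (a i))).
move=> y lam; rewrite /gquad dotvBr dotvDr dotvNl dotv_mulmxl trmxK.
by move: (dotv _ _) (dotv _ _) (dotv _ _) => X Y Z; split; lra.
Qed.

Lemma cell_same_csub y0 lam0 y lam t : csub y0 lam0 -> cell y0 y lam ->
  0 < t <= 1 -> csub (y + t *: (y0 - y)) (lam + t *: (lam0 - lam)).
Proof.
move=> /csubP[Dy0 h0] [hL hQ] /andP[t0 t1].
have S : same_cell (y + t *: (y0 - y)) y0.
  move=> i e eL; have [] := hL i e eL.
  rewrite dotvDr dotvZr dotvBr; move: (dotv e.1 y) (dotv e.1 y0) => d d0 h1 h2.
  split; apply/idP/idP => H.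
  - by rewrite leNgt; apply/negP => c0; have := h2 (ltW c0); nra.
  - by have := h1 H; nra.
  - by rewrite leNgt; apply/negP => c0; have := h1 (ltW c0); nra.
  - by have := h2 H; nra.
apply/csubP; split.
  have [i hi] := (D_pieces _).1 Dy0.
  by apply/D_pieces; exists i; apply/(same_cell_psat i S).
move=> i /(same_cell_psat i S) hi u; rewrite (same_cell_act i S) => hu.
have := hQ i hi u hu; have := h0 i hi u hu.
rewrite /gquad !mulmxDl -!scalemxAl !mulmxBl !(dotvDl, dotvBl, dotvNl, dotvZl).
move: (dotv _ _) (dotv _ _) (dotv _ _) (dotv _ _) (dotv _ _) => X1 X2 X3 X4 X5.
nra.
Qed.

(** One polyhedron per sign pattern: the cell of some chosen graph point with that pattern, or the
    empty set if there is none. The patterns are finitely many. *)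
Lemma csub_pieces : exists (I : finType) (P : I -> seq ('rV[R]_m * 'rV[R]_m * R)),
  (forall k y lam, sat2 (P k) y lam -> csub y lam) /\
  (forall y lam, csub y lam -> exists k, sat2 (P k) y lam).
Proof.
have H (k : {ffun 'I_s * 'I_N -> bool * bool}) :
    exists C : seq ('rV[R]_m * 'rV[R]_m * R),
    (forall y lam, sat2 C y lam -> csub y lam) /\
    (forall y lam, pattern y = k -> csub y lam -> sat2 C y lam).
  have [[y0 [lam0 [<- c0]]]|no] :=
      pselect (exists y0 lam0, pattern y0 = k /\ csub y0 lam0).
    have [C hC] := cell_polyhedral y0; exists C; split.
      move=> y lam /hC cyl.
      apply: (@csub_closed _ (0 : R)^'+ _ (fun t => y + t *: (y0 - y))
          (fun t => lam + t *: (lam0 - lam))).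
      - rewrite -[X in _ --> X]addr0 -(scale0r (y0 - y)).
        by apply: cvgD; [exact: cvg_cst|apply: cvgZ; [exact: cvg_right0|exact: cvg_cst]].
      - rewrite -[X in _ --> X]addr0 -(scale0r (lam0 - lam)).
        by apply: cvgD; [exact: cvg_cst|apply: cvgZ; [exact: cvg_right0|exact: cvg_cst]].
      - by apply: filterS (right_small ltr01) => t; exact: cell_same_csub.
    move=> y lam /pattern_same_cell S /csubP[Dy hy]; apply/hC; split.
      by move=> i e eL; have [-> ->] := S i e eL.
    by move=> i /(same_cell_psat i S) hi u; rewrite -(same_cell_act i S); exact: hy.
  (* The single constraint [0 <= - 1] encodes the empty polyhedron. *)
  exists [:: (0, 0, - 1)]; split=> y lam.
    move=> /(_ (0, 0, - 1)); rewrite mem_head => /(_ isT) /=.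
    by rewrite !dot0v add0r => ?; exfalso; lra.
  by move=> pk c; exfalso; apply: no; exists y, lam.
have [P hP] := choice H.
exists _, P; split=> [k|y lam c]; first by have [] := hP k.
by exists (pattern y); apply: (hP _).2.
Qed.

(** For a finite union of polyhedra these feasible directions are all the tangent directions, so
    this is the graphical derivative of [csub] in a form free of limits. *)
Definition csub_ray (y lam u eta : 'rV[R]_m) : Prop :=
  exists2 e : R, 0 < e & forall t, 0 < t <= e -> csub (y + t *: u) (lam + t *: eta).

Lemma row_mx_ray (y lam u eta : 'rV[R]_m) (t : R) :
  row_mx (y + t *: u) (lam + t *: eta) = row_mx y lam + t *: row_mx u eta.
Proof. by rewrite scale_row_mx add_row_mx. Qed.

Section Pieces.
Variables (I : finType) (P : I -> seq ('rV[R]_m * 'rV[R]_m * R)).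
Hypothesis P_csub : forall k y lam, sat2 (P k) y lam -> csub y lam.
Hypothesis csub_P : forall y lam, csub y lam -> exists k, sat2 (P k) y lam.

Lemma act2_csub_ray k y lam u eta :
  sat2 (P k) y lam -> sat2 (act2 (P k) y lam) u eta -> csub_ray y lam u eta.
Proof.
move=> /psat_pack h1 /psat_pack; rewrite pack_act => h2.
have [r r0 hr] := psat_cone_ray h1 h2; exists r => // t /andP[t0 tr].
apply: (@P_csub k); apply/psat_pack; rewrite row_mx_ray.
by apply: hr; rewrite (ltW t0).
Qed.

Lemma limit_act2 {T : Type} (U : set_system T) {UU : UltraFilter U}
    (t : T -> R) (u eta : T -> 'rV[R]_m) y lam u0 eta0 :
  (\forall x \near U, 0 < t x) -> t @ U --> (0 : R) -> u @ U --> u0 ->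
  eta @ U --> eta0 ->
  (\forall x \near U, csub (y + t x *: u x) (lam + t x *: eta x)) ->
  exists2 k, sat2 (P k) y lam & sat2 (act2 (P k) y lam) u0 eta0.
Proof.
move=> t0 t0' uc ec h.
have [k hk] : exists k, \forall x \near U,
    sat2 (P k) (y + t x *: u x) (lam + t x *: eta x).
  by apply: ultra_pigeonhole; apply: filterS h => x /csub_P.
have [h1 h2] : psat (pack (P k)) (row_mx y lam) /\
    psat (actp (pack (P k)) (row_mx y lam)) (row_mx u0 eta0).
  apply: (@psat_ray _ _ U _ _ _ _ _ t (fun x => row_mx (u x) (eta x))) => //.
    by apply/cvg_row_mx.
  by apply: filterS hk => x /psat_pack; rewrite row_mx_ray.
by exists k; apply/psat_pack; rewrite ?pack_act.
Qed.

End Pieces.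

(** The secants stay in one polyhedral piece along an ultrafilter; their limit satisfies its active
    constraints and is therefore a feasible direction. *)
Lemma csub_ray_limit {T : Type} (F : set_system T) {FF : ProperFilter F}
    (t : T -> R) (u eta : T -> 'rV[R]_m) y lam u0 eta0 :
  (\forall x \near F, 0 < t x) -> t @ F --> (0 : R) -> u @ F --> u0 ->
  eta @ F --> eta0 ->
  (\forall x \near F, csub (y + t x *: u x) (lam + t x *: eta x)) ->
  csub_ray y lam u0 eta0.
Proof.
move=> t0 t0' uc ec h; have [U [UU FU]] := ultraFilterLemma FF.
have [I [P [P1 P2]]] := csub_pieces.
have [|||||k h1 h2] := @limit_act2 I P P2 _ U _ t u eta y lam u0 eta0.
- exact: FU.
- by apply: cvg_trans t0' => B; exact: FU.
- by apply: cvg_trans uc => B; exact: FU.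
- by apply: cvg_trans ec => B; exact: FU.
- exact: FU.
exact: (act2_csub_ray P1 h1 h2).
Qed.

(** Each ray is tangent to some piece, and one piece serves for the limit; on it
    [image_polyhedral_closed] applies although the vectors [eta] may be unbounded. *)
Lemma csub_ray_image_closed {T : Type} (F : set_system T) {FF : ProperFilter F}
    (n : nat) (M : 'M[R]_(m, n)) y lam (u : T -> 'rV[R]_m) u0
    (x : T -> 'rV[R]_n) x0 :
  u @ F --> u0 -> x @ F --> x0 ->
  (\forall b \near F, exists2 eta, csub_ray y lam (u b) eta & eta *m M = x b) ->
  exists2 eta, csub_ray y lam u0 eta & eta *m M = x0.
Proof.
move=> uc xc h; have [I [P [P1 P2]]] := csub_pieces.
have [U [UU FU]] := ultraFilterLemma FF.
have [k hk] : exists k, \forall b \near U, sat2 (P k) y lam /\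
    exists2 eta, sat2 (act2 (P k) y lam) (u b) eta & eta *m M = x b.
  apply: ultra_pigeonhole; apply: filterS (FU _ h) => b [eta [e e0 he] etaM].
  have [V [VV FV]] := @ultraFilterLemma _ (0 : R)^'+ _.
  have [|||||k h1 h2] := @limit_act2 I P P2 _ V _ id (cst (u b)) (cst eta) y lam (u b) eta.
  - by apply: FV; apply: filterS (right_small ltr01) => t /andP[].
  - by apply: cvg_trans cvg_right0 => B; exact: FV.
  - exact: cvg_cst.
  - exact: cvg_cst.
  - by apply: FV; apply: filterS (right_small e0) => t; exact: he.
  by exists k; split=> //; exists eta.
have [b [hP _]] := filter_ex hk.
have uU : u @ U --> u0 by apply: cvg_trans uc => B; exact: FU.
have xU : x @ U --> x0 by apply: cvg_trans xc => B; exact: FU.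
have [|eta he etaM] := @image_polyhedral_closed _ _ U _ _ _ _ (act2 (P k) y lam) M _ _ _ _ uU xU.
  by apply: filterS hk => c [].
by exists eta => //; exact: (act2_csub_ray P1 hP he).
Qed.

(* The segments from [(y, lam0)] to nearby points of the graph stay in a polyhedral
   piece, so they can be tested against any subgradient [mu] at [y] by monotonicity:
   this is where the optimality of limit multipliers comes from. *)
Lemma csub_graph_limit {T : Type} (U : set_system T) {UU : UltraFilter U}
    (n : nat) (M : 'M[R]_(m, n)) (t : T -> R) (u lam : T -> 'rV[R]_m)
    (y lam0 u0 : 'rV[R]_m) (x0 : 'rV[R]_n) :
  (\forall b \near U, 0 < t b) -> t @ U --> (0 : R) -> u @ U --> u0 ->
  lam @ U --> lam0 ->
  (fun b => (t b)^-1 *: ((lam b - lam0) *m M)) @ U --> x0 ->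
  (\forall b \near U, csub (y + t b *: u b) (lam b)) ->
  [/\ csub y lam0,
      exists2 eta, csub_ray y lam0 u0 eta & eta *m M = x0 &
      forall mu, csub y mu ->
        \forall b \near U, 0 <= dotv (lam0 - mu) (t b *: u b)].
Proof.
move=> t0 t0' uc lc xc h; have [I [P [P1 P2]]] := csub_pieces.
have [k hk] : exists k, \forall b \near U, sat2 (P k) (y + t b *: u b) (lam b).
  by apply: ultra_pigeonhole; apply: filterS h => x /P2.
have yc : (fun b => y + t b *: u b) @ U --> y.
  rewrite -[X in _ --> X]addr0 -(scale0r u0).
  by apply: cvgD; [exact: cvg_cst|exact: cvgZ].
have hP : sat2 (P k) y lam0 by exact: (sat2_closed yc lc hk).
split; first exact: P1 hP.
  have [|eta he etaM] := @image_polyhedral_closed _ _ U _ _ _ _ (act2 (P k) y lam0) M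
      _ _ _ _ uc xc.
    apply: filterS2 t0 hk => b tb /psat_pack hb.
    exists ((t b)^-1 *: (lam b - lam0)); last by rewrite -scalemxAl.
    apply/psat_pack; rewrite pack_act.
    rewrite (_ : row_mx (u b) _ = (t b)^-1 *: (row_mx (y + t b *: u b) (lam b) - row_mx y lam0)).
      by apply: psat_cone hb _; rewrite invr_ge0 ltW.
    rewrite opp_row_mx add_row_mx scale_row_mx [y + _]addrC addrK.
    by rewrite scalerA mulVf ?gt_eqF// scale1r.
  by exists eta => //; exact: (act2_csub_ray P1 hP he).
move=> mu cmu; apply: filterS2 t0 hk => b tb hb.
apply: (@small_limit_ge0 _ _ (dotv (lam b - lam0) (t b *: u b)) 1) => // c /andP[c0 c1].
have cs : csub (y + c *: (t b *: u b)) (lam0 + c *: (lam b - lam0)).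
  apply: (P1 k) => e eP; have := hb e eP; have := hP e eP.
  rewrite !dotvDr !dotvZr !dotvBr; move: (t b * _) => TY.
  move: (dotv _ _) (dotv _ _) (dotv _ _) => X Y Z; nra.
have := csub_monotone cs cmu.
have -> : y + c *: (t b *: u b) - y = c *: (t b *: u b) by rewrite addrC addKr.
rewrite [dotv _ (c *: _)]dotvZr pmulr_rge0// !(dotvBl, dotvDl, dotvZl).
lra.

Qed.

End ConvexPLQ.

(** * Limiting subgradients *)

Section Subgradients.
Context {R : realType}.

(** Trades the limsup of Euclidean quotients for an inequality in the sup norm; equivalence of the
    norms only rescales [e]. *)
Lemma regular_normalP (k : nat) (Om : set 'rV[R]_k) (x v : 'rV[R]_k) :
  regular_normal Om x v <-> forall e : R, 0 < e ->
    \forall y \near x, Om y -> dotv v (y - x) <= e * `|y - x|.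
Proof.
split.
  move=> hv e e0; have e'0 : 0 < e / k.+1%:R by rewrite divr_gt0.
  have : (limf_esup (fun y : 'rV[R]_k => (dotv v (y - x) / enorm (y - x))%:E)
              (within (Om `\ x) (nbhs x)) < (e / k.+1%:R)%:E)%E.
    by apply: le_lt_trans hv _; rewrite lte_fin.
  rewrite /limf_esup => /ereal_inf_lt[_ [V hV <-]] Ve.
  have {}hV : \forall y \near x, (Om `\ x) y -> V y by exact: hV.
  apply: filterS hV => y hy Oy.
  have [->|yx] := eqVneq y x; first by rewrite subrr dotv0 normr0 mulr0.
  have Vy : V y by exact: (hy (conj Oy (elimN eqP yx))).
  have : ((dotv v (y - x) / enorm (y - x))%:E <= (e / k.+1%:R)%:E)%E.
    by apply: le_trans (ltW Ve); apply: ereal_sup_ubound; exists y.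
  rewrite lee_fin ler_pdivrMr; last first.
    by apply: lt_le_trans (norm_le_enorm _); rewrite normr_gt0 subr_eq0.
  move=> h; apply: le_trans h _.
  rewrite mulrAC ler_pdivrMr// -mulrA ler_wpM2l ?(ltW e0)// mulrC.
  exact: enorm_le.
move=> h; rewrite /regular_normal /=.
apply/lee_addgt0Pr => e e0; rewrite add0e.
pose V := [set y : 'rV[R]_k | dotv v (y - x) / enorm (y - x) <= e].
apply: (@le_trans _ _ (ereal_sup ((fun y : 'rV[R]_k => (dotv v (y - x) / enorm (y - x))%:E) @` V))).
  apply: ereal_inf_lbound; exists V => //; apply: filterS (h e e0) => y hy [Oy yx].
  rewrite /V /= ler_pdivrMr; last first.
    by apply: lt_le_trans (norm_le_enorm _); rewrite normr_gt0 subr_eq0; exact/eqP.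
  apply: le_trans (hy Oy) _; rewrite ler_wpM2l ?(ltW e0)//.
  exact: norm_le_enorm.
by apply: ub_ereal_sup => _ [y Vy <-]; rewrite lee_fin.
Qed.

(* Regular subgradients, in first order form. *)
Definition rsub {k : nat} (phi : 'rV[R]_k -> \bar R) (x v : 'rV[R]_k) : Prop :=
  edom phi x /\ forall e : R, 0 < e -> \forall y \near x,
    ((fine (phi x) + dotv v (y - x) - e * `|y - x|)%:E <= phi y)%E.

Lemma row_mx_sub (k l : nat) (z z' : 'rV[R]_(k + l)) :
  z - z' = row_mx (lsubmx z - lsubmx z') (rsubmx z - rsubmx z').
Proof. by rewrite -{1}[z]hsubmxK -{1}[z']hsubmxK opp_row_mx add_row_mx. Qed.

Lemma norm_row_mx1 (k : nat) (u : 'rV[R]_k) (r : 'rV[R]_1) (c : R) :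
  (`|row_mx u r| <= c) = (`|u| <= c) && (`|r 0 0| <= c).
Proof.
rewrite norm_row_mx_le; congr (_ && _); apply/idP/idP; first exact/le_trans/coord_norm_le.
move=> h; apply: norm_le_coord => [|i]; first exact: le_trans h.
by rewrite ord1.
Qed.

Lemma dotv1 (u v : 'rV[R]_1) : dotv u v = u 0 0 * v 0 0.
Proof. by rewrite /dotv big_ord1. Qed.

(** Constant sequences suffice: the subgradient inequality makes (v, -1) a regular normal to the
    epigraph, since points of the epigraph lie above the values of [phi]. *)
Lemma rsub_subdifferential (k : nat) (phi : 'rV[R]_k -> \bar R) (x v : 'rV[R]_k) :
  (forall y, phi y <> -oo%E) -> rsub phi x v -> subdifferential phi x v.
Proof.
move=> phiNy [Dx hx]; split=> //.
have phix : phi x = (fine (phi x))%:E.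
  by rewrite fineK// fin_numE -ltey; apply/andP; split => //; exact/eqP.
exists (cst (row_mx x (const_mx (fine (phi x))))), (cst (row_mx v (const_mx (-1)))).
split; [| |exact: cvg_cst|exact: cvg_cst].
  by move=> i; rewrite /epi /= row_mxKl row_mxKr mxE -phix.
move=> i /=; apply/regular_normalP => e e0.
have [r r0 hr] := near_norm_ball (hx e e0).
apply: (near_of_ball r0) => h; set z := row_mx _ _ + h; rewrite /epi /= => hr' Oz.
have zh : z - row_mx x (const_mx (fine (phi x))) = row_mx (lsubmx z - x)
    (rsubmx z - const_mx (fine (phi x))).
  by rewrite row_mx_sub row_mxKl row_mxKr.
have hE : h = z - row_mx x (const_mx (fine (phi x))) by rewrite /z addrC addKr.
clearbody z; move: hr'; rewrite hE zh norm_row_mx_le => /andP[h1 h2].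
have xz : x + (lsubmx z - x) = lsubmx z by rewrite addrC subrK.
have /= := hr _ h1; rewrite xz => h3.
have := le_trans h3 Oz; rewrite lee_fin mxE => h4.
rewrite dotv_row_mx dotv1 !mxE.
have : e * `|lsubmx z - x| <=
    e * `|row_mx (lsubmx z - x) (rsubmx z - const_mx (fine (phi x)))|.
  by rewrite ler_wpM2l ?(ltW e0)//; have := lexx `|row_mx (lsubmx z - x)
    (rsubmx z - const_mx (fine (phi x)))|; rewrite norm_row_mx_le => /andP[].
lra.
Qed.

Lemma fin_dom (k : nat) (phi : 'rV[R]_k -> \bar R) x :
  (forall y, phi y <> -oo%E) -> edom phi x -> phi x = (fine (phi x))%:E.
Proof.
by move=> phiNy Dx; rewrite fineK// fin_numE -ltey; apply/andP; split => //; exact/eqP.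
Qed.

(** The point [z] may lie above the graph. A direction [d] violating the subgradient inequality
    gives an epigraph point over [x + d] at height [al + de], because [al] is at least the value at
    [x]; along it the normal inequality fails. *)
Lemma regular_normal_epi_rsub (k : nat) (phi : 'rV[R]_k -> \bar R)
    (z : 'rV[R]_(k + 1)) (v : 'rV[R]_k) (b : 'rV[R]_1) :
  (forall y, phi y <> -oo%E) -> epi phi z -> b 0 0 < 0 ->
  regular_normal (epi phi) z (row_mx v b) ->
  rsub phi (lsubmx z) ((- b 0 0)^-1 *: v).
Proof.
move=> phiNy Oz b0 /regular_normalP hn.
pose x := lsubmx z; pose al := rsubmx z 0 0; pose be := - b 0 0.
have be0 : 0 < be by rewrite oppr_gt0.
pose v' := be^-1 *: v.
have Dx : edom phi x by rewrite /edom /=; apply: le_lt_trans Oz _; rewrite ltry.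
have phix := fin_dom phiNy Dx.
have fx : fine (phi x) <= al by rewrite -lee_fin -phix.
split=> // e e0.
(* Chosen so that (d, de) has norm at most [c * |d|]. With tolerance [be * e / (2 * c)] the normal
   inequality then allows only half of the increment [be * e * |d|]. *)
pose c := 1 + k%:R * `|v'| + e.
have c0 : 0 < c by rewrite /c -addrA ltr_pwDl// addr_ge0 ?mulr_ge0// ltW.
have ep0 : 0 < be * e / (2 * c) by rewrite divr_gt0 ?mulr_gt0.
have [r r0 hr] := near_norm_ball (hn _ ep0).
apply: (@near_of_ball _ _ x _ (r / c)); first by rewrite divr_gt0.
move=> d hd; rewrite leNgt; apply/negP.
rewrite [x + d]addrC addrK => hlt.
have dne : d != 0.
  by apply/eqP => d0; move: hlt; rewrite d0 dotv0 normr0 mulr0 addr0 subr0 add0r -phix ltxx.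
have d0 : 0 < `|d| by rewrite normr_gt0.
pose de := dotv v' d - e * `|d|.
have deb : `|de| <= c * `|d|.
  have := dotv_le v' d; have := dotv_ge v' d.
  have : 0 <= e * `|d| by rewrite mulr_ge0// ltW.
  rewrite /de /c !mulrDl mul1r ler_norml => *; apply/andP; split; lra.
have hk : `|row_mx d (const_mx de : 'rV[R]_1)| <= c * `|d|.
  rewrite norm_row_mx1 mxE deb andbT ler_peMl//.
  by rewrite /c -addrA lerDl addr_ge0 ?mulr_ge0// ltW.
have := hr (row_mx d (const_mx de)).
have zE : z + row_mx d (const_mx de) = row_mx (d + x) (const_mx (al + de)).
  rewrite -[z in LHS]hsubmxK add_row_mx; congr row_mx; first by rewrite addrC.
  by apply/rowP => i; rewrite ord1 [LHS]mxE [const_mx de _ _]mxE [RHS]mxE.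
have -> : z + row_mx d (const_mx de) - z = row_mx d (const_mx de) by rewrite addrC addKr.
rewrite zE => /(_ _ _)/=.
have -> : `|row_mx d (const_mx de : 'rV[R]_1)| <= r.
  by apply: le_trans hk _; rewrite mulrC -ler_pdivlMr.
move=> /(_ isT); rewrite /epi /= row_mxKl row_mxKr mxE => hepi.
have {}hepi : dotv (row_mx v b) (row_mx d (const_mx de)) <=
    be * e / (2 * c) * `|row_mx d (const_mx de : 'rV[R]_1)|.
  apply: hepi; apply: le_trans (ltW hlt) _; rewrite lee_fin /de; lra.
have : be * e / (2 * c) * `|row_mx d (const_mx de : 'rV[R]_1)| <= be * e / 2 * `|d|.
  apply: le_trans (ler_wpM2l (ltW ep0) hk) _.
  rewrite le_eqVlt; apply/orP; left; apply/eqP; field; exact: lt0r_neq0.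
move: hepi; rewrite dotv_row_mx dotv1 mxE -[b 0 0]opprK -/be.
have -> : v = be *: v' by rewrite /v' scalerA mulfV ?gt_eqF// scale1r.
rewrite dotvZl /de; have : 0 < be * e * `|d| by rewrite !mulr_gt0.
move: (dotv _ _) => X; lra.
Qed.

(** In regular normals converging to (v, -1) the last component is eventually negative; dividing by
    its absolute value gives regular subgradients at nearby points. *)
Lemma subdifferential_rsub (k : nat) (phi : 'rV[R]_k -> \bar R) (x v : 'rV[R]_k) :
  (forall y, phi y <> -oo%E) -> subdifferential phi x v ->
  edom phi x /\ forall e : R, 0 < e -> exists x' v',
    [/\ `|x' - x| <= e, `|v' - v| <= e & rsub phi x' v'].
Proof.
move=> phiNy [Dx [z_ [w_ [hz hw zc wc]]]]; split=> // e e0.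
have zc' : (fun i => row_mx (lsubmx (z_ i)) (rsubmx (z_ i))) @ \oo -->
    row_mx x (const_mx (fine (phi x))).
  by under eq_fun do rewrite hsubmxK.
have wc' : (fun i => row_mx (lsubmx (w_ i)) (rsubmx (w_ i))) @ \oo -->
    row_mx v (const_mx (-1)).
  by under eq_fun do rewrite hsubmxK.
have [z1 _] := (cvg_row_mx _ _ _ _).1 zc'.
have [w1 w2] := (cvg_row_mx _ _ _ _).1 wc'.
have w3 : (fun i => rsubmx (w_ i) 0 0) @ \oo --> (-1 : R).
  have := cvg_comp _ _ w2 (@coord_continuous _ _ _ 0 0 _); rewrite mxE; exact.
have w4 : (fun i => (- rsubmx (w_ i) 0 0)^-1 *: lsubmx (w_ i)) @ \oo --> v.
  rewrite -[X in _ --> X]scale1r -[X in X *: _]invr1 -[X in X^-1]opprK.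
  apply: cvgZ => //; apply: cvgV; first by rewrite opprK oner_eq0.
  exact: cvgN.
have n1 : \forall i \near \oo, `|x - lsubmx (z_ i)| <= e.
  by move/cvgrPdist_le : z1; apply.
have n2 : \forall i \near \oo, `|v - (- rsubmx (w_ i) 0 0)^-1 *: lsubmx (w_ i)| <= e.
  by move/cvgrPdist_le : w4; apply.
have n3 : \forall i \near \oo, rsubmx (w_ i) 0 0 < 0.
  by move/cvgr_lt : w3; apply; rewrite oppr_lt0.
have [i [i1 [i2 i3]]] := filter_ex (filterI n1 (filterI n2 n3)).
exists (lsubmx (z_ i)), ((- rsubmx (w_ i) 0 0)^-1 *: lsubmx (w_ i)).
split; [by rewrite distrC|by rewrite distrC|].
by apply: regular_normal_epi_rsub => //; rewrite hsubmxK.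
Qed.

Lemma rsub_le (k : nat) (phi : 'rV[R]_k -> \bar R) (x v : 'rV[R]_k) (e : R) :
  (forall y, phi y <> -oo%E) -> rsub phi x v -> 0 < e ->
  exists2 r : R, 0 < r & forall h, `|h| <= r -> edom phi (x + h) ->
    fine (phi x) + dotv v h - e * `|h| <= fine (phi (x + h)).
Proof.
move=> phiNy [_ h] e0; have [r r0 hr] := near_norm_ball (h e e0).
exists r => // d /hr /= + Dd; rewrite (fin_dom phiNy Dd) lee_fin.
by rewrite [x + d - x]addrC addKr.
Qed.

End Subgradients.

(** * Multipliers under metric subregularity *)

Ltac vring := apply/rowP => ?; rewrite !mxE; ring.

Record composite_setting {R : realType} {n m : nat}
    (phi : 'rV[R]_n -> \bar R) (theta : 'rV[R]_m -> \bar R)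
    (f : 'rV[R]_n -> 'rV[R]_m) (xb vb : 'rV[R]_n) (s : nat)
    (L : 'I_s -> seq ('rV[R]_m * R)) (A : 'I_s -> 'M[R]_m)
    (a : 'I_s -> 'rV[R]_m) (alpha : 'I_s -> R) : Prop := CompositeSetting {
  set_phi_gtNy : forall x, phi x <> -oo%E;
  set_theta_gtNy : forall y, theta y <> -oo%E;
  set_phi_comp : \forall x \near xb, phi x = theta (f x);
  set_C2 : C2_around f xb;
  set_dom : edom theta (f xb);
  set_msqc : MSQC theta f xb;
  set_sub : subdifferential phi xb vb;
  set_plq : convex_plq (edom theta) (fun y => fine (theta y)) L A a alpha }.

Section Composite.
Context {R : realType} {n m : nat}.
Variables (phi : 'rV[R]_n -> \bar R) (theta : 'rV[R]_m -> \bar R).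
Variables (f : 'rV[R]_n -> 'rV[R]_m) (xb vb : 'rV[R]_n) (s : nat).
Variables (L : 'I_s -> seq ('rV[R]_m * R)) (A : 'I_s -> 'M[R]_m).
Variables (a : 'I_s -> 'rV[R]_m) (alpha : 'I_s -> R).
Hypothesis setP : composite_setting phi theta f xb vb L A a alpha.
Let phi_gtNy := set_phi_gtNy setP.
Let theta_gtNy := set_theta_gtNy setP.
Let phi_comp := set_phi_comp setP.
Let f_C2 := set_C2 setP.
Let fxb_dom := set_dom setP.
Let msqc := set_msqc setP.
Let plqP := set_plq setP.
Let th_convex := plq_convex plqP.

Local Notation D := (edom theta).
Local Notation th := (fun y => fine (theta y)).
Local Notation cs := (csub D th).

Lemma rsub_csub y lam : rsub theta y lam -> cs y lam.
Proof.
move=> h; have Dy : D y by case: h.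
split=> // y' Dy'; apply/ler_addgt0Pr => e e0.
pose d := y' - y; have d0 : 0 < `|d| + 1 by rewrite ltr_wpDl.
have [r r0 hr] := rsub_le theta_gtNy h (divr_gt0 e0 d0).
pose t := Num.min 2^-1 (r / (`|d| + 1)).
have t0 : 0 < t by rewrite lt_min invr_gt0 ltr0n divr_gt0.
have t1 : t < 1 by rewrite gt_min invf_lt1// ltr1n.
have td : `|t *: d| <= r.
  rewrite normrZ gtr0_norm//; apply: (@le_trans _ _ (t * (`|d| + 1))).
    by rewrite ler_wpM2l ?(ltW t0)// lerDl.
  by rewrite -ler_pdivlMr// ge_min lexx orbT.
have [|Dt ht] := th_convex _ Dy' Dy (t := t); first by rewrite t0.
have tE : t *: y' + (1 - t) *: y = y + t *: d.
  by rewrite scalerBl scale1r scalerBr addrCA.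
rewrite tE in Dt ht.
have := hr _ td Dt; rewrite dotvZr normrZ (gtr0_norm t0) => h1.
have h2 : e / (`|d| + 1) * (t * `|d|) <= t * e.
  rewrite mulrCA ler_wpM2l ?(ltW t0)// mulrAC ler_pdivrMr//.
  by rewrite ler_wpM2l ?(ltW e0)// lerDl.
rewrite -(ler_pM2l t0); move: h1 h2 ht; rewrite -/d.
move: (dotv _ _) => X h1 h2 ht; nra.
Qed.

Lemma csub_rsub y lam : cs y lam -> rsub theta y lam.
Proof.
move=> [Dy h]; split=> // e e0; apply: (@near_of_ball _ _ y _ 1) => // k _; set y' := y + k.
have [ey'|Dy'] := eqVneq (theta y') +oo%E; first by rewrite ey' leey.
have Dy'' : D y' by rewrite /edom /= ltey.
rewrite (fin_dom theta_gtNy Dy'') lee_fin; have := h _ Dy''.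
have : 0 <= e * `|y' - y| by rewrite mulr_ge0// ltW.
lra.
Qed.

(** By convexity regular subgradients of [theta] satisfy the global inequality, and the graph of
    [csub] is closed, so the limits in the limiting subdifferential add nothing. *)
Lemma theta_subdifferential y lam : subdifferential theta y lam <-> cs y lam.
Proof.
split; last by move/csub_rsub; exact: rsub_subdifferential.
move=> /(subdifferential_rsub theta_gtNy)[Dy h].
have H (i : nat) : exists p : 'rV[R]_m * 'rV[R]_m,
    [/\ `|p.1 - y| <= i.+1%:R^-1, `|p.2 - lam| <= i.+1%:R^-1 & cs p.1 p.2].
  have [|y' [l' [h1 h2 /rsub_csub h3]]] := h i.+1%:R^-1; first by rewrite invr_gt0.
  by exists (y', l').
have [p hp] := choice H.
have c (q : nat -> 'rV[R]_m) q0 : (forall i, `|q i - q0| <= i.+1%:R^-1) ->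
    q @ \oo --> q0.
  move=> hq; apply/cvgrPdist_le => e e0.
  have /cvgrPdist_le/(_ e e0) := @cvg_harmonic R.
  apply: filterS => i; rewrite sub0r normrN ger0_norm ?invr_ge0//=.
  by apply: le_trans; rewrite distrC.
apply: (csub_closed plqP (F := \oo) (y := fst \o p) (lam := snd \o p)).
- by apply: c => i; have [] := hp i.
- by apply: c => i; have [] := hp i.
- by apply: nearW => i; have [] := hp i.
Qed.

(** Gathers on one ball all local information. The last clause is MSQC with the distances unfolded:
    any [y] in the domain bounds the distance to the feasible set, [kap] includes the comparison of
    norms, and [tau] is there because the infimum need not be attained. *)
Lemma good_ball : exists rho Lf kap : R, [/\ 0 < rho, 0 < Lf, 0 < kap &
  forall h, `|h| <= rho ->
  [/\ differentiable f (xb + h), phi (xb + h) = theta (f (xb + h)),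
   (forall h', `|h'| <= rho -> `|f (xb + h) - f (xb + h')| <= Lf * `|h - h'|) &
   forall y tau, D y -> 0 < tau -> exists h', D (f (xb + h')) /\
     `|h - h'| <= kap * `|f (xb + h) - y| + tau]].
Proof.
have [Lf [r1 [Lf0 r10 hL]]] := C2_lipschitz f_C2.
have [r2 r20 h2] := near_norm_ball (C2_near f_C2).
have [r3 r30 h3] := near_norm_ball phi_comp.
have [kappa kappa0 /near_norm_ball[r4 r40 h4]] := msqc.
exists (Num.min (Num.min r1 r2) (Num.min r3 r4)), Lf, (kappa * m.+1%:R + 1).
split=> //; first by rewrite !lt_min r10 r20 r30 r40.
  by rewrite ltr_wpDl// mulr_ge0.
move=> h; rewrite !le_min => /andP[/andP[hr1 hr2] /andP[hr3 hr4]].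
split; [exact: h2|exact: h3| |].
  by move=> h'; rewrite !le_min => /andP[/andP[hr1' _] _]; exact: hL.
move=> y tau Dy tau0.
pose S := [set enorm (xb + h - x) | x in f @^-1` D].
have [S0 Slb] : S !=set0 /\ has_lbound S.
  split; first by exists (enorm (xb + h - xb)), xb.
  by exists 0 => _ [x _ <-]; exact: sqrtr_ge0.
have [_ [x Dx <-] hx] := inf_adherent tau0 (conj S0 Slb).
exists (x - xb); rewrite addrC subrK; split=> //.
rewrite opprB addrA [h + xb]addrC.
apply: le_trans (norm_le_enorm _) _; apply: le_trans (ltW hx) _.
rewrite lerD2r; apply: le_trans (h4 _ hr4) _.
apply: (@le_trans _ _ (kappa * enorm (f (xb + h) - y))).
  rewrite ler_wpM2l//; apply: ge_inf; last by exists y.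
  by exists 0 => _ [z _ <-]; exact: sqrtr_ge0.
apply: (@le_trans _ _ (kappa * m.+1%:R * `|f (xb + h) - y|)).
  by rewrite -mulrA ler_wpM2l// enorm_le.
by rewrite ler_wpM2r// lerDl.
Qed.

Lemma directional_cvg (g : 'rV[R]_n -> 'rV[R]_m) x u : differentiable g x ->
  (fun t : R => t^-1 *: (g (x + t *: u) - g x)) @ (0 : R)^'+ --> nabla_app g x u.
Proof.
move=> dg; rewrite /nabla_app -deriveEjacobian//.
have /cvg_ex[l hl] := @diff_derivable _ _ _ g x u dg.
have -> : 'D_u g x = l by exact: cvg_lim.
apply: cvg_dnbhs_at_right; move: hl.
rewrite (_ : (fun h : R => _) = (fun t : R => t^-1 *: (g (x + t *: u) - g x)))//.
by apply/funext => t /=; rewrite [_ + x]addrC.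
Qed.

Lemma box_compact (x : 'rV[R]_n) (y : 'rV[R]_m) (d d' : R) :
  compact [set p : 'rV[R]_n * 'rV[R]_m | `|p.1 - x| <= d /\ `|p.2 - y| <= d'].
Proof.
have B (k : nat) (z : 'rV[R]_k) c : compact [set w : 'rV[R]_k | `|w - z| <= c].
  rewrite (_ : [set _ | _] = +%R z @` [set w | `|w| <= c]).
    apply: continuous_compact (@norm_ball_compact R k c).
    apply: continuous_subspaceT => w; apply: (@cvgD _ _ _ (nbhs w)); first exact: cvg_cst.
    exact: cvg_id.
  apply/seteqP; split => [w wc|_ [w wc <-] /=]; first by exists (w - z) => //; rewrite addrC subrK.
  by rewrite addrAC subrr add0r.
exact: (compact_setX (B n x d) (B m y d')).
Qed.

(* Near a subgradient [v] at [x] the composite function can be decoupled: the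
   subregularity condition turns the constraint [y = f x'] into an exact penalty. *)
Lemma exact_penalty : exists r1 Lf Lb : R, [/\ 0 < r1, 0 < Lf, 0 < Lb &
  forall h v, `|h| <= r1 -> `|v| <= `|vb| + 1 -> rsub phi (xb + h) v ->
  D (f (xb + h)) /\ forall e1 e : R, 0 < e1 <= 1 -> 0 < e ->
  exists de, [/\ 0 < de, (Lf + 2) * de <= e,
    forall x', `|x' - (xb + h)| <= de ->
      differentiable f x' /\ `|f x' - f (xb + h)| <= Lf * `|x' - (xb + h)| &
    forall x' y, `|x' - (xb + h)| <= de -> `|y - f (xb + h)| <= (Lf + 1) * de -> D y ->
      th (f (xb + h)) + dotv v (x' - (xb + h)) - e1 * `|x' - (xb + h)|
        - Lb * `|f x' - y| <= th y]].
Proof.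
have [rho [Lf [kap [rho0 Lf0 kap0 good]]]] := good_ball.
have rhoD0 : 0 <= `|f xb| + (2 * Lf + 1) * rho.
  by rewrite addr_ge0// mulr_ge0 ?ltW// addr_gt0// mulr_gt0.
have [l l0 hl] := dom_lipschitz plqP rhoD0.
(* [G] is the cost per unit length of moving [x'] to a feasible point: [n%:R * V] for the linear
   term, 1 for the [e1] term, [l * Lf] for [theta]. In [Lb] this length is at most [kap] times the
   gap between [f x'] and [y], and the extra [l] pays for passing from [f x'] to [y]. *)
pose V := `|vb| + 1; pose G := n%:R * V + 1 + l * Lf.
have V0 : 0 < V by rewrite ltr_wpDl.
have G0 : 0 < G by rewrite addr_gt0 ?mulr_gt0// ltr_wpDl// mulr_ge0// ltW.
pose Lb := G * kap + l.
have Lb0 : 0 < Lb by rewrite addr_gt0// mulr_gt0.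
exists (rho / 2), Lf, Lb; split=> //; first by rewrite divr_gt0.
move=> h v hr vV hsub; pose x := xb + h.
have hrho : `|h| <= rho by lra.
have [dfx phix _ _] := good _ hrho.
have Dx : D (f x) by case: hsub; rewrite /edom /= phix.
split=> // e1 e /andP[e10 e1le1] e0.
have [r r0 hr1] := rsub_le phi_gtNy hsub e10.
(* The feasible point has distance at most [K * de] from [xb + h]: [de] for [x'],
   [kap * (2 * Lf + 1) * de] for its correction, [de] for the slack [tau]. It thus stays where the
   subgradient inequality is available. *)
pose K := 2 + kap * (2 * Lf + 1).
have K2 : 2 <= K by rewrite /K lerDl mulr_ge0 ?(ltW kap0)// addr_ge0// mulr_ge0// ltW.
pose mn := Num.min e (Num.min r (rho / 2)).
have mn0 : 0 < mn by rewrite !lt_min e0 r0 divr_gt0.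
have [mne [mnr mnrho]] : mn <= e /\ mn <= r /\ mn <= rho / 2.
  by rewrite /mn !ge_min !lexx !orbT.
pose de := mn / (K * (Lf + 2)).
have KL0 : 0 < K * (Lf + 2) by apply: mulr_gt0; lra.
have de0 : 0 < de by rewrite divr_gt0.
have deE : de * (K * (Lf + 2)) = mn by rewrite /de divfK// gt_eqF.
have Kde : K * de <= mn.
  rewrite -deE mulrC ler_wpM2l ?(ltW de0)// ler_peMr ?(le_trans _ K2)//; lra.
have Lde : (Lf + 2) * de <= mn.
  rewrite -deE mulrC ler_wpM2l ?(ltW de0)// ler_peMl ?addr_ge0 ?(ltW Lf0)//; lra.
have de_mn : 2 * de <= mn by apply: le_trans Kde; rewrite ler_wpM2r// ltW.
pose de' := (Lf + 1) * de.
have Lfde : 0 < Lf * de by rewrite mulr_gt0.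
have fbound k : `|k| <= rho -> `|f (xb + k)| <= `|f xb| + Lf * rho.
  move=> hk; have [_ _ + _] := good _ hk.
  move=> /(_ 0); rewrite normr0 (ltW rho0) addr0 subr0 => /(_ isT) h1.
  rewrite -[f (xb + k)](subrK (f xb)) addrC.
  apply: le_trans (ler_normD _ _) _; rewrite lerD2l (le_trans h1)//.
  by rewrite ler_wpM2l// ltW.
have bound_y y : `|y - f x| <= de' -> `|y| <= `|f xb| + (2 * Lf + 1) * rho.
  move=> hy; rewrite -[y](subrK (f x)); apply: le_trans (ler_normD _ _) _.
  have := fbound _ hrho; rewrite -/x => h1.
  have : (Lf + 1) * de <= (Lf + 1) * rho.
    by rewrite ler_wpM2l ?addr_ge0 ?ltW//; lra.
  move: hy; rewrite /de'; lra.
exists de; split=> // [|x' hx'|x' y hx' hy Dy]; first exact: le_trans Lde mne.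
  have x'E : x' = xb + (h + (x' - x)) by rewrite addrA addrC subrK.
  have hb : `|h + (x' - x)| <= rho by apply: le_trans (ler_normD _ _) _; lra.
  have [df _ lip _] := good _ hb; rewrite -x'E in df lip; split=> //.
  by have := lip _ hrho; rewrite addrAC subrr add0r.
pose k := x' - x.
have xk : x' = xb + (h + k) by rewrite addrA [_ + k]addrC subrK.
have hkrho : `|h + k| <= rho.
  by apply: le_trans (ler_normD _ _) _; rewrite -/k in hx'; lra.
have [_ _ lipk msk] := good _ hkrho.
pose q := `|f x' - y|.
have qb : q <= (2 * Lf + 1) * de.
  rewrite /q -[f x' - y](subrKA (f x)).
  apply: le_trans (ler_normD _ _) _; rewrite [`|f x - y|]distrC.
  have := lipk _ hrho; rewrite -xk -/x addrAC subrr add0r => h1.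
  have : Lf * `|k| <= Lf * de by rewrite ler_wpM2l// ltW.
  move: hy; rewrite /de'; lra.
rewrite -subr_ge0; apply: (@small_limit_ge0 _ _ G de) => // tau /andP[tau0 taude].
have [h' [Dh' hh']] := msk y tau Dy tau0; rewrite -xk -/q in hh'.
have kq : kap * q <= kap * ((2 * Lf + 1) * de) by rewrite ler_wpM2l// ltW.
have h'h : `|h' - h| <= mn.
  rewrite -[h' - h](subrKA (h + k)); apply: le_trans (ler_normD _ _) _.
  rewrite distrC [h + k]addrC addrK; apply: le_trans _ Kde; rewrite [k + h]addrC.
  rewrite /K mulrDl -mulrA; move: hx'; rewrite -/k; lra.
have h'rho : `|h'| <= rho.
  by rewrite -[h'](subrK h); apply: le_trans (ler_normD _ _) _; lra.
have [_ phih' lip' _] := good _ h'rho.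
have xh' : xb + h + (h' - h) = xb + h' by vring.
have := hr1 _ (le_trans h'h mnr); rewrite xh' /edom /= phih' phix => /(_ Dh') i1.
have yb := bound_y _ hy.
have fh'b : `|f (xb + h')| <= `|f xb| + (2 * Lf + 1) * rho.
  apply: le_trans (fbound _ h'rho) _; rewrite lerD2l ler_wpM2r ?(ltW rho0)//; lra.
have i2 := hl _ _ Dh' Dy fh'b yb.
have i3 : `|y - f (xb + h')| <= q + Lf * `|h + k - h'|.
  rewrite -[y - _](subrKA (f x')); apply: le_trans (ler_normD _ _) _.
  by rewrite distrC lerD2l xk; exact: lipk.
have i4 : dotv v k - n%:R * V * `|h + k - h'| <= dotv v (h' - h).
  have -> : h' - h = k - (h + k - h') by vring.
  rewrite [leRHS]dotvBr lerD2l lerN2; apply: le_trans (dotv_le _ _) _.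
  by rewrite ler_wpM2r// ler_wpM2l.
have i5 : `|h' - h| <= `|k| + `|h + k - h'|.
  have -> : h' - h = k - (h + k - h') by vring.
  exact: ler_normB.
have i6 : e1 * `|h' - h| <= e1 * `|k| + `|h + k - h'|.
  have := ler_wpM2l (ltW e10) i5; have := ler_wpM2r (normr_ge0 (h + k - h')) e1le1.
  lra.
have i7 : l * `|y - f (xb + h')| <= l * q + l * Lf * `|h + k - h'|.
  by have := ler_wpM2l (ltW l0) i3; rewrite mulrDr mulrA.
have i8 : G * `|h + k - h'| <= G * (kap * q + tau) by rewrite ler_wpM2l// ltW.
have GE : G = n%:R * V + 1 + l * Lf by [].
have LbE : Lb = G * kap + l by [].
have i9 : G * `|h + k - h'| = n%:R * V * `|h + k - h'| + `|h + k - h'|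
    + l * Lf * `|h + k - h'| by rewrite GE; ring.
rewrite i9 in i8; rewrite -/k -/q LbE; clear -i1 i2 i4 i6 i7 i8; lra.
Qed.

(** The multiplier is [rr *: (f x' - y)] at a minimizer of the penalized problem. Comparison with
    the point (x, f x) and [exact_penalty] bound its norm by [2 * Lb], whatever the penalty
    parameter [rr] and the accuracy [e]. *)
Lemma approx_multiplier : exists r1 M : R, [/\ 0 < r1, 0 < M &
  forall h v, `|h| <= r1 -> `|v| <= `|vb| + 1 -> rsub phi (xb + h) v ->
  forall e : R, 0 < e -> exists x' y lam,
    [/\ `|x' - (xb + h)| <= e, `|y - f (xb + h)| <= e, cs y lam, `|lam| <= M &
        differentiable f x' /\ `|nabla_adj f x' lam - v| <= e]].
Proof.
have [r1 [Lf [Lb [r10 Lf0 Lb0 hpen]]]] := exact_penalty.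
exists r1, (2 * Lb); split=> //; first by rewrite mulr_gt0.
move=> h v hr vV hsub e e0.
have [Dx {}hpen] := hpen h v hr vV hsub.
pose x := xb + h.
pose e1 := Num.min (e / 2) 1.
have e10 : 0 < e1 by rewrite lt_min divr_gt0/=.
have e1le1 : e1 <= 1 by rewrite ge_min lexx orbT.
have e1e : 2 * e1 <= e.
  by have : e1 <= e / 2 by [rewrite ge_min lexx]; lra.
have [|de [de0 Lde good penalty]] := hpen e1 e _ e0; first by rewrite e10.
pose de' := (Lf + 1) * de.
have Lfde : 0 < Lf * de by rewrite mulr_gt0.
(* The two summands yield [rrA] and [rrB], which force the minimizer off the boundary of the box in
   [x'] and in [y] respectively. *)
pose rr := 4 * Lb ^+ 2 / (e1 * de) + 4 * Lb / de + 1.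
have ed0 : 0 < e1 * de by rewrite mulr_gt0.
have rr1 : 0 <= 4 * Lb ^+ 2 / (e1 * de).
  by rewrite divr_ge0 ?(ltW ed0)// mulr_ge0// sqr_ge0.
have rr2 : 0 <= 4 * Lb / de by apply: divr_ge0; lra.
have rr0 : 0 < rr by rewrite /rr; lra.
have rrA : 4 * Lb ^+ 2 <= rr * (e1 * de).
  by rewrite -ler_pdivrMr// /rr; lra.
have rrB : 4 * Lb <= rr * de by rewrite -ler_pdivrMr// /rr; lra.
pose C := [set p : 'rV[R]_n * 'rV[R]_m | `|p.1 - x| <= de /\ `|p.2 - f x| <= de'].
(* Of the weight [2 * e1], one half pays for the [e1] term of [penalty]; the other half remains to
   bound [x' - x]. *)
pose kk (p : 'rV[R]_n * 'rV[R]_m) := - dotv v (p.1 - x)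
  + rr / 2 * dotv (f p.1 - p.2) (f p.1 - p.2) + 2 * e1 * `|p.1 - x|.
have dfC x' : `|x' - x| <= de -> differentiable f x'.
  by move=> /good[].
have Cx : C (x, f x).
  by rewrite /C /= !subrr !normr0 (ltW de0) /de' mulr_ge0// ?addr_ge0// ltW.
have [|||||[x' y] [[/= hx' hy] /= Dy minp]] := @min_exists _ _ _ _ _ _ _ _ _
    plqP _ C snd kk (x, f x).
- exact: box_compact.
- by move=> p _; exact: cvg_snd.
- move=> [x1 y1] [/= hx1 hy1]; rewrite /continuous_at.
  have c1 : (fun p : 'rV[R]_n * 'rV[R]_m => p.1) @ (x1, y1) --> x1 by exact: cvg_fst.
  have c2 : (fun p : 'rV[R]_n * 'rV[R]_m => p.2) @ (x1, y1) --> y1 by exact: cvg_snd.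
  have c3 : (fun p : 'rV[R]_n * 'rV[R]_m => f p.1) @ (x1, y1) --> f x1.
    by apply: cvg_comp c1 _; exact: differentiable_continuous (dfC _ hx1).
  have c4 : (fun p : 'rV[R]_n * 'rV[R]_m => p.1 - x) @ (x1, y1) --> x1 - x.
    by apply: cvgB => //; exact: cvg_cst.
  have c5 : (fun p : 'rV[R]_n * 'rV[R]_m => f p.1 - p.2) @ (x1, y1) --> f x1 - y1.
    exact: cvgB.
  apply: cvgD; [apply: cvgD|].
  + by apply: cvgN; apply: cvg_dotv => //; exact: cvg_cst.
  + by apply: cvgM; [exact: cvg_cst|exact: cvg_dotv].
  + by apply: cvgM; [exact: cvg_cst|exact: cvg_norm].
- exact: Cx.
- by [].
pose w := f x' - y; pose q := `|w|; pose k := x' - x.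
have kx : kk (x, f x) = 0 by rewrite /kk /= !subrr !dotv0 normr0; lra.
have m0 : th y + kk (x', y) <= th (f x).
  by rewrite -[leRHS]addr0 -kx; exact: (minp (x, f x)).
have q0 : 0 <= q by exact: normr_ge0.
have k0 : 0 <= `|k| by exact: normr_ge0.
have key : rr / 2 * q ^+ 2 + e1 * `|k| <= Lb * q.
  have := penalty _ _ hx' hy Dy; rewrite -/k -/w -/q.
  move: m0; rewrite /kk /= -/k -/w.
  have : rr / 2 * q ^+ 2 <= rr / 2 * dotv w w.
    by apply: ler_wpM2l; [apply: divr_ge0; lra|exact: sqr_norm_le].
  lra.
have e1k0 : 0 <= e1 * `|k| by rewrite mulr_ge0// ltW.
have rq : rr * q <= 2 * Lb.
  have [->|qn0] := eqVneq q 0; first by rewrite mulr0 mulr_ge0// ltW.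
  have qp : 0 < q by rewrite lt0r qn0.
  rewrite -(ler_pM2r qp); move: key; rewrite expr2; lra.
have qde : q < de.
  rewrite -(ltr_pM2l rr0); apply: le_lt_trans rq _; apply: lt_le_trans rrB; lra.
have kde : `|k| < de.
  rewrite -(ltr_pM2l e10) -(ltr_pM2l rr0).
  have e1kq : e1 * `|k| <= Lb * q.
    have : 0 <= rr / 2 * q ^+ 2 by rewrite mulr_ge0 ?sqr_ge0// divr_ge0// ltW.
    lra.
  have := ler_wpM2l (ltW rr0) e1kq.
  have := ler_wpM2l (ltW Lb0) rq; have : 0 < Lb ^+ 2 by rewrite exprn_gt0.
  move: rrA; rewrite expr2; lra.
have ylt : `|y - f x| < de'.
  rewrite -[y - _](subrKA (f x')); apply: le_lt_trans (ler_normD _ _) _.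
  rewrite distrC -/w -/q; have [_] := good _ hx'; rewrite -/x -/k.
  have : Lf * `|k| <= Lf * de by rewrite ler_wpM2l ?ltW.
  rewrite /de'; lra.
exists x', y, (rr *: w); split.
- by apply: le_trans hx' _; lra.
- by apply: le_trans hy _; rewrite /de'; lra.
- apply: (csub_fermat plqP Dy) => y' Dy'.
  pose d := y' - y; pose gap := de' - `|y - f x|.
  have gap0 : 0 < gap by rewrite subr_gt0.
  have d0 : 0 < `|d| + 1 by rewrite ltr_wpDl.
  exists (rr / 2 * dotv d d), (Num.min 2^-1 (gap / (`|d| + 1))); split.
    by rewrite lt_min invr_gt0 ltr0n divr_gt0.
  move=> t /andP[t0]; rewrite le_min => /andP[t1 tg].
  have t01 : 0 < t < 1 by rewrite t0 (le_lt_trans t1)// invf_lt1// ltr1n.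
  have [Dt _] := th_convex t01 Dy' Dy.
  have tE : t *: y' + (1 - t) *: y = y + t *: d.
    by rewrite scalerBl scale1r scalerBr addrCA.
  rewrite tE in Dt.
  have Ct : C (x', y + t *: d).
    split=> //=; rewrite addrAC; apply: le_trans (ler_normD _ _) _.
    rewrite normrZ gtr0_norm//; move: tg; rewrite ler_pdivlMr// /gap => tg.
    have : t * `|d| <= t * (`|d| + 1) by rewrite ler_wpM2l ?(ltW t0)// lerDl.
    lra.
  have dE : f x' - (y + t *: d) = w - t *: d by rewrite opprD addrA.
  have := minp _ Ct Dt; rewrite /kk /= dE -/k -/w -/d.
  move: (k) (w) (d) => k1 w1 d1.
  rewrite !dotvBl !dotvBr !dotvZl !dotvZr [dotv d1 w1]dotvC.
  move: (dotv _ _) (dotv _ _) (dotv _ _) (dotv _ _) => X1 X2 X3 X4 H; nra.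
- by rewrite normrZ gtr0_norm.
split; first exact: dfC.
(* Stationarity in [x'] up to the nonsmooth term; tested on plus and minus the unit vectors it gives
   coordinates of size at most [2 * e1 <= e]. *)
have stat u : 0 <= dotv (nabla_adj f x' (rr *: w) - v) u + 2 * e1 * `|u|.
  pose g (t : R) := t^-1 *: (f (x' + t *: u) - f x').
  have gc : g @ (0 : R)^'+ --> nabla_app f x' u by exact: directional_cvg (dfC _ hx').
  have c0 : (fun t : R => t) @ (0 : R)^'+ --> (0 : R) by exact: cvg_right0.
  have u0 : 0 < `|u| + 1 by rewrite ltr_wpDl.
  have gap0 : 0 < de - `|k| by rewrite subr_gt0.
  have lim : (fun t => - dotv v u + rr * dotv w (g t) + rr / 2 * (t * dotv (g t) (g t))
      + 2 * e1 * `|u|) @ (0 : R)^'+ -->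
      - dotv v u + rr * dotv w (nabla_app f x' u)
        + rr / 2 * (0 * dotv (nabla_app f x' u) (nabla_app f x' u)) + 2 * e1 * `|u|.
    apply: cvgD; last exact: cvg_cst.
    apply: cvgD.
      apply: cvgD; first exact: cvg_cst.
      by apply: cvgM; [exact: cvg_cst|apply: cvg_dotv => //; exact: cvg_cst].
    by apply: cvgM; [exact: cvg_cst|apply: cvgM => //; exact: cvg_dotv].
  rewrite (_ : _ + _ = - dotv v u + rr * dotv w (nabla_app f x' u)
      + rr / 2 * (0 * dotv (nabla_app f x' u) (nabla_app f x' u)) + 2 * e1 * `|u|); last first.
    by rewrite nabla_adjZ dotvBl dotvZl dotv_adj; ring.
  apply: (cvg_le (f := cst 0) _ lim); first exact: cvg_cst.
  apply: filterS (right_small (divr_gt0 gap0 u0)) => t /andP[t0].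
  rewrite ler_pdivlMr// => tu.
  have xt : `|x' + t *: u - x| <= de.
    rewrite addrAC; apply: le_trans (ler_normD _ _) _; rewrite normrZ gtr0_norm// -/k.
    have : t * `|u| <= t * (`|u| + 1) by rewrite ler_wpM2l ?(ltW t0)// lerDl.
    lra.
  have := minp (x' + t *: u, y) (conj xt hy) Dy.
  have fE : f (x' + t *: u) - y = w + t *: g t.
    by rewrite /g scalerA mulfV ?gt_eqF// scale1r; vring.
  rewrite /kk /= fE -/w -/k.
  have nE : `|x' + t *: u - x| <= `|k| + t * `|u|.
    by rewrite addrAC; apply: le_trans (ler_normD _ _) _; rewrite normrZ gtr0_norm.
  have -> : x' + t *: u - x = k + t *: u by rewrite addrAC.
  rewrite addrAC -/k in nE.
  have := ler_wpM2l (ltW e10) nE; move: (k) (w) (g t) => k1 w1 g1 H2.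
  rewrite !dotvDl !dotvDr !dotvZl !dotvZr [dotv g1 w1]dotvC => H.
  rewrite -(pmulr_rge0 _ t0).
  move: H H2; move: (dotv _ _) (dotv _ _) (dotv _ _) (dotv _ _) => X1 X2 X3 X4 H H2.
  nra.
apply: norm_le_coord => [|j]; first exact: ltW.
have dj (c : R) : `|c| <= 1 -> `|c *: (delta_mx 0 j : 'rV[R]_n)| <= 1.
  move=> c1; apply: norm_le_coord => // i; rewrite !mxE eqxx /=.
  by case: eqP => _ /=; rewrite ?mulr1// mulr0 normr0.
have n1 : `|1 : R| <= 1 by rewrite normr1.
have n2 : `|-1 : R| <= 1 by rewrite normrN normr1.
have s1 := stat (1 *: delta_mx 0 j); have s2 := stat (-1 *: delta_mx 0 j).
rewrite dotvZr dotv_deltar in s1; rewrite dotvZr dotv_deltar in s2.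
have d1 := ler_wpM2l (ltW e10) (dj 1 n1); have d2 := ler_wpM2l (ltW e10) (dj (-1) n2).
by rewrite ler_norml; apply/andP; split; lra.
Qed.

End Composite.

(** * Exact bounded multipliers and quadratic growth *)

Section Multipliers.
Context {R : realType} {n m : nat}.
Variables (phi : 'rV[R]_n -> \bar R) (theta : 'rV[R]_m -> \bar R).
Variables (f : 'rV[R]_n -> 'rV[R]_m) (xb vb : 'rV[R]_n) (s : nat).
Variables (L : 'I_s -> seq ('rV[R]_m * R)) (A : 'I_s -> 'M[R]_m).
Variables (a : 'I_s -> 'rV[R]_m) (alpha : 'I_s -> R).
Hypothesis setP : composite_setting phi theta f xb vb L A a alpha.
Let phi_gtNy := set_phi_gtNy setP.
Let theta_gtNy := set_theta_gtNy setP.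
Let f_C2 := set_C2 setP.
Let vb_sub := set_sub setP.
Let plqP := set_plq setP.

Local Notation D := (edom theta).
Local Notation th := (fun y => fine (theta y)).
Local Notation cs := (csub D th).

Lemma cvg_harmonic_bound (V : normedModType R) (q : nat -> V) q0 (c : R) :
  (forall i, `|q i - q0| <= c * i.+1%:R^-1) -> q @ \oo --> q0.
Proof.
move=> h; apply/cvgrPdist_le => e e0.
have c0 : 0 < `|c| + 1 by rewrite ltr_wpDl.
have /cvgrPdist_le/(_ _ (divr_gt0 e0 c0)) := @cvg_harmonic R.
apply: filterS => i; rewrite sub0r normrN ger0_norm ?invr_ge0//= => hi.
rewrite distrC; apply: le_trans (h i) _.
rewrite ler_pdivlMr// in hi; apply: le_trans hi.
rewrite mulrC ler_wpM2l ?invr_ge0// (le_trans (ler_norm _))// lerDl//.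
Qed.

(** A limiting subgradient is approached by regular ones, these have approximate multipliers of norm
    at most [M], and a limit along an ultrafilter is exact because the graph of [csub] is closed and
    the adjoint is continuous in both arguments. *)
Lemma multiplier_exists : exists r2 M : R, [/\ 0 < r2, 0 < M & forall h v,
  `|h| <= r2 -> `|v - vb| <= 2^-1 -> subdifferential phi (xb + h) v ->
  exists lam, [/\ `|lam| <= M, nabla_adj f (xb + h) lam = v & cs (f (xb + h)) lam]].
Proof.
have [r1 [M [r10 M0 happ]]] := approx_multiplier setP.
have [r' r'0 hadj] := near_norm_ball (C2_adj_continuous f_C2).
have [r3 r30 hdf] := near_norm_ball (C2_near f_C2).
exists (Num.min (r1 / 2) (Num.min r' r3)), M; split=> //.
  by rewrite !lt_min divr_gt0 ?r'0.
move=> h v; rewrite !le_min => /and3P[hr1 hr' hr3] hv.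
move=> /(subdifferential_rsub phi_gtNy)[_ hsub].
have H (i : nat) : exists p : 'rV[R]_n * 'rV[R]_n * 'rV[R]_m * 'rV[R]_m,
    [/\ `|p.1.1.1 - (xb + h)| <= 1 * i.+1%:R^-1,
        `|p.1.1.2 - (xb + h)| <= 2 * i.+1%:R^-1,
        `|p.1.2 - f p.1.1.1| <= 1 * i.+1%:R^-1,
        cs p.1.2 p.2 & [/\ `|p.2| <= M, differentiable f p.1.1.2 &
        `|nabla_adj f p.1.1.2 p.2 - v| <= 2 * i.+1%:R^-1]].
  have i0 : 0 < i.+1%:R^-1 :> R by rewrite invr_gt0.
  (* The caps [r1 / 2] and [2^-1] keep the approximating point in the ball, and its subgradient
     below [|vb| + 1], as [approx_multiplier] requires. *)
  pose e : R := Num.min i.+1%:R^-1 (Num.min (r1 / 2) 2^-1).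
  have e0 : 0 < e by rewrite !lt_min i0 divr_gt0//= invr_gt0.
  have [ei [er e2]] : e <= i.+1%:R^-1 /\ e <= r1 / 2 /\ e <= 2^-1.
    by rewrite /e !ge_min !lexx !orbT.
  have [x' [v' [hx' hv' rs]]] := hsub e e0.
  have xE : xb + (x' - xb) = x' by rewrite addrC subrK.
  have b1 : `|x' - xb| <= r1.
    have -> : x' - xb = (x' - (xb + h)) + h by vring.
    by apply: le_trans (ler_normD _ _) _; lra.
  have b2 : `|v'| <= `|vb| + 1.
    rewrite -[v'](subrK v); apply: le_trans (ler_normD _ _) _.
    have : `|v| <= 2^-1 + `|vb|.
      by rewrite -[v](subrK vb); apply: le_trans (ler_normD _ _) _; rewrite lerD2r.
    lra.
  rewrite -xE in rs.
  have [x2 [y [lam [c1 c2 c3 c4 [c5 c6]]]]] := happ _ _ b1 b2 rs e e0.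
  rewrite xE in c1 c2.
  have ed : e + e <= 2 * i.+1%:R^-1 by rewrite mulr_natl mulr2n lerD.
  exists (x', x2, y, lam) => /=; split => //; rewrite ?mul1r.
  - exact: le_trans hx' ei.
  - rewrite -[x2 - _](subrKA x'); apply: le_trans (ler_normD _ _) _.
    exact: le_trans (lerD c1 hx') ed.
  - exact: le_trans c2 ei.
  split=> //; rewrite -[_ - v](subrKA v'); apply: le_trans (ler_normD _ _) _.
  exact: le_trans (lerD c6 hv') ed.
have [p hp] := choice H.
have pc1 : (fun i => (p i).1.1.1) @ \oo --> xb + h.
  by apply: (@cvg_harmonic_bound _ _ _ 1) => i; have [] := hp i.
have pc2 : (fun i => (p i).1.1.2) @ \oo --> xb + h.
  by apply: (@cvg_harmonic_bound _ _ _ 2) => i; have [] := hp i.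
have pc3 : (fun i => (p i).1.2) @ \oo --> f (xb + h).
  have -> : (fun i => (p i).1.2) = (fun i => ((p i).1.2 - f (p i).1.1.1) + f (p i).1.1.1).
    by apply/funext => i; rewrite subrK.
  rewrite -[X in _ --> X]add0r; apply: cvgD.
    by apply: (@cvg_harmonic_bound _ _ _ 1) => i; rewrite subr0; have [] := hp i.
  by apply: (cvg_comp _ _ pc1); exact: differentiable_continuous (hdf _ hr3).
have pc4 : (fun i => nabla_adj f (p i).1.1.2 (p i).2) @ \oo --> v.
  by apply: (@cvg_harmonic_bound _ _ _ 2) => i; have [_ _ _ _ []] := hp i.
have [U [UU FU]] := @ultraFilterLemma _ \oo _.
have [lam lamc lamM] : exists2 l, (fun i => (p i).2) @ U --> l & `|l| <= M.
  apply: ultra_bounded_cvg; apply: filterE => i.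
  by have [_ _ _ _ []] := hp i.
exists lam; split=> //.
  have c1 : (fun i => nabla_adj f (p i).1.1.2 (p i).2) @ U --> nabla_adj f (xb + h) lam.
    apply: (hadj _ hr') => //.
      by apply: filterE => i; have [_ _ _ _ []] := hp i.
    by apply: cvg_trans pc2 => B; exact: FU.
  have c2 : (fun i => nabla_adj f (p i).1.1.2 (p i).2) @ U --> v.
    by apply: cvg_trans pc4 => B; exact: FU.
  exact: (cvg_unique _ c1 c2).
apply: (csub_closed plqP (F := U) (y := fun i => (p i).1.2) (lam := fun i => (p i).2)).
- by apply: cvg_trans pc3 => B; exact: FU.
- exact: lamc.
- by apply: filterE => i; have [] := hp i.
Qed.

Lemma subdifferential_of_bound : exists2 r : R, 0 < r & forall h v, `|h| <= r ->
  D (f (xb + h)) ->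
  (forall e : R, 0 < e -> exists2 r' : R, 0 < r' & forall k, `|k| <= r' ->
     D (f (xb + h + k)) ->
     th (f (xb + h)) + dotv v k - e * `|k| <= th (f (xb + h + k))) ->
  subdifferential phi (xb + h) v.
Proof.
have [rho [Lf [kap [rho0 _ _ good]]]] := good_ball setP.
have phiE h : `|h| <= rho -> phi (xb + h) = theta (f (xb + h)).
  by move=> /good[].
exists (rho / 2) => [|h v hr Dx hv]; first by rewrite divr_gt0.
apply: rsub_subdifferential => //; have hE := phiE h.
rewrite /rsub /edom /= hE; last by lra.
split=> // e e0; have [r' r'0 hr'] := hv e e0.
apply: (@near_of_ball _ _ (xb + h) _ (Num.min r' (rho / 2))).
  by rewrite lt_min r'0 divr_gt0.
move=> k; rewrite le_min => /andP[k1 k2].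
have -> : xb + h + k - (xb + h) = k by vring.
have -> : phi (xb + h + k) = theta (f (xb + h + k)).
  by rewrite -addrA; apply: phiE; apply: le_trans (ler_normD _ _) _; lra.
have [->|Dy] := eqVneq (theta (f (xb + h + k))) +oo%E; first by rewrite leey.
have Dy' : D (f (xb + h + k)) by rewrite /edom /= ltey.
by rewrite (fin_dom theta_gtNy Dy') lee_fin; exact: hr'.
Qed.

(** A multiplier turns the convex subgradient inequality for [theta] into one for the composition,
    and the linearization error of [f] is quadratic: [vb] is a proximal subgradient at [xb]. *)
Lemma quadratic_growth : exists C r : R, [/\ 0 < C, 0 < r & forall h, `|h| <= r ->
  D (f (xb + h)) ->
  th (f xb) + dotv vb h - C * `|h| ^+ 2 <= th (f (xb + h))].
Proof.
have [r2 [M [r20 M0 hm]]] := multiplier_exists.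
have [|||lam [_]] := hm 0 vb.
- by rewrite normr0 ltW.
- by rewrite subrr normr0 invr_ge0.
- by rewrite addr0.
rewrite addr0 => hadj [_ hc].
have [C [r [C0 r0 hr]]] := C2_quadratic f_C2.
exists (m%:R * `|lam| * C + 1), r; split=> // [|h hh Dh].
  by rewrite ltr_wpDl// !mulr_ge0// ltW.
have := hc _ Dh; rewrite -hadj dotv_adj.
have := dotv_ge lam (f (xb + h) - f xb - nabla_app f xb h).
have : m%:R * `|lam| * `|f (xb + h) - f xb - nabla_app f xb h| <=
    (m%:R * `|lam| * C + 1) * `|h| ^+ 2.
  apply: le_trans (ler_wpM2l _ (hr _ hh)) _; first by rewrite mulr_ge0.
  by rewrite mulrA ler_wpM2r ?sqr_ge0// lerDl.
rewrite dotvBr; lra.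
Qed.

End Multipliers.

(** * Tangent vectors to the subgradient graph *)

Section Inclusion.
Context {R : realType} {n m : nat}.
Variables (phi : 'rV[R]_n -> \bar R) (theta : 'rV[R]_m -> \bar R).
Variables (f : 'rV[R]_n -> 'rV[R]_m) (xb vb : 'rV[R]_n) (s : nat).
Variables (L : 'I_s -> seq ('rV[R]_m * R)) (A : 'I_s -> 'M[R]_m).
Variables (a : 'I_s -> 'rV[R]_m) (alpha : 'I_s -> R).
Hypothesis setP : composite_setting phi theta f xb vb L A a alpha.
Let phi_gtNy := set_phi_gtNy setP.
Let theta_gtNy := set_theta_gtNy setP.
Let f_C2 := set_C2 setP.
Let fxb_dom := set_dom setP.
Let plqP := set_plq setP.

Local Notation D := (edom theta).
Local Notation th := (fun y => fine (theta y)).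
Local Notation cs := (csub D th).
Local Notation ray := (csub_ray D th).

Lemma phi_fin : phi xb = (th (f xb))%:E.
Proof.
by rewrite (nbhs_singleton (set_phi_comp setP)); exact: fin_dom.
Qed.

Lemma subderivative_le {T : Type} (F : set_system T) {FF : ProperFilter F}
    (t q : T -> R) (w : T -> 'rV[R]_n) (w0 : 'rV[R]_n) (c : R) :
  (\forall b \near F, 0 < t b) -> t @ F --> (0 : R) -> w @ F --> w0 -> q @ F --> c ->
  (\forall b \near F, (phi (xb + t b *: w b) <= (th (f xb) + t b * q b)%:E)%E) ->
  (subderivative phi xb w0 <= c%:E)%E.
Proof.
move=> t0 t0' wc qc h; rewrite /subderivative limf_einfE.
apply: ub_ereal_sup => _ [V FV <-]; apply/lee_addgt0Pr => e e0.
have tc : t @ F --> (0 : R)^'+.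
  move=> B; rewrite /at_right /within /= => hB.
  by apply: filterS2 t0 (t0' _ hB) => b b0; exact.
have VF : \forall b \near F, V (t b, w b).
  case: FV => -[B C] /= [hB hC] BC.
  have h1 : \forall b \near F, B (t b) := tc _ hB.
  have h2 : \forall b \near F, C (w b) := wc _ hC.
  by apply: filterS2 h1 h2 => b b1 b2; apply: BC.
have qe : \forall b \near F, q b <= c + e.
  move/cvgrPdist_le : qc => /(_ e e0); apply: filterS => b.
  by rewrite ler_norml => /andP[h1 _]; lra.
have [b [[b1 b2] [b3 b4]]] := filter_ex (filterI (filterI VF qe) (filterI t0 h)).
apply: ereal_inf_le; eexists; first by exists (t b, w b).
rewrite /= phi_fin.
have pfin : phi (xb + t b *: w b) = (fine (phi (xb + t b *: w b)))%:E.
  by apply: fin_dom => //; rewrite /edom /=; apply: le_lt_trans b4 _; rewrite ltry.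
rewrite pfin lee_fin in b4; rewrite pfin -EFinD -EFinM lee_fin.
by rewrite ler_pdivrMr//; move: b2; nra.
Qed.

(** Immediate from [quadratic_growth], whose error is o(t). Membership in the critical cone is
    therefore only an upper bound on the subderivative. *)
Lemma subderivative_ge (w0 : 'rV[R]_n) : ((dotv vb w0)%:E <= subderivative phi xb w0)%E.
Proof.
have [C [r [C0 r0 hr]]] := quadratic_growth setP.
have [r1 r10 h1] := near_norm_ball (set_phi_comp setP).
apply/lee_subgt0Pr => e e0; rewrite /subderivative limf_einfE.
pose B := `|w0| + 1.
have B0 : 0 < B by rewrite ltr_wpDl.
pose k := n%:R * `|vb| + 1.
have k0 : 0 < k by rewrite ltr_wpDl// mulr_ge0.
(* [d] limits the variation of the linear term and [tm] the quadratic error; each costs at most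
   [e / 2]. *)
pose d := Num.min 1 (e / (2 * k)).
have d0 : 0 < d by rewrite lt_min ltr01 divr_gt0// mulr_gt0.
pose tm := Num.min (Num.min r r1 / B) (e / (2 * (C * B ^+ 2))).
have CB0 : 0 < C * B ^+ 2 by rewrite mulr_gt0// exprn_gt0.
have tm0 : 0 < tm.
  by rewrite lt_min !divr_gt0 ?lt_min ?r0 ?mulr_gt0// exprn_gt0.
pose V := [set q : R * 'rV[R]_n | 0 < q.1 <= tm /\ `|w0 - q.2| <= d].
apply: (@le_trans _ _ (ereal_inf ((fun q : R * 'rV[R]_n =>
  ((phi (xb + q.1 *: q.2)%R - phi xb) * (q.1^-1)%:E)%E) @` V))); last first.
  apply: ereal_sup_ubound; exists V => //.
  exists ([set t | 0 < t <= tm], [set w | `|w0 - w| <= d]) => /=.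
    split; first exact: right_small.
    apply: (@near_of_ball _ _ w0 _ d) => // y hy /=.
    by rewrite opprD addrA subrr add0r normrN.
  by move=> [t w] [/= h2 h3].
apply: le_ereal_inf_tmp => _ [[t w] [/= /andP[t0 ttm] wd] <-].
have wB : `|w| <= B.
  rewrite -[w](subrK w0) /B addrC; apply: le_trans (ler_normD _ _) _.
  by rewrite lerD2l distrC (le_trans wd)// ge_min lexx.
have tw : `|t *: w| <= Num.min r r1.
  rewrite normrZ gtr0_norm//; apply: (@le_trans _ _ (t * B)).
    by rewrite ler_wpM2l// ltW.
  by rewrite -ler_pdivlMr// (le_trans ttm)// ge_min lexx.
move: tw; rewrite le_min => /andP[tw1 tw2].
rewrite (h1 _ tw2) phi_fin.
have [->|Dy] := eqVneq (theta (f (xb + t *: w))) +oo%E.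
  by rewrite addye// gt0_mulye ?lte_fin ?invr_gt0// leey.
have Dy' : D (f (xb + t *: w)) by rewrite /edom /= ltey.
rewrite (fin_dom theta_gtNy Dy') -EFinD -EFinM lee_fin ler_pdivlMr//.
have := hr _ tw1 Dy'; rewrite dotvZr normrZ (gtr0_norm t0) exprMn.
have i1 : C * (t ^+ 2 * `|w| ^+ 2) <= t * (e / 2).
  rewrite expr2 mulrCA -mulrA ler_wpM2l ?(ltW t0)// mulrCA.
  apply: (@le_trans _ _ (t * (C * B ^+ 2))).
    rewrite mulrCA ler_wpM2l ?(ltW t0)// ler_wpM2l ?(ltW C0)//.
    by rewrite ler_sqr ?nnegrE// ltW.
  rewrite -ler_pdivlMr// (le_trans ttm)// ge_min; apply/orP; right.
  by rewrite invfM mulrA.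
have i2 : dotv vb w0 - e / 2 <= dotv vb w.
  have := dotv_le vb (w0 - w); rewrite dotvBr.
  have : n%:R * `|vb| * `|w0 - w| <= k * d.
    by apply: ler_pM => //; rewrite ?mulr_ge0// /k lerDl.
  have : k * d <= e / 2.
    have : d <= e / (2 * k) by rewrite ge_min lexx orbT.
    rewrite ler_pdivlMr ?mulr_gt0// => ?; lra.
  lra.
have := ler_wpM2l (ltW t0) i2; lra.
Qed.

Lemma multipliersE lam : multipliers theta f xb vb lam <->
  nabla_adj f xb lam = vb /\ cs (f xb) lam.
Proof.
by split=> -[h1 h2]; split=> //; move: h2; rewrite (theta_subdifferential setP).
Qed.

(** The bound [M] is the same for all tangent vectors, which later allows parameters to be chosen
    before the tangent vector is known. The ray is based at the limit multiplier [lam]; it is moved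
    to a prescribed one only afterwards. *)
Lemma tangent_inclusion : exists2 M : R, 0 < M & forall w z,
  tangent (gph (subdifferential phi)) (row_mx xb vb) (row_mx w z) ->
  critical_cone phi xb vb w /\
  exists lam eta, [/\ `|lam| <= M, max_multipliers theta f xb vb w lam,
    ray (f xb) lam (nabla_app f xb w) eta &
    z = w *m hess_mx f xb lam + nabla_adj f xb eta].
Proof.
have [r2 [M [r20 M0 hm]]] := multiplier_exists setP.
have [r3 r30 hphi] := near_norm_ball (set_phi_comp setP).
have [r4 r40 hdf] := near_norm_ball (C2_near f_C2).
exists M => // w z [t_ [W_ [t0 tc Wc hW]]].
pose w_ i := lsubmx (W_ i); pose z_ i := rsubmx (W_ i).
have [wc zc] : w_ @ \oo --> w /\ z_ @ \oo --> z.
  apply/cvg_row_mx; rewrite (_ : (fun _ => _) = W_)//.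
  by apply/funext => i; rewrite hsubmxK.
have {}hW i : subdifferential phi (xb + t_ i *: w_ i) (vb + t_ i *: z_ i).
  have := hW i; rewrite /gph /= -[W_ i]hsubmxK scale_row_mx add_row_mx.
  by rewrite row_mxKl row_mxKr.
have H i : exists lam, `|t_ i *: w_ i| <= r2 -> `|t_ i *: z_ i| <= 2^-1 ->
    [/\ `|lam| <= M, nabla_adj f (xb + t_ i *: w_ i) lam = vb + t_ i *: z_ i &
        cs (f (xb + t_ i *: w_ i)) lam].
  have [h1|h1] := pselect (`|t_ i *: w_ i| <= r2); last by exists 0 => /h1.
  have [h2|h2] := pselect (`|t_ i *: z_ i| <= 2^-1); last by exists 0 => _ /h2.
  have [|lam hl] := hm _ (vb + t_ i *: z_ i) h1 _ (hW i); last by exists lam.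
  by rewrite addrC addKr.
have [lam_ hlam] := choice H.
have [U [UU FU]] := @ultraFilterLemma _ \oo _.
have tU : t_ @ U --> (0 : R) by apply: cvg_trans tc => B; exact: FU.
have wU : w_ @ U --> w by apply: cvg_trans wc => B; exact: FU.
have zU : z_ @ U --> z by apply: cvg_trans zc => B; exact: FU.
have tU0 : \forall i \near U, 0 < t_ i by apply: filterE.
have hU : \forall i \near U, [/\ `|lam_ i| <= M,
    nabla_adj f (xb + t_ i *: w_ i) (lam_ i) = vb + t_ i *: z_ i &
    cs (f (xb + t_ i *: w_ i)) (lam_ i)].
  have h2 : \forall i \near U, `|t_ i *: z_ i| <= 2^-1.
    by apply: (near_scaled tU zU); rewrite invr_gt0.
  by apply: filterS2 (near_scaled tU wU r20) h2 => i; exact: hlam.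
have [lam lamc lamM] : exists2 l, lam_ @ U --> l & `|l| <= M.
  by apply: ultra_bounded_cvg; apply: filterS hU => i [].
have xU : (fun i => xb + t_ i *: w_ i) @ U --> xb by apply: cvg_shifted tU wU.
have adjU : (fun i => nabla_adj f (xb + t_ i *: w_ i) (lam_ i)) @ U -->
    nabla_adj f xb lam.
  apply: (nbhs_singleton (C2_adj_continuous f_C2)) => //.
  by apply: filterS (near_scaled tU wU r40) => i; exact: hdf.
have vbU : (fun i => vb + t_ i *: z_ i) @ U --> vb by apply: cvg_shifted tU zU.
have adjE : nabla_adj f xb lam = vb.
  apply: (cvg_unique _ adjU); first exact: norm_hausdorff.
  apply: cvg_trans vbU; apply: near_eq_cvg.
  by apply: filterS hU => i [_ -> _].
pose u_ i := (t_ i)^-1 *: (f (xb + t_ i *: w_ i) - f xb).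
have uU : u_ @ U --> nabla_app f xb w by exact: (cvg_first_order f_C2 tU0 tU wU).
have sU : (fun i => (t_ i ^+ 2)^-1 *: (f (xb + t_ i *: w_ i) - f xb
    - t_ i *: nabla_app f xb (w_ i))) @ U --> 2^-1 *: nabla2 f xb w w.
  exact: (cvg_second_order f_C2 tU0 tU wU).
have aU : (fun i => (t_ i)^-1 *: (nabla_adj f (xb + t_ i *: w_ i) (lam_ i)
    - nabla_adj f xb (lam_ i))) @ U --> w *m hess_mx f xb lam.
  exact: (cvg_adj_first_order f_C2 tU0 tU wU lamc).
have tuE : \forall i \near U, f xb + t_ i *: u_ i = f (xb + t_ i *: w_ i).
  apply: filterS tU0 => i ti; rewrite /u_ scalerA mulfV ?gt_eqF// scale1r.
  by rewrite addrC subrK.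
(* The adjoint equations at the moving points and at [xb] determine this limit, although
   [(t_ i)^-1 *: (lam_ i - lam)] itself may diverge. *)
have xi : (fun i => (t_ i)^-1 *: ((lam_ i - lam) *m ('J f xb)^T)) @ U -->
    z - w *m hess_mx f xb lam.
  have zaU : (fun i => z_ i - (t_ i)^-1 *: (nabla_adj f (xb + t_ i *: w_ i) (lam_ i)
      - nabla_adj f xb (lam_ i))) @ U --> z - w *m hess_mx f xb lam by exact: cvgB.
  apply: cvg_trans zaU; apply: near_eq_cvg.
  apply: filterS2 hU tU0 => i [_ h _] ti /=; rewrite h.
  rewrite -/(nabla_adj f xb (lam_ i - lam)) nabla_adjB adjE.
  rewrite [vb + _]addrC -addrA scalerDr scalerA mulVf ?gt_eqF// scale1r.
  by rewrite opprD addrA subrr add0r -scalerN opprB.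
have [|ceta [eta heta etaE] mono] := csub_graph_limit plqP (U := U)
    (y := f xb) tU0 tU uU lamc xi.
  by apply: filterS2 hU tuE => i [_ _ h] ->.
have multl : multipliers theta f xb vb lam by apply/multipliersE.
split.
  apply/eqP; rewrite eq_le subderivative_ge andbT.
  have qc : (fun i => dotv (lam_ i) (u_ i)) @ U --> dotv lam (nabla_app f xb w).
    exact: cvg_dotv.
  rewrite -adjE dotv_adj.
  apply: (subderivative_le tU0 tU wU qc).
  have hr : \forall i \near U, phi (xb + t_ i *: w_ i) = theta (f (xb + t_ i *: w_ i)).
    by apply: filterS (near_scaled tU wU r30) => i; exact: hphi.
  apply: filterS3 hr hU tuE => i -> [_ _ [Dy hc]] tu.
  rewrite (fin_dom theta_gtNy Dy) lee_fin.
  have := hc _ fxb_dom; rewrite -tu opprD addrA subrr add0r dotvNr dotvZr; lra.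
exists lam, eta; split=> //; last first.
  by move: etaE; rewrite -/(nabla_adj f xb eta) => ->; rewrite addrC subrK.
split=> // mu /multipliersE[muE hmu].
rewrite -subr_ge0 -dotvBl.
(* Both [lam] and [mu] have adjoint image [vb], so the linear term of [f] disappears and [mono]
   gives the sign of the second-order term. *)
have lim : (fun i => dotv (lam - mu) ((t_ i ^+ 2)^-1 *:
     (f (xb + t_ i *: w_ i) - f xb - t_ i *: nabla_app f xb (w_ i)))) @ U -->
     dotv (lam - mu) (2^-1 *: nabla2 f xb w w).
  by apply: cvg_dotv; [exact: cvg_cst|exact: sU].
suff : 0 <= dotv (lam - mu) (2^-1 *: nabla2 f xb w w) by rewrite dotvZr pmulr_rge0.
apply: (cvg_le (f := cst 0) _ lim); first exact: cvg_cst.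
apply: filterS3 tU0 tuE (mono mu hmu) => i ti tu h.
rewrite dotvZr mulr_ge0 ?invr_ge0 ?sqr_ge0// -tu [f xb + _]addrC addrK dotvBr.
by rewrite dotvZr -dotv_adj nabla_adjB adjE muE subrr dot0v mulr0 subr0.
Qed.

End Inclusion.

(** * Independence of the choice of the multiplier *)

Section LinearChainRule.
Context {R : realType} {n m : nat}.
Variables (D : set 'rV[R]_m) (th : 'rV[R]_m -> R) (s : nat).
Variables (L : 'I_s -> seq ('rV[R]_m * R)) (A : 'I_s -> 'M[R]_m).
Variables (a : 'I_s -> 'rV[R]_m) (alpha : 'I_s -> R).
Hypothesis plqP : convex_plq D th L A a alpha.
Variables (M : 'M[R]_(n, m)) (yb : 'rV[R]_m).

Local Notation cs := (csub D th).
Local Notation ray := (csub_ray D th).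

Lemma dotv_trmx (mu : 'rV[R]_m) (w : 'rV[R]_n) :
  dotv (mu *m M^T) w = dotv mu (w *m M).
Proof. by rewrite dotv_mulmxl trmxK. Qed.

(** Monotonicity of [csub] at parameter [t]: the equal adjoint images of [lam] and [lam'] cancel,
    and what remains is [t ^+ 2] times the claim. *)
Lemma ray_monotone lam lam' (w w' : 'rV[R]_n) eta eta' :
  lam *m M^T = lam' *m M^T -> ray yb lam (w *m M) eta -> ray yb lam' (w' *m M) eta' ->
  0 <= dotv (eta *m M^T - eta' *m M^T) (w - w').
Proof.
move=> ll [e e0 he] [e' e'0 he'].
pose t := Num.min e e'.
have t0 : 0 < t by rewrite lt_min e0.
have := csub_monotone (he t _) (he' t _); rewrite t0 !ge_min !lexx orbT.
move=> /(_ isT isT).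
have -> : yb + t *: (w *m M) - (yb + t *: (w' *m M)) = t *: ((w - w') *m M).
  by rewrite mulmxBl scalerBr opprD addrACA subrr add0r.
rewrite dotvZr pmulr_rge0// -dotv_trmx.
rewrite (_ : _ *m M^T = t *: (eta *m M^T - eta' *m M^T)).
  by rewrite dotvZl pmulr_rge0.
rewrite mulmxBl !mulmxDl ll -!scalemxAl scalerBr opprD addrACA subrr add0r.
by [].
Qed.

Lemma sqr_le_bound (k : nat) (e : 'rV[R]_k) (x : R) :
  0 <= x -> x ^+ 2 <= dotv e e -> x <= k.+1%:R * `|e|.
Proof.
move=> x0 h; rewrite -ler_sqr ?nnegrE ?mulr_ge0//.
apply: le_trans h _; apply: le_trans (dotv_le _ _) _.
rewrite exprMn -[leLHS]mulrA [X in _ <= _ * X]expr2 ler_wpM2r ?mulr_ge0//.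
by rewrite expr2 -natrM ler_nat mulSn (leq_trans (leqnSn k))// leq_addr.
Qed.

(** The pair minimizes [th (yb + t *: y) - t * dotv lam y] plus [t ^+ 2] times a penalty for
    [y = w *m M] and a proximal term centred at [e]. Stationarity in [y] gives the subgradient,
    stationarity in [w] the adjoint equation; comparison with (0, 0) gives bounds independent of
    [t]. *)
Lemma penalized_minimizer lam (e : 'rV[R]_n) (rho t : R) :
  cs yb lam -> 1 <= rho -> 0 < t ->
  exists w y, [/\ dotv (w - e) (w - e) <= dotv e e,
    rho * dotv (w *m M - y) (w *m M - y) <= dotv e e,
    cs (yb + t *: y) (lam + t *: (rho *: (w *m M - y))) &
    (rho *: (w *m M - y)) *m M^T = e - w].
Proof.
move=> [Dyb hlam] rho1 t0.
have rho0 : 0 < rho by apply: lt_le_trans rho1.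
have t20 : 0 < t ^+ 2 by rewrite exprn_gt0.
have [c c0 hc] := norm_mulmx_le M.
pose E := n.+1%:R * `|e|.
have E0 : 0 <= E by rewrite mulr_ge0.
pose B := `|e| + E; pose B' := c * B + E.
have B0 : 0 <= B by rewrite addr_ge0.
have B'0 : 0 <= B' by rewrite addr_ge0// mulr_ge0// ltW.
pose Q (w : 'rV[R]_n) (y : 'rV[R]_m) := rho / 2 * dotv (w *m M - y) (w *m M - y)
  + 2^-1 * dotv (w - e) (w - e).
pose g (p : 'rV[R]_n * 'rV[R]_m) := yb + t *: p.2.
pose k (p : 'rV[R]_n * 'rV[R]_m) := - (t * dotv lam p.2) + t ^+ 2 * Q p.1 p.2.
(* The radii exceed the a priori bounds [B] and [B'] by 1, so the minimizer is interior and may be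
   perturbed in every direction. *)
pose C := [set p : 'rV[R]_n * 'rV[R]_m | `|p.1 - 0| <= B + 1 /\ `|p.2 - 0| <= B' + 1].
have C0 : C (0, 0) by rewrite /C /= !subrr !normr0; split; rewrite addr_ge0.
have [|||||[w y] [Cwy /= Dy minp]] := @min_exists _ _ _ _ _ _ _ _ _ plqP _ C g k (0, 0).
- exact: box_compact.
- move=> p _; rewrite /continuous_at /g; apply: cvgD; first exact: cvg_cst.
  by apply: cvgZ; [exact: cvg_cst|exact: cvg_snd].
- move=> [w1 y1] _; rewrite /continuous_at.
  have c1 : (fun p : 'rV[R]_n * 'rV[R]_m => p.1) @ (w1, y1) --> w1 by exact: cvg_fst.
  have c2 : (fun p : 'rV[R]_n * 'rV[R]_m => p.2) @ (w1, y1) --> y1 by exact: cvg_snd.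
  have c3 : (fun p : 'rV[R]_n * 'rV[R]_m => p.1 *m M - p.2) @ (w1, y1) --> w1 *m M - y1.
    by apply: cvgB => //; exact: cvg_mulmx.
  have c4 : (fun p : 'rV[R]_n * 'rV[R]_m => p.1 - e) @ (w1, y1) --> w1 - e.
    by apply: cvgB => //; exact: cvg_cst.
  apply: cvgD.
    apply: cvgN; apply: cvgM; first exact: cvg_cst.
    by apply: cvg_dotv; [exact: cvg_cst|exact: c2].
  apply: cvgM; first exact: cvg_cst.
  by apply: cvgD; apply: cvgM; [exact: cvg_cst|exact: cvg_dotv|exact: cvg_cst|exact: cvg_dotv].
- exact: C0.
- by rewrite /= /g /= scaler0 addr0.
have := minp _ C0; rewrite /g /= scaler0 addr0 => /(_ Dyb).
have := hlam _ Dy; rewrite /g /= addrAC subrr add0r dotvZr.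
rewrite /k /Q /= mul0mx subrr sub0r !dotv0 dotvNl dotvNr opprK.
move=> h1 h2.
have bound : rho * dotv (w *m M - y) (w *m M - y) + dotv (w - e) (w - e) <= dotv e e.
  rewrite -(ler_pM2l t20); move: h1 h2; clear; lra.
have b1 : dotv (w - e) (w - e) <= dotv e e.
  by have := mulr_ge0 (ltW rho0) (dotv_ge0 (w *m M - y)); lra.
have b2 : rho * dotv (w *m M - y) (w *m M - y) <= dotv e e.
  by have := dotv_ge0 (w - e); lra.
have we : `|w - e| <= E.
  by apply: sqr_le_bound => //; apply: le_trans (sqr_norm_le _) b1.
have wy : `|w *m M - y| <= E.
  apply: sqr_le_bound => //; apply: le_trans (sqr_norm_le _) (le_trans _ b2).
  by rewrite ler_peMl// dotv_ge0.
have wB : `|w| <= B.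
  by rewrite -[w](subrK e) /B addrC; apply: le_trans (ler_normD _ _) _; rewrite lerD2l.
have yB' : `|y| <= B'.
  have -> : y = w *m M - (w *m M - y) by rewrite subKr.
  apply: le_trans (ler_normB _ _) _; apply: lerD => //.
  by apply: le_trans (hc w) _; rewrite ler_wpM2l// ltW.
exists w, y; split=> //.
- apply: (csub_fermat plqP Dy) => y' Dy'.
  pose d := y' - (yb + t *: y).
  have d0 : 0 < `|t^-1 *: d| + 1 by rewrite ltr_wpDl.
  exists (rho / 2 * dotv d d), (Num.min 2^-1 (`|t^-1 *: d| + 1)^-1); split.
    by rewrite lt_min !invr_gt0 ltr0n.
  move=> c1 /andP[c10]; rewrite le_min => /andP[c11 c12].
  have c101 : 0 < c1 < 1 by rewrite c10 (le_lt_trans c11)// invf_lt1// ltr1n.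
  have [Dt _] := plq_convex plqP c101 Dy' Dy.
  have tE : c1 *: y' + (1 - c1) *: (yb + t *: y) = yb + t *: y + c1 *: d.
    by rewrite scalerBl scale1r /d scalerBr addrCA.
  rewrite tE in Dt.
  have gE : g (w, y + c1 *: (t^-1 *: d)) = yb + t *: y + c1 *: d.
    by rewrite /g /= scalerDr !scalerA mulrAC mulfV ?gt_eqF// mul1r addrA.
  have Ct : C (w, y + c1 *: (t^-1 *: d)).
    rewrite /C /= !subr0; split; first by apply: le_trans wB _; rewrite lerDl.
    apply: le_trans (ler_normD _ _) _; apply: lerD => //.
    rewrite normrZ gtr0_norm//; apply: (@le_trans _ _ (c1 * (`|t^-1 *: d| + 1))).
      by rewrite ler_wpM2l ?(ltW c10)// lerDl.
    by rewrite -ler_pdivlMr// mul1r.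
  have := minp _ Ct; rewrite gE => /(_ Dt); rewrite /k /Q /g /= -/d.
  pose u := c1 / t; have cE : c1 = t * u by rewrite /u mulrC divfK// gt_eqF.
  rewrite [c1 *: (t^-1 *: d)]scalerA -/u.
  have -> : w *m M - (y + u *: d) = (w *m M - y) - u *: d by rewrite opprD addrA.
  rewrite cE; move: (u) => u1.
  move: (w *m M - y) (dotv (w - e) (w - e)) (d) => q1 q2 d1.
  rewrite !(dotvDl, dotvDr, dotvNl, dotvNr) !(dotvZl, dotvZr) [dotv d1 q1]dotvC.
  clear; lra.
- apply: dotvP => v; rewrite dotv_trmx.
  have stat v1 : 0 <= rho * dotv (w *m M - y) (v1 *m M) + dotv (w - e) v1.
    have d0 : 0 < `|v1| + 1 by rewrite ltr_wpDl.
    apply: (@small_limit_ge0 _ _ (rho / 2 * dotv (v1 *m M) (v1 *m M) + 2^-1 * dotv v1 v1)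
      (`|v1| + 1)^-1); first by rewrite invr_gt0.
    move=> c1 /andP[c10 c11].
    have Ct : C (w + c1 *: v1, y).
      rewrite /C /= !subr0; split; last by apply: le_trans yB' _; rewrite lerDl.
      apply: le_trans (ler_normD _ _) _; apply: lerD => //.
      rewrite normrZ gtr0_norm//; apply: (@le_trans _ _ (c1 * (`|v1| + 1))).
        by rewrite ler_wpM2l ?(ltW c10)// lerDl.
      by rewrite -ler_pdivlMr// mul1r.
    have := minp _ Ct Dy; rewrite /k /Q /=.
    have -> : (w + c1 *: v1) *m M - y = (w *m M - y) + c1 *: (v1 *m M).
      by rewrite mulmxDl -scalemxAl addrAC.
    have -> : w + c1 *: v1 - e = (w - e) + c1 *: v1 by rewrite addrAC.
    move: (w *m M - y) (w - e) (v1 *m M) => q1 q2 q3 H.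
    rewrite -(pmulr_rge0 _ c10) -(pmulr_rge0 _ t20); move: H.
    rewrite !(dotvDl, dotvDr) !(dotvZl, dotvZr) [dotv q3 q1]dotvC [dotv v1 q2]dotvC.
    clear; lra.
  apply/eqP; rewrite -subr_eq0 dotvZl.
  have := stat v; have := stat (- v); rewrite mulNmx !dotvNr !dotvBl.
  by move=> h3 h4; rewrite eq_le; apply/andP; split; lra.
Qed.

(* The minimizers of a penalized model at [lam'], with penalty parameter tending to
   infinity, give some [w1] and a ray at [lam'] in direction [w1 *m M] whose
   adjoint image is [e - w1]; comparing with [eta] by monotonicity, [w1 = w]. *)
Lemma ray_exchange lam lam' (w : 'rV[R]_n) eta :
  cs yb lam -> cs yb lam' -> lam *m M^T = lam' *m M^T -> ray yb lam (w *m M) eta ->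
  exists2 eta', ray yb lam' (w *m M) eta' & eta' *m M^T = eta *m M^T.
Proof.
move=> hlam hlam' ll reta.
(* With this centre, [w] solves the resolvent equation: the adjoint image of [eta] is [e - w]. *)
pose e := eta *m M^T + w.
pose E := n.+1%:R * `|e|.
(* With [rho] fixed, [t] tends to 0: the bounds are uniform in [t] and the graph points turn into
   rays. The limit in [rho] is taken afterwards. *)
have step (rho : R) : 1 <= rho -> exists w1 y1,
    [/\ `|w1| <= `|e| + E, rho * `|w1 *m M - y1| ^+ 2 <= dotv e e,
      ray yb lam' y1 (rho *: (w1 *m M - y1)) &
      (rho *: (w1 *m M - y1)) *m M^T = e - w1].
  move=> rho1; have rho0 : 0 < rho by apply: lt_le_trans rho1.
  have H (t : R) : exists p : 'rV[R]_n * 'rV[R]_m, 0 < t ->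
      [/\ dotv (p.1 - e) (p.1 - e) <= dotv e e,
      rho * dotv (p.1 *m M - p.2) (p.1 *m M - p.2) <= dotv e e,
      cs (yb + t *: p.2) (lam' + t *: (rho *: (p.1 *m M - p.2))) &
      (rho *: (p.1 *m M - p.2)) *m M^T = e - p.1].
    have [t0|t0] := ltP 0 t; last by exists (0, 0).
    have [w1 [y1 h]] := penalized_minimizer e hlam' rho1 t0.
    by exists (w1, y1).
  have [p hp] := choice H.
  have [U [UU FU]] := @ultraFilterLemma _ (0 : R)^'+ _.
  have t0U : \forall t \near U, 0 < t.
    by apply: FU; apply: filterS (right_small (ltr01 : 0 < 1 :> R)) => t /andP[].
  have tU : (fun t : R => t) @ U --> (0 : R).
    by apply: cvg_trans (@cvg_right0 R) => B; exact: FU.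
  have wb : \forall t \near U, `|(p t).1| <= `|e| + E.
    apply: filterS t0U => t /hp[h1 _ _ _].
    rewrite -[(p t).1](subrK e) addrC; apply: le_trans (ler_normD _ _) _.
    by rewrite lerD2l; apply: sqr_le_bound => //; apply: le_trans (sqr_norm_le _) h1.
  have yb' : \forall t \near U, `|(p t).1 *m M - (p t).2| <= E.
    apply: filterS t0U => t /hp[_ h2 _ _]; apply: sqr_le_bound => //.
    apply: le_trans (sqr_norm_le _) (le_trans _ h2).
    by rewrite ler_peMl// dotv_ge0.
  have [w1 w1c w1b] := ultra_bounded_cvg wb.
  have [q qc qb] := ultra_bounded_cvg yb'.
  have yc : (fun t => (p t).2) @ U --> w1 *m M - q.
    rewrite (_ : (fun t => (p t).2) =
      (fun t => (p t).1 *m M - ((p t).1 *m M - (p t).2))); last first.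
      by apply/funext => t; rewrite subKr.
    by apply: cvgB => //; exact: cvg_mulmx.
  exists w1, (w1 *m M - q); rewrite subKr; split=> //.
  - apply: (@cvg_le _ _ U _ (fun t => rho * `|(p t).1 *m M - (p t).2| ^+ 2)
      (cst (dotv e e))); last 1 first.
    + apply: filterS t0U => t /hp[_ h2 _ _]; apply: le_trans h2.
      by rewrite ler_wpM2l ?(ltW rho0)// sqr_norm_le.
    + apply: cvgM; first exact: cvg_cst.
      by rewrite expr2; under eq_fun do rewrite expr2; apply: cvgM; exact: cvg_norm.
    + exact: cvg_cst.
  - apply: (csub_ray_limit plqP (F := U) (t := id) (u := fun t => (p t).2)
      (eta := fun t => rho *: ((p t).1 *m M - (p t).2))) => //.
      by apply: cvgZ; [exact: cvg_cst|exact: qc].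
    by apply: filterS t0U => t /hp[].
  - have c1 : (fun t => (rho *: ((p t).1 *m M - (p t).2)) *m M^T) @ U -->
        (rho *: q) *m M^T.
      by apply: cvg_mulmx; apply: cvgZ; [exact: cvg_cst|exact: qc].
    have c2 : (fun t => e - (p t).1) @ U --> e - w1.
      by apply: cvgB => //; exact: cvg_cst.
    apply: (cvg_unique _ c1); first exact: norm_hausdorff.
    apply: cvg_trans c2; apply: near_eq_cvg; apply: filterS t0U => t /hp[_ _ _ ->].
    by [].
have H (i : nat) : exists p : 'rV[R]_n * 'rV[R]_m,
    [/\ `|p.1| <= `|e| + E, i.+1%:R * `|p.1 *m M - p.2| ^+ 2 <= dotv e e,
      ray yb lam' p.2 (i.+1%:R *: (p.1 *m M - p.2)) &
      (i.+1%:R *: (p.1 *m M - p.2)) *m M^T = e - p.1].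
  have [|w1 [y1 h]] := step i.+1%:R; first by rewrite ler1n.
  by exists (w1, y1).
have [p hp] := choice H.
have [U [UU FU]] := @ultraFilterLemma _ \oo _.
have [w1 w1c w1b] : exists2 l, (fun i => (p i).1) @ U --> l & `|l| <= `|e| + E.
  by apply: ultra_bounded_cvg; apply: filterE => i; have [] := hp i.
have dc : (fun i => (p i).1 *m M - (p i).2) @ U --> (0 : 'rV[R]_m).
  suff : (fun i => (p i).1 *m M - (p i).2) @ \oo --> (0 : 'rV[R]_m).
    by apply: cvg_trans => B; exact: FU.
  apply/cvgrPdist_le => e1 e10.
  have e20 : 0 < e1 ^+ 2 / (dotv e e + 1).
    by rewrite divr_gt0 ?exprn_gt0// ltr_wpDl// dotv_ge0.
  have /cvgrPdist_le/(_ _ e20) := @cvg_harmonic R.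
  apply: filterS => i; rewrite !sub0r !normrN ger0_norm ?invr_ge0//= => hi.
  have [_ h2 _ _] := hp i.
  rewrite -ler_sqr ?nnegrE ?(ltW e10)//.
  have i0 : 0 < i.+1%:R :> R by [].
  rewrite -(ler_pM2l i0); apply: le_trans h2 _.
  move: hi; rewrite ler_pdivlMr ?ltr_wpDl ?dotv_ge0// => hi.
  have := ler_wpM2l (ltW i0) hi; rewrite mulrA mulfV ?gt_eqF// mul1r.
  by apply: le_trans; rewrite lerDl.
have yc : (fun i => (p i).2) @ U --> w1 *m M.
  rewrite (_ : (fun t => (p t).2) =
    (fun t => (p t).1 *m M - ((p t).1 *m M - (p t).2))); last first.
    by apply/funext => t; rewrite subKr.
  by rewrite -[X in _ --> X]subr0; apply: cvgB => //; exact: cvg_mulmx.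
have xc : (fun i => e - (p i).1) @ U --> e - w1.
  by apply: cvgB => //; exact: cvg_cst.
have [|eta' reta' etaE'] := csub_ray_image_closed plqP (F := U) (M := M^T)
    (y := yb) (lam := lam') yc xc.
  apply: filterE => i; have [_ _ h3 h4] := hp i.
  by exists (i.+1%:R *: ((p i).1 *m M - (p i).2)).
(* The inequality obtained is [0 <= - dotv (w - w1) (w - w1)], which identifies the direction. *)
have := ray_monotone ll reta reta'; rewrite etaE'.
have -> : eta *m M^T - (e - w1) = - (w - w1) by rewrite /e !opprD opprK addrA addrA subrr add0r.
rewrite dotvNl oppr_ge0 => /dotv_eq0/subr0_eq ww1.
by rewrite -ww1 in reta' etaE'; exists eta' => //; rewrite etaE' /e addrK.
Qed.

End LinearChainRule.

(** * Curves in the subgradient graph *)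

Section ProxPoints.
Context {R : realType} {n m : nat}.
Variables (phi : 'rV[R]_n -> \bar R) (theta : 'rV[R]_m -> \bar R).
Variables (f : 'rV[R]_n -> 'rV[R]_m) (xb vb : 'rV[R]_n) (s : nat).
Variables (L : 'I_s -> seq ('rV[R]_m * R)) (A : 'I_s -> 'M[R]_m).
Variables (a : 'I_s -> 'rV[R]_m) (alpha : 'I_s -> R).
Hypothesis setP : composite_setting phi theta f xb vb L A a alpha.
Let f_C2 := set_C2 setP.
Let fxb_dom := set_dom setP.
Let plqP := set_plq setP.

Local Notation D := (edom theta).
Local Notation th := (fun y => fine (theta y)).

(** Quadratic growth makes the proximal term dominate for small [r], so minimizers over a fixed ball
    have norm O(t), are interior, and satisfy the optimality condition. The minimality itself is
    also exported, for comparison with the feasible arcs of [critical_arc]. *)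
Lemma prox_points : exists r0 dl : R, [/\ 0 < r0, 0 < dl &
  forall (r : R) (e : 'rV[R]_n), 0 < r <= r0 -> exists t0 K : R, [/\ 0 < t0, 0 < K &
  forall t, 0 < t <= t0 -> exists d, [/\ `|d| <= K * t, D (f (xb + d)),
    subdifferential phi (xb + d) (vb + r^-1 *: (t *: e - d)) &
    forall d', `|d'| <= dl -> D (f (xb + d')) ->
      th (f (xb + d)) - dotv vb d + (2 * r)^-1 * dotv (d - t *: e) (d - t *: e)
      <= th (f (xb + d')) - dotv vb d' + (2 * r)^-1 * dotv (d' - t *: e) (d' - t *: e)]]].
Proof.
have [C [r1 [C0 r10 growth]]] := quadratic_growth setP.
have [r2 r20 hsub] := subdifferential_of_bound setP.
have [r3 r30 hdf] := near_norm_ball (C2_near f_C2).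
pose dl := Num.min (Num.min r1 r2) r3.
have dl0 : 0 < dl by rewrite !lt_min r10 r20.
(* For [r] below this bound, [2 * C <= (2 * r)^-1], so at most half of the proximal term is spent on
   the growth error. *)
have r00 : 0 < (4 * C)^-1 by rewrite invr_gt0 mulr_gt0.
exists (4 * C)^-1, dl; split=> // r e /andP[r_gt0 rr0].
have Cr : 2 * C <= (2 * r)^-1.
  rewrite -[leRHS]div1r ler_pdivlMr ?mulr_gt0//.
  have := ler_wpM2l (ltW (mulr_gt0 (ltr0n R 4) C0)) rr0.
  rewrite mulfV ?gt_eqF// ?mulr_gt0//; lra.
move: (Cr); set q := (2 * r)^-1 => Crq.
have q0 : 0 < q by apply: lt_le_trans Crq; rewrite mulr_gt0.
(* Comparison with d = 0 gives [|d| ^+ 2 <= 4 * n%:R * |e| * t * |d|]; the 1 only ensures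
   positivity. *)
pose K := 4 * n%:R * `|e| + 1.
have K0 : 0 < K by rewrite ltr_wpDl// !mulr_ge0.
exists (dl / (2 * K)), K; split=> // [|t /andP[t0 tt0]].
  by rewrite divr_gt0 ?mulr_gt0.
have Kt : K * t <= dl / 2.
  by move: tt0; rewrite ler_pdivlMr ?mulr_gt0// => h; rewrite ler_pdivlMr//; lra.
have shiftc (F : set_system 'rV[R]_n) (FF : Filter F) (c h : 'rV[R]_n) :
    F --> h -> (fun x => x + c) @ F --> h + c.
  by move=> Fh; apply: cvgD; [exact: Fh|exact: cvg_cst].
have gc (F : set_system 'rV[R]_n) (FF : Filter F) (h : 'rV[R]_n) : `|h| <= dl -> F --> h ->
    (fun h => f (xb + h)) @ F --> f (xb + h).
  rewrite le_min => /andP[_ hh] Fh.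
  have c2 : (fun h => xb + h) @ F --> xb + h.
    by rewrite addrC; under eq_fun do rewrite addrC; exact: shiftc.
  by apply: (cvg_comp (fun h => xb + h) f c2); exact: differentiable_continuous (hdf _ hh).
have kc (F : set_system 'rV[R]_n) (FF : Filter F) (h : 'rV[R]_n) : F --> h ->
    (fun h => - dotv vb h + q * dotv (h - t *: e) (h - t *: e))
    @ F --> - dotv vb h + q * dotv (h - t *: e) (h - t *: e).
  move=> Fh; have c1 := shiftc F FF (- (t *: e)) h Fh.
  apply: cvgD.
    by apply: cvgN; apply: cvg_dotv; [exact: cvg_cst|exact: Fh].
  by apply: cvgM; [exact: cvg_cst|exact: cvg_dotv].
have [d [/= dB Dd mind]] : exists d : 'rV[R]_n, [/\ `|d| <= dl, D (f (xb + d)) &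
    forall d', `|d'| <= dl -> D (f (xb + d')) ->
    th (f (xb + d)) + (- dotv vb d + q * dotv (d - t *: e) (d - t *: e)) <=
    th (f (xb + d')) + (- dotv vb d' + q * dotv (d' - t *: e) (d' - t *: e))].
  apply: (@min_exists _ _ _ _ _ _ _ _ _ plqP _ [set h : 'rV[R]_n | `|h| <= dl]
    (fun h => f (xb + h)) (fun h => - dotv vb h + q * dotv (h - t *: e) (h - t *: e)) 0).
  - exact: norm_ball_compact.
  - by move=> h hh; apply: (gc (nbhs h)) => //; exact: cvg_id.
  - by move=> h _; apply: (kc (nbhs h)); exact: cvg_id.
  - by rewrite /= normr0 ltW.
  - by rewrite addr0.
have dK : `|d| <= K * t.
  have := mind 0; rewrite /= normr0 addr0 (ltW dl0) => /(_ isT fxb_dom).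
  have dr1 : `|d| <= r1 by move: dB; rewrite !le_min => /andP[/andP[]].
  have := growth _ dr1 Dd.
  rewrite !(dotv0, sub0r, dotvNl, dotvNr, dotvBl, dotvBr) !(dotvZl, dotvZr).
  rewrite [dotv e d]dotvC !dot0v !mulr0 !oppr0.
  have := sqr_norm_le d; have := dotv_le d e.
  have := ler_wpM2r (sqr_ge0 `|d|) Crq.
  move: (`|d|) (dotv d e) (dotv d d) (dotv e e) (th _) (th _) (dotv vb d) => N Q P S Y1 Y2 Y3.
  move=> hC hQ hP hg hm.
  have h1 : q * (P - 2 * t * Q) <= q * (N ^+ 2 / 2) by lra.
  rewrite ler_pM2l// in h1.
  have h2 : N * N <= (4 * n%:R * `|e| * t) * N.
    have := ler_wpM2l (ltW t0) hQ; rewrite -expr2; lra.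
  have [N0|N0] := leP N 0; first by apply: le_trans N0 _; rewrite mulr_ge0// ltW.
  rewrite ler_pM2r// in h2; apply: le_trans h2 _.
  by rewrite ler_wpM2r ?(ltW t0)// lerDl.
have dl2 : `|d| <= dl / 2 by apply: le_trans dK Kt.
exists d; split=> //; last first.
  by move=> d' hd' Dd'; have := mind _ hd' Dd'; rewrite !addrA.
apply: hsub => //; first by move: dB; rewrite !le_min => /andP[/andP[]].
move=> eps eps0.
have b0 : 0 < q * n%:R + 1 by rewrite ltr_wpDl// mulr_ge0// ltW.
exists (Num.min (dl / 2) (eps / (q * n%:R + 1))).
  by rewrite lt_min !divr_gt0.
move=> k; rewrite le_min => /andP[kd ke] Dk.
have := mind (d + k); rewrite /= addrA => /(_ _ Dk) H.
have {H} := H _; have -> : `|d + k| <= dl.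
  by apply: le_trans (ler_normD _ _) _; move: dl2 kd; lra.
move=> /(_ isT).
have : q * dotv k k <= eps * `|k|.
  apply: (@le_trans _ _ ((q * n%:R + 1) * `|k| * `|k|)).
    have := dotv_le k k; move/(ler_wpM2l (ltW q0)) => h; apply: le_trans h _.
    rewrite !mulrA ler_wpM2r// ler_wpM2r// lerDl//.
  rewrite ler_wpM2r//; move: ke; rewrite ler_pdivlMr// => h; lra.
have -> : d + k - t *: e = (d - t *: e) + k by rewrite addrAC.
have qE : r^-1 = 2 * q by rewrite /q invfM mulrA mulfV ?mul1r// pnatr_eq0.
rewrite qE -[t *: e - d]opprB; move: (d - t *: e) => p.
rewrite !(dotvDl, dotvDr) !(dotvZl, dotvZr, dotvNl, dotvNr) [dotv k p]dotvC.
lra.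
Qed.

End ProxPoints.

(** * Differentiable curves with a prescribed derivative *)

Section ProtoCurve.
Context {R : realType} {n m : nat}.
Variables (phi : 'rV[R]_n -> \bar R) (theta : 'rV[R]_m -> \bar R).
Variables (f : 'rV[R]_n -> 'rV[R]_m) (xb vb : 'rV[R]_n) (s : nat).
Variables (L : 'I_s -> seq ('rV[R]_m * R)) (A : 'I_s -> 'M[R]_m).
Variables (a : 'I_s -> 'rV[R]_m) (alpha : 'I_s -> R).
Hypothesis setP : composite_setting phi theta f xb vb L A a alpha.
Let f_C2 := set_C2 setP.
Let vb_sub := set_sub setP.

Local Notation D := (edom theta).
Local Notation th := (fun y => fine (theta y)).
Local Notation ray := (csub_ray D th).

(** [lam] and [lamb] are independent: the Hessian term uses an optimal multiplier and the ray may
    start at any multiplier. Monotonicity only needs their adjoint images to agree. *)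
Lemma proto_curve lam lamb w eta :
  max_multipliers theta f xb vb w lam -> multipliers theta f xb vb lamb ->
  ray (f xb) lamb (nabla_app f xb w) eta ->
  exists (e : R) (xi : R -> 'rV[R]_(n + n)), [/\ 0 < e,
    forall t, 0 <= t <= e -> gph (subdifferential phi) (xi t), xi 0 = row_mx xb vb &
    t^-1 *: (xi t - xi 0) @[t --> 0^'+] -->
      row_mx w (w *m hess_mx f xb lam + nabla_adj f xb eta)].
Proof.
move=> [lamL lammax] lambL reta.
set z := w *m _ + _.
have [M M0 incl] := tangent_inclusion setP.
have [C C0 hC] := nabla2_bound f xb.
have [r0 [dl [r00 dl0 prox]]] := prox_points setP.
(* Bounds the Hessian forms of [lam] together with those of any [lam'] of norm at most [M]. Then
   [r^-1 >= B + 1] is incompatible with a nonzero [de]. *)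
pose B := m%:R * (`|lam| + M) * C.
have B0 : 0 <= B by rewrite !mulr_ge0 ?addr_ge0// ltW.
pose r := Num.min r0 (B + 1)^-1.
have r_gt0 : 0 < r by rewrite lt_min r00 invr_gt0 ltr_wpDl.
have rB : B + 1 <= r^-1.
  by rewrite -[leLHS]invrK lef_pV2 ?posrE ?invr_gt0 ?ltr_wpDl// ge_min lexx orbT.
pose e : 'rV[R]_n := w + r *: z.
have [|t0 [K [t00 K0 hprox]]] := prox r e; first by rewrite r_gt0 ge_min lexx.
have H (t : R) : exists d : 'rV[R]_n, 0 < t <= t0 -> `|d| <= K * t /\
    subdifferential phi (xb + d) (vb + r^-1 *: (t *: e - d)).
  have [/hprox[d [h1 _ h2 _]]|] := boolP (0 < t <= t0); first by exists d.
  by exists 0.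
have {H} [d hd] := choice H.
pose q (t : R) : 'rV[R]_n := t^-1 *: d t.
have small := right_small t00.
have gphE (t : R) : 0 < t -> row_mx (xb + d t) (vb + r^-1 *: (t *: e - d t)) =
    row_mx xb vb + t *: row_mx (q t) (r^-1 *: (e - q t)).
  move=> t_gt0; rewrite scale_row_mx add_row_mx.
  have tq : t *: q t = d t by rewrite /q scalerA mulfV ?gt_eqF// scale1r.
  rewrite -{1 2}tq; congr row_mx; clear; vring.
have qc : q @ 0^'+ --> w.
  apply: cvg_ultra => U UU FU.
  have [w' qw' _] : exists2 l, q @ U --> l & `|l| <= K.
    apply: ultra_bounded_cvg; apply: filterS (FU _ small) => t tt.
    have /andP[t_gt0 _] := tt; have [h _] := hd t tt.
    by rewrite normrZ gtr0_norm ?invr_gt0// mulrC ler_pdivrMr.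
  suff <- : w' = w by [].
  have [|_ [lam' [eta' [lam'M [lam'L lam'max] reta' zE]]]] := incl w' (r^-1 *: (e - w')).
    apply: (@tangent_filter _ _ _ _ _ U _ id (fun t => row_mx (q t) (r^-1 *: (e - q t)))).
    - by apply: filterS (FU _ small) => t /andP[].
    - by apply: cvg_trans (@cvg_right0 R) => V; exact: FU.
    - apply/cvg_row_mx; split=> //; apply: cvgZ; first exact: cvg_cst.
      by apply: cvgB => //; exact: cvg_cst.
    - apply: filterS (FU _ small) => t tt; have /andP[t_gt0 _] := tt.
      by rewrite -gphE// /gph /= row_mxKl row_mxKr; have [] := hd t tt.
  have [lamE _] := lambL; have [lam'E _] := lam'L.
  have mono : 0 <= dotv (nabla_adj f xb eta - nabla_adj f xb eta') (w - w').
    by apply: (ray_monotone _ reta reta'); rewrite -![_ *m _]/(nabla_adj _ _ _) lamE lam'E.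
  have m1 := lammax _ lam'L; have m2 := lam'max _ lamL.
  pose de : 'rV[R]_n := w - w'.
  have etaE : nabla_adj f xb eta - nabla_adj f xb eta' =
      w' *m hess_mx f xb lam' - w *m hess_mx f xb lam - r^-1 *: de.
    have -> : nabla_adj f xb eta = z - w *m hess_mx f xb lam by rewrite addrAC subrr add0r.
    have -> : nabla_adj f xb eta' = z + r^-1 *: de - w' *m hess_mx f xb lam'.
      have -> : z + r^-1 *: de = r^-1 *: (e - w').
        have -> : e - w' = de + r *: z by rewrite /e /de addrAC.
        by apply/rowP => i; rewrite !mxE; field; rewrite gt_eqF.
      by rewrite zE addrAC subrr add0r.
    by rewrite /z; vring.
  have bnd (l : 'rV[R]_m) : - (m%:R * `|l| * C * dotv de de) <= dotv l (nabla2 f xb de de).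
    apply: le_trans (dotv_ge _ _); rewrite lerN2 -!mulrA ler_wpM2l// ler_wpM2l//.
    by apply: le_trans (hC _) _; rewrite ler_wpM2l ?(ltW C0)// sqr_norm_le.
  have := bnd lam; have := bnd lam'; move: mono.
  rewrite etaE dotvBl dotvBl dotvZl !dotv_hess_mx -/de.
  have wE : w = w' + de by rewrite /de addrC subrK.
  clearbody de.
  have Dg := dotv_ge0 de.
  have e1 : nabla2 f xb w w = nabla2 f xb w' w' + nabla2 f xb w' de + nabla2 f xb w' de
      + nabla2 f xb de de.
    rewrite wE !(nabla2Dl, nabla2Dr) [nabla2 f xb de w'](nabla2_sym f_C2) -!addrA.
    by congr (_ + _).
  have e2 : nabla2 f xb w de = nabla2 f xb w' de + nabla2 f xb de de.
    by rewrite {1}wE nabla2Dl.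
  rewrite e1 !dotvDr in m1; rewrite e2 dotvDr => mono b' b.
  (* Optimality of [lam] at [w] and of [lam'] at [w'], expanded around [w'], bounds the mixed term
     in [lam' - lam] by terms quadratic in [de]; inserted into [mono], only such terms remain. *)
  have h : r^-1 * dotv de de <= B * dotv de de.
    apply: (@le_trans _ _ (m%:R * (`|lam| + `|lam'|) * C * dotv de de)).
      have : 0 <= m%:R * (`|lam| + `|lam'|) * C * dotv de de.
        by rewrite !mulr_ge0 ?addr_ge0// ltW.
      move: m1 m2 mono b b'; rewrite !mulrDr !mulrDl; lra.
    by rewrite ler_wpM2r// ler_wpM2r ?(ltW C0)// ler_wpM2l// lerD2l.
  suff de0 : de = 0 by rewrite wE de0 addr0.
  by apply: dotv_eq0; have := ler_wpM2r Dg rB; rewrite mulrDl mul1r; lra.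
(* [d] is unspecified outside the interval ]0, t0], hence the separate value at 0. *)
pose xi t := if 0 < t then row_mx (xb + d t) (vb + r^-1 *: (t *: e - d t)) else row_mx xb vb.
have xi0 : xi 0 = row_mx xb vb by rewrite /xi ltxx.
exists t0, xi; split=> //.
  move=> t /andP[t_ge0 tt0]; rewrite /xi; case: ifP => t_gt0.
    rewrite /gph /= row_mxKl row_mxKr.
    by have [|_] := hd t; first by rewrite t_gt0.
  by rewrite /gph /= row_mxKl row_mxKr.
have zE : z = r^-1 *: (e - w).
  by rewrite /e addrAC subrr add0r scalerA mulVf ?gt_eqF// scale1r.
have c1 : (fun t => row_mx (q t) (r^-1 *: (e - q t))) @ 0^'+ --> row_mx w z.
  apply/cvg_row_mx; split=> //; rewrite zE; apply: cvgZ; first exact: cvg_cst.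
  by apply: cvgB => //; exact: cvg_cst.
apply: cvg_trans c1; apply: near_eq_cvg; apply: filterS small => t /andP[t_gt0 _].
rewrite xi0 /xi t_gt0 gphE// [row_mx xb vb + _]addrC addrK scalerA mulVf ?gt_eqF//.
by rewrite scale1r.
Qed.

End ProtoCurve.

(** * Critical directions *)

Section CriticalDirections.
Context {R : realType} {n m : nat}.
Variables (phi : 'rV[R]_n -> \bar R) (theta : 'rV[R]_m -> \bar R).
Variables (f : 'rV[R]_n -> 'rV[R]_m) (xb vb : 'rV[R]_n) (s : nat).
Variables (L : 'I_s -> seq ('rV[R]_m * R)) (A : 'I_s -> 'M[R]_m).
Variables (a : 'I_s -> 'rV[R]_m) (alpha : 'I_s -> R).
Hypothesis setP : composite_setting phi theta f xb vb L A a alpha.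
Let phi_gtNy := set_phi_gtNy setP.
Let theta_gtNy := set_theta_gtNy setP.
Let f_C2 := set_C2 setP.
Let plqP := set_plq setP.

Local Notation D := (edom theta).
Local Notation th := (fun y => fine (theta y)).

Lemma critical_point w (e : R) : critical_cone phi xb vb w -> 0 < e ->
  exists t w', [/\ 0 < t <= e, `|w' - w| <= e &
    (phi (xb + t *: w') <= (th (f xb) + t * (dotv vb w + e))%:E)%E].
Proof.
move=> wK e0; pose V := [set q : R * 'rV[R]_n | 0 < q.1 <= e /\ `|q.2 - w| <= e].
have FV : filter_prod (0^'+) (nbhs w) V.
  exists ([set t | 0 < t <= e], [set w' | `|w' - w| <= e]) => [|[t w'] []//]; split => /=.
    exact: right_small.
  by apply: (@near_of_ball _ _ w _ e) => // k ke /=; rewrite addrAC subrr add0r.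
have : (ereal_inf [set (phi (xb + q.1 *: q.2)%R - phi xb) * (q.1^-1)%:E | q in V]
    < (dotv vb w + e)%:E)%E.
  apply: (@le_lt_trans _ _ (dotv vb w)%:E); last by rewrite lte_fin ltrDl.
  by rewrite -wK /subderivative limf_einfE; apply: ereal_sup_ubound; exists V.
move=> /ereal_inf_lt[_ [[t w'] /= [/andP[t0 te] ww] <-]].
exists t, w'; split=> //; first by rewrite t0.
have [py|pf] := eqVneq (phi (xb + t *: w')) +oo%E.
  by move: q; rewrite py (phi_fin setP) addye// gt0_mulye// lte_fin invr_gt0.
have pE : phi (xb + t *: w') = (fine (phi (xb + t *: w')))%:E.
  by apply: fin_dom => //; rewrite /edom /= ltey.
move: q; rewrite pE (phi_fin setP) -EFinD -EFinM lte_fin lee_fin.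
by rewrite ltr_pdivrMr// => /ltW; lra.
Qed.

(** Points nearly attaining the subderivative lie in one piece along an ultrafilter. In the limit
    [nabla_app f xb w] is tangent to that piece, and the slope of its quadratic is at most
    [dotv vb w]. *)
Lemma critical_piece w : critical_cone phi xb vb w ->
  exists i, [/\ psat (L i) (f xb), psat (actp (L i) (f xb)) (nabla_app f xb w) &
    dotv (gquad A a i (f xb)) (nabla_app f xb w) <= dotv vb w].
Proof.
move=> wK.
have H (k : nat) : exists p : R * 'rV[R]_n, [/\ 0 < p.1 <= k.+1%:R^-1,
    `|p.2 - w| <= k.+1%:R^-1 &
    (phi (xb + p.1 *: p.2) <= (th (f xb) + p.1 * (dotv vb w + k.+1%:R^-1))%:E)%E].
  have [|t [w' h]] := critical_point wK (e := k.+1%:R^-1); first by rewrite invr_gt0.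
  by exists (t, w').
have [p hp] := choice H.
have t0 k : 0 < (p k).1 by have [/andP[]] := hp k.
have [U [UU FU]] := @ultraFilterLemma _ \oo _.
have tc : (fun k => (p k).1) @ \oo --> (0 : R).
  apply: (@cvg_harmonic_bound _ _ _ _ 1) => k; rewrite subr0 mul1r gtr0_norm//.
  by have [/andP[]] := hp k.
have wc : (fun k => (p k).2) @ \oo --> w.
  by apply: (@cvg_harmonic_bound _ _ _ _ 1) => k; rewrite mul1r; have [] := hp k.
have {}tc : (fun k => (p k).1) @ U --> (0 : R) by apply: cvg_trans tc => B; exact: FU.
have {}wc : (fun k => (p k).2) @ U --> w by apply: cvg_trans wc => B; exact: FU.
have t0U : \forall k \near U, 0 < (p k).1 by apply: filterE.
have xc : (fun k => xb + (p k).1 *: (p k).2) @ U --> xb by exact: (cvg_shifted tc wc).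
have phiE := xc _ (set_phi_comp setP).
pose u k : 'rV[R]_m := ((p k).1)^-1 *: (f (xb + (p k).1 *: (p k).2) - f xb).
have uc : u @ U --> nabla_app f xb w by exact: (cvg_first_order f_C2 t0U tc wc).
have uE k : f (xb + (p k).1 *: (p k).2) = f xb + (p k).1 *: u k.
  by rewrite /u scalerA mulfV ?gt_eqF// scale1r addrCA subrr addr0.
clearbody u.
have {}phiE : \forall k \near U,
    phi (xb + (p k).1 *: (p k).2) = theta (f (xb + (p k).1 *: (p k).2)).
  exact: phiE.
have [i hi] : exists i, \forall k \near U, psat (L i) (f xb + (p k).1 *: u k).
  apply: ultra_pigeonhole; apply: filterS phiE => k pk.
  rewrite -uE; apply/(plq_dom plqP); rewrite /edom /= -pk.
  by have [_ _ /le_lt_trans] := hp k; apply; rewrite ltry.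
have [h1 h2] := psat_ray t0U tc uc hi.
exists i; split=> //.
apply: (@cvg_le _ _ U _ (fun k => dotv (gquad A a i (f xb)) (u k) +
    (p k).1 * (2^-1 * dotv (u k *m A i) (u k))) (fun k => dotv vb w + k.+1%:R^-1)).
- rewrite -[X in _ --> X]addr0.
  rewrite -[X in _ + X](mul0r (2^-1 * dotv (nabla_app f xb w *m A i) (nabla_app f xb w))).
  apply: cvgD; first by apply: cvg_dotv => //; exact: cvg_cst.
  apply: cvgM => //; apply: cvgM; first exact: cvg_cst.
  by apply: cvg_dotv => //; exact: cvg_mulmx.
- rewrite -[X in _ --> X]addr0; apply: cvgD; first exact: cvg_cst.
  by apply: cvg_trans (@cvg_harmonic R) => B; exact: FU.
- apply: filterS2 phiE hi => k /= pk hk; have [_ _] := hp k; rewrite pk uE.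
  have Dk : D (f xb + (p k).1 *: u k) by apply/(plq_dom plqP); exists i.
  rewrite (fin_dom theta_gtNy Dk) lee_fin (plq_quad plqP hk) (plq_quad plqP h1) (quadD plqP).
  rewrite !dotvZr -!scalemxAl !dotvZl => hh; rewrite -(ler_pM2l (t0 k)).
  move: hh; move: (dotv (gquad A a i (f xb)) (u k)) (dotv (u k *m A i) (u k)) => g1 g2.
  move: (k.+1%:R^-1) => g3.
  move: (p k).1 (quad _ _ _ _ _) => g4 g5; lra.
Qed.

(** Along the ray in the piece found by [critical_piece], [th] is exactly quadratic. The point
    [f (xb + t *: w)] misses this ray by O(t^2), MSQC makes it feasible at a cost of O(t^2), and the
    Lipschitz bound on [th] keeps the value within the same order. *)
Lemma critical_arc w : critical_cone phi xb vb w ->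
  exists c t1 : R, [/\ 0 < c, 0 < t1 & forall t, 0 < t <= t1 ->
    exists h, [/\ D (f (xb + h)), `|h - t *: w| <= c * t ^+ 2 &
      th (f (xb + h)) <= th (f xb) + t * dotv vb w + c * t ^+ 2]].
Proof.
move=> wK; have [i [Li Ci gi]] := critical_piece wK.
have [r1 r10 hr1] := psat_cone_ray Li Ci.
have [C [r2 [C0 r20 hC]]] := C2_quadratic f_C2.
have [rho [Lf [kap [rho0 Lf0 kap0 good]]]] := good_ball setP.
set u := nabla_app f xb w in Ci gi hr1.
pose Y := `|f xb| + `|u| + Lf * rho.
have Y0 : 0 <= Y by rewrite !addr_ge0// mulr_ge0// ltW.
have [l l0 hl] := dom_lipschitz plqP Y0.
pose W := `|w| + 1.
have W0 : 0 < W by rewrite ltr_wpDl.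
pose c1 := C * W ^+ 2.
have c10 : 0 < c1 by rewrite mulr_gt0// exprn_gt0.
pose c2 := kap * c1 + 1.
have c20 : 0 < c2 by rewrite ltr_wpDl// mulr_ge0// ltW.
pose c3 := l * (Lf * c2 + c1) + `|2^-1 * dotv (u *m A i) u|.
have c30 : 0 <= c3 by rewrite addr_ge0// mulr_ge0 ?(ltW l0)// addr_ge0 ?mulr_ge0 ?(ltW Lf0) ?ltW.
pose t1 := Num.min (Num.min r1 1) (Num.min r2 (rho / (1 + c2)) / W).
have t10 : 0 < t1.
  have c21 : 0 < 1 + c2 by rewrite addr_gt0.
  by rewrite !lt_min r10 ltr01 divr_gt0// lt_min r20 divr_gt0.
exists (c2 + c3), t1; split=> //; first by rewrite ltr_wpDr.
move=> t /andP[t0]; rewrite /t1 !le_min => /andP[/andP[tr1 t_1]].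
rewrite ler_pdivlMr// le_min => /andP[tr2 trho].
have tw : `|t *: w| <= t * W by rewrite normrZ gtr0_norm// ler_wpM2l ?(ltW t0)// lerDl.
have tw2 : `|t *: w| <= r2 by apply: le_trans tw tr2.
have twrho : t * W * (1 + c2) <= rho by move: trho; rewrite ler_pdivlMr// ltr_wpDl// ltW.
have tWle : t <= t * W by rewrite ler_peMr ?(ltW t0)// lerDr.
have t2W : t ^+ 2 <= t * W.
  by apply: le_trans tWle; rewrite expr2 ler_piMr// ltW.
have twr : `|t *: w| <= rho.
  apply: le_trans tw (le_trans _ twrho); rewrite ler_peMr ?mulr_ge0 ?(ltW t0) ?(ltW W0)//.
  by rewrite lerDl ltW.
have Ly : psat (L i) (f xb + t *: u) by apply: hr1; rewrite ltW.
have Dy : D (f xb + t *: u) by apply/(plq_dom plqP); exists i.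
have fy : `|f (xb + t *: w) - (f xb + t *: u)| <= c1 * t ^+ 2.
  have := hC _ tw2; rewrite /nabla_app -scalemxAl -/(nabla_app f xb w) -/u opprD addrA => h.
  apply: le_trans h _; rewrite /c1 -mulrA ler_wpM2l ?(ltW C0)//.
  rewrite -exprMn [W * t]mulrC; apply: ler_pM => //; exact: tw.
(* The slack [tau] is taken as [t ^+ 2], the order of the correction itself. *)
have [_ _ _ /(_ _ (t ^+ 2) Dy)] := good _ twr.
rewrite exprn_gt0// => /(_ isT)[h [Dh hh]].
have hb : `|h - t *: w| <= c2 * t ^+ 2.
  rewrite distrC; apply: le_trans hh _; rewrite /c2 mulrDl mul1r lerD2r -mulrA.
  by rewrite ler_wpM2l ?(ltW kap0).
have hrho : `|h| <= rho.
  rewrite -[h](subrK (t *: w)); apply: le_trans (ler_normD _ _) (le_trans _ twrho).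
  apply: (@le_trans _ _ (c2 * (t * W) + t * W)); last by lra.
  by apply: lerD => //; apply: le_trans hb _; rewrite ler_wpM2l ?(ltW c20).
have fh : `|f (xb + h) - f (xb + t *: w)| <= Lf * (c2 * t ^+ 2).
  have [_ _ /(_ _ twr) h1 _] := good _ hrho; apply: le_trans h1 _.
  by rewrite ler_wpM2l ?(ltW Lf0).
exists h; split=> //.
  by apply: le_trans hb _; rewrite ler_wpM2r ?sqr_ge0// lerDl.
have yY : `|f xb + t *: u| <= Y.
  rewrite /Y; apply: le_trans (ler_normD _ _) _; rewrite -addrA lerD2l normrZ gtr0_norm//.
  by apply: ler_wpDr; [rewrite mulr_ge0 ?(ltW Lf0) ?(ltW rho0)|rewrite ler_piMl].
have hY : `|f (xb + h)| <= Y.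
  have [_ _ /(_ 0) h1 _] := good _ hrho; rewrite normr0 (ltW rho0) in h1.
  have {}h1 := h1 isT; rewrite addr0 subr0 in h1.
  rewrite -[f (xb + h)](subrK (f xb)); apply: le_trans (ler_normD _ _) _.
  rewrite /Y addrC -addrA lerD2l; apply: ler_wpDl => //; apply: le_trans h1 _.
  by rewrite ler_wpM2l ?(ltW Lf0).
have := hl _ _ Dh Dy hY yY.
have : `|f xb + t *: u - f (xb + h)| <= (Lf * c2 + c1) * t ^+ 2.
  rewrite distrC -(subrK (f (xb + t *: w)) (f (xb + h))) -addrA.
  apply: le_trans (ler_normD _ _) _; rewrite mulrDl -mulrA.
  by apply: lerD.
move=> /(ler_wpM2l (ltW l0)); rewrite (plq_quad plqP Ly) (quadD plqP) -(plq_quad plqP Li).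
rewrite dotvZr -scalemxAl dotvZl dotvZr -/u.
have := ler_norm (2^-1 * dotv (u *m A i) u); set N := `|_|.
move=> /(ler_wpM2r (sqr_ge0 t)).
have := ler_wpM2l (ltW t0) gi; have := mulr_ge0 (ltW c20) (sqr_ge0 t).
rewrite /c3 -/N; move: (th _) (th _) (dotv _ _) (dotv _ _) (dotv _ _) => X1 X2 X3 X4 X5.
move: (`|_|) => X6; rewrite !mulrDl; lra.
Qed.

End CriticalDirections.

(** * Approximation of critical directions and passage to the limit *)

Section CriticalLimits.
Context {R : realType} {n m : nat}.
Variables (phi : 'rV[R]_n -> \bar R) (theta : 'rV[R]_m -> \bar R).
Variables (f : 'rV[R]_n -> 'rV[R]_m) (xb vb : 'rV[R]_n) (s : nat).
Variables (L : 'I_s -> seq ('rV[R]_m * R)) (A : 'I_s -> 'M[R]_m).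
Variables (a : 'I_s -> 'rV[R]_m) (alpha : 'I_s -> R).
Hypothesis setP : composite_setting phi theta f xb vb L A a alpha.
Let plqP := set_plq setP.

Local Notation D := (edom theta).
Local Notation th := (fun y => fine (theta y)).
Local Notation ray := (csub_ray D th).

(** The proximal points centred at [t *: w] are compared with the arc of [critical_arc]. After
    division by [t ^+ 2], the squared distance of [w'] to [w], weighted by [(2 * r)^-1], is at most
    [C * |w'| ^+ 2 + c1], so it is O(r). *)
Lemma critical_approx w : critical_cone phi xb vb w ->
  exists c s0 : R, [/\ 0 < c, 0 < s0 & forall r, 0 < r <= s0 -> exists w' z',
    tangent (gph (subdifferential phi)) (row_mx xb vb) (row_mx w' z') /\
    `|w' - w| ^+ 2 <= c * r].
Proof.
move=> wK; have [c [t1 [c0 t10 arc]]] := critical_arc setP wK.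
have [C [rg [C0 rg0 growth]]] := quadratic_growth setP.
have [r0 [dl [r00 dl0 prox]]] := prox_points setP.
pose c1 := n%:R * `|vb| * c + c.
have c10 : 0 < c1 by rewrite ltr_wpDl// !mulr_ge0// ltW.
pose c2 := 4 * (2 * C * `|w| ^+ 2 + c1).
have c20 : 0 < c2 by rewrite mulr_gt0// ltr_wpDl// mulr_ge0 ?sqr_ge0// mulr_ge0// ltW.
exists c2, (Num.min r0 (8 * C)^-1); split=> //.
  by rewrite lt_min r00 invr_gt0 mulr_gt0.
move=> r /andP[r_gt0]; rewrite le_min => /andP[rr0 rC].
have [|t0 [K [t00 K0 hprox]]] := prox r w; first by rewrite r_gt0.
(* This is the reason for the cap [(8 * C)^-1]: after bounding [|w'| ^+ 2] by
   [2 * |w| ^+ 2 + 2 * |w' - w| ^+ 2], the second summand is absorbed by half of the left-hand side,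
   which yields [c2]. *)
have Cr : 4 * C <= (2 * r)^-1.
  rewrite -[leRHS]div1r ler_pdivlMr ?mulr_gt0//.
  have := ler_wpM2l (ltW (mulr_gt0 (ltr0n R 8) C0)) rC.
  rewrite mulfV ?gt_eqF// ?mulr_gt0//; lra.
have [q0 qr] : 0 < (2 * r)^-1 /\ 2 * (2 * r)^-1 * r = 1.
  split; first by rewrite invr_gt0 mulr_gt0.
  by field; rewrite gt_eqF.
move: ((2 * r)^-1) q0 qr Cr hprox => q q0 qr Cr hprox.
have B0 : 0 < `|w| + c by rewrite ltr_wpDl.
pose tm := Num.min (Num.min (Num.min t0 t1) 1) (Num.min (dl / (`|w| + c)) (rg / K)).
have tm0 : 0 < tm by rewrite !lt_min t00 t10 ltr01 !divr_gt0.
have H (t : R) : exists d : 'rV[R]_n, 0 < t <= tm -> [/\ `|d| <= K * t,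
    subdifferential phi (xb + d) (vb + r^-1 *: (t *: w - d)) &
    q * `|d - t *: w| ^+ 2 <= C * `|d| ^+ 2 + c1 * t ^+ 2 + q * n%:R * (c * t ^+ 2) ^+ 2].
  have [/andP[t_gt0]|] := boolP (0 < t <= tm); last by exists 0.
  rewrite !le_min => /andP[/andP[/andP[tt0 tt1] t_1] /andP[tdl trg]].
  have [|d [dK Dd hd mind]] := hprox t; first by rewrite t_gt0.
  have [|h [Dh hh thh]] := arc t; first by rewrite t_gt0.
  exists d => _; split=> //.
  have hdl : `|h| <= dl.
    rewrite -[h](subrK (t *: w)); apply: le_trans (ler_normD _ _) _.
    move: tdl; rewrite ler_pdivlMr// => tdl; apply: le_trans _ tdl.
    rewrite normrZ gtr0_norm// mulrDr addrC lerD2l; apply: le_trans hh _.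
    by rewrite mulrC ler_wpM2r ?(ltW c0)// expr2 ler_piMl ?(ltW t_gt0).
  have drg : `|d| <= rg.
    by apply: le_trans dK _; rewrite mulrC -ler_pdivlMr.
  have := mind _ hdl Dh; have := growth _ drg Dd.
  have := ler_wpM2l (ltW q0) (sqr_norm_le (d - t *: w)).
  have : q * dotv (h - t *: w) (h - t *: w) <= q * n%:R * (c * t ^+ 2) ^+ 2.
    rewrite -mulrA ler_wpM2l ?(ltW q0)//; apply: le_trans (dotv_le _ _) _.
    rewrite -mulrA ler_wpM2l// expr2; apply: ler_pM => //.
  have : - (n%:R * `|vb| * (c * t ^+ 2)) <= dotv vb (h - t *: w).
    by apply: le_trans (dotv_ge _ _); rewrite lerN2 ler_wpM2l// mulr_ge0.
  move: thh; rewrite dotvBr dotvZr /c1.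
  move: (th _) (th _) (th _) (dotv vb h) (dotv vb d) (dotv vb w) => T1 T2 T3 v1 v2 v3.
  move: (dotv _ _) (dotv _ _) => v4 v5; lra.
have {H} [d hd] := choice H.
pose p (t : R) : 'rV[R]_n := t^-1 *: d t.
have [U [UU FU]] := @ultraFilterLemma _ (0 : R)^'+ _.
have small : \forall t \near U, 0 < t <= tm by exact: FU (right_small tm0).
have t_gt0U : \forall t \near U, 0 < t by apply: filterS small => t /andP[].
have tU : (fun t : R => t) @ U --> (0 : R).
  by apply: cvg_trans (@cvg_right0 R) => B; exact: FU.
have tp t : 0 < t -> t *: p t = d t.
  by move=> t_gt0; rewrite /p scalerA mulfV ?gt_eqF// scale1r.
have [w' pw' _] : exists2 l, p @ U --> l & `|l| <= K.
  apply: ultra_bounded_cvg; apply: filterS small => t tt.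
  have /andP[t_gt0 _] := tt; have [h _ _] := hd t tt.
  by rewrite normrZ gtr0_norm ?invr_gt0// mulrC ler_pdivrMr.
clearbody p.
exists w', (r^-1 *: (w - w')); split.
  apply: (@tangent_filter _ _ _ _ _ U _ id (fun t => row_mx (p t) (r^-1 *: (w - p t)))) => //.
    apply/cvg_row_mx; split=> //; apply: cvgZ; first exact: cvg_cst.
    by apply: cvgB => //; exact: cvg_cst.
  apply: filterS small => t tt; have /andP[t_gt0 _] := tt.
  rewrite scale_row_mx add_row_mx /gph /= row_mxKl row_mxKr tp//.
  rewrite (_ : t *: (r^-1 *: (w - p t)) = r^-1 *: (t *: w - d t)); last first.
    by rewrite -(tp t)//; clear; vring.
  by have [] := hd t tt.
have h : q * `|w' - w| ^+ 2 <= C * `|w'| ^+ 2 + (c1 + q * n%:R * c ^+ 2 * 0 ^+ 2).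
  have sqc (g : R -> 'rV[R]_n) l : g @ U --> l -> (fun t => `|g t| ^+ 2) @ U --> `|l| ^+ 2.
    move=> gl; rewrite expr2; under eq_fun do rewrite expr2.
    by apply: cvgM; exact: cvg_norm.
  apply: (@cvg_le _ _ U _ (fun t => q * `|p t - w| ^+ 2)
    (fun t => C * `|p t| ^+ 2 + (c1 + q * n%:R * c ^+ 2 * t ^+ 2))).
  - apply: cvgM; first exact: cvg_cst.
    by apply: sqc; apply: cvgB => //; exact: cvg_cst.
  - apply: cvgD; first by apply: cvgM; [exact: cvg_cst|exact: sqc].
    apply: cvgD; first exact: cvg_cst.
    apply: cvgM; first exact: cvg_cst.
    by rewrite expr2; under eq_fun do rewrite expr2; apply: cvgM.
  - apply: filterS small => t tt; have /andP[t_gt0 _] := tt; have [_ _] := hd t tt.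
    rewrite -(tp t)// -scalerBr !normrZ gtr0_norm// => hh.
    have t2 : 0 < t ^+ 2 by rewrite exprn_gt0.
    rewrite -(ler_pM2l t2); move: hh.
    rewrite !exprMn; move: (`|_|) (`|_|) => N1 N2; lra.
have tri : `|w'| ^+ 2 <= 2 * `|w| ^+ 2 + 2 * `|w' - w| ^+ 2.
  have h1 : `|w'| <= `|w| + `|w' - w|.
    by rewrite -{1}[w'](subrK w) addrC; exact: ler_normD.
  apply: (@le_trans _ _ ((`|w| + `|w' - w|) ^+ 2)).
    by rewrite ler_sqr ?nnegrE ?addr_ge0.
  by have := sqr_ge0 (`|w| - `|w' - w|); lra.
move: h tri; rewrite expr0n /= mulr0 addr0.
have := sqr_ge0 `|w'|; have := sqr_ge0 `|w' - w|.
move: (`|w'| ^+ 2) (`|w' - w| ^+ 2) => X Y Y0 X0 h tri.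
have h1 : q * Y <= 2 * (2 * C * `|w| ^+ 2 + c1).
  have := ler_wpM2l (ltW C0) tri; have := ler_wpM2r Y0 Cr; lra.
have := ler_wpM2r (ltW r_gt0) h1; rewrite /c2 => h2.
have : 2 * q * r * Y = Y by rewrite qr mul1r.
lra.
Qed.

Lemma multipliers_closed {T : Type} (F : set_system T) {FF : ProperFilter F}
    (lam : T -> 'rV[R]_m) lam0 :
  lam @ F --> lam0 -> (\forall b \near F, multipliers theta f xb vb (lam b)) ->
  multipliers theta f xb vb lam0.
Proof.
move=> lc h; apply/(multipliersE setP); split.
  have c1 : (fun b => nabla_adj f xb (lam b)) @ F --> nabla_adj f xb lam0.
    by apply: cvg_mulmx.
  apply: (cvg_unique _ c1); first exact: norm_hausdorff.
  apply: cvg_near_cst; apply: filterS h => b /(multipliersE setP)[-> _].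
  by [].
apply: (csub_closed plqP (F := F) (y := fun=> f xb) (lam := lam)) => //.
  exact: cvg_cst.
by apply: filterS h => b /(multipliersE setP)[].
Qed.

Lemma cvg_nabla2 {T : Type} (F : set_system T) {FF : Filter F} (w : T -> 'rV[R]_n) w0 :
  w @ F --> w0 -> (fun b => nabla2 f xb (w b) (w b)) @ F --> nabla2 f xb w0 w0.
Proof.
move=> wc; apply: cvg_coord => i; rewrite mxE; under eq_fun do rewrite mxE.
by apply: cvg_dotv => //; exact: cvg_mulmx.
Qed.

(** The data supplied by the approximating directions converge as r tends to 0: the multipliers are
    bounded by [M], and the rays, first moved to the fixed [lamb] by [ray_exchange], form a closed
    family. *)
Lemma critical_cone_formula w lamb : critical_cone phi xb vb w ->
  multipliers theta f xb vb lamb ->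
  exists lam eta, max_multipliers theta f xb vb w lam /\
    ray (f xb) lamb (nabla_app f xb w) eta.
Proof.
move=> wK lambL; have [lambE lambC] := (multipliersE setP _).1 lambL.
have [c [s0 [c0 s00 hs]]] := critical_approx wK.
have [M M0 incl] := tangent_inclusion setP.
(* The zero matrix makes the image condition vacuous: only the existence of a ray is to pass to the
   limit in [csub_ray_image_closed]. *)
have H (r : R) : exists p : 'rV[R]_n * 'rV[R]_m, 0 < r <= s0 ->
    [/\ `|p.1 - w| ^+ 2 <= c * r, `|p.2| <= M, max_multipliers theta f xb vb p.1 p.2 &
      exists2 eta, ray (f xb) lamb (nabla_app f xb p.1) eta & eta *m (0 : 'M[R]_(m, 1)) = 0].
  have [/hs[w' [z' [/incl[_ [lam [eta [h1 h2 h3 _]]]] h4]]]|] := boolP (0 < r <= s0).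
    have [lamE lamC] := (multipliersE setP _).1 h2.1.
    have [|eta' reta' _] := ray_exchange plqP lamC lambC _ h3.
      by rewrite -![_ *m _]/(nabla_adj _ _ _) lamE lambE.
    by exists (w', lam) => _; split=> //; exists eta' => //; rewrite mulmx0.
  by exists (0, 0).
have {H} [p hp] := choice H.
have [U [UU FU]] := @ultraFilterLemma _ (0 : R)^'+ _.
have small : \forall t \near U, 0 < t <= s0 by exact: FU (right_small s00).
have wc : (fun t => (p t).1) @ U --> w.
  suff : (fun t => (p t).1) @ 0^'+ --> w by apply: cvg_trans => B; exact: FU.
  apply/cvgrPdist_le => e e0.
  have e1 : 0 < Num.min s0 (e ^+ 2 / c) by rewrite lt_min s00 divr_gt0// exprn_gt0.
  apply: filterS (right_small e1) => t; rewrite le_min => /and3P[t0 ts te].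
  have [|h _ _ _] := hp t; first by rewrite t0.
  rewrite distrC -ler_sqr ?nnegrE ?(ltW e0)//; apply: le_trans h _.
  by rewrite mulrC -ler_pdivlMr.
have [lam lamc _] : exists2 l, (fun t => (p t).2) @ U --> l & `|l| <= M.
  by apply: ultra_bounded_cvg; apply: filterS small => t /hp[].
have [eta reta _] : exists2 eta, ray (f xb) lamb (nabla_app f xb w) eta &
    eta *m (0 : 'M[R]_(m, 1)) = 0.
  apply: (csub_ray_image_closed plqP (F := U) (u := fun t => nabla_app f xb (p t).1)
    (x := fun=> 0)); first exact: cvg_mulmx.
    exact: cvg_cst.
  by apply: filterS small => t /hp[].
exists lam, eta; split=> //; split.
  by apply: (multipliers_closed lamc); apply: filterS small => t /hp[_ _ []].
move=> mu muL.
apply: (@cvg_le _ _ U _ (fun t => dotv mu (nabla2 f xb (p t).1 (p t).1))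
  (fun t => dotv (p t).2 (nabla2 f xb (p t).1 (p t).1))).
- by apply: cvg_dotv; [exact: cvg_cst|exact: cvg_nabla2].
- by apply: cvg_dotv => //; exact: cvg_nabla2.
- by apply: filterS small => t /hp[_ _ [_ h] _]; exact: h.
Qed.

End CriticalLimits.

(** * Proto-derivative *)

Section ProtoDerivative.
Context {R : realType} {n m : nat}.
Variables (phi : 'rV[R]_n -> \bar R) (theta : 'rV[R]_m -> \bar R).
Variables (f : 'rV[R]_n -> 'rV[R]_m) (xb vb : 'rV[R]_n) (s : nat).
Variables (L : 'I_s -> seq ('rV[R]_m * R)) (A : 'I_s -> 'M[R]_m).
Variables (a : 'I_s -> 'rV[R]_m) (alpha : 'I_s -> R).
Hypothesis setP : composite_setting phi theta f xb vb L A a alpha.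
Let phi_gtNy := set_phi_gtNy setP.
Let theta_gtNy := set_theta_gtNy setP.
Let f_C2 := set_C2 setP.
Let fxb_dom := set_dom setP.
Let vb_sub := set_sub setP.
Let plqP := set_plq setP.

Local Notation D := (edom theta).
Local Notation th := (fun y => fine (theta y)).
Local Notation cs := (csub D th).
Local Notation ray := (csub_ray D th).

Lemma graphical_derivative_theta lam u eta : cs (f xb) lam ->
  graphical_derivative (subdifferential theta) (f xb) lam u eta <-> ray (f xb) lam u eta.
Proof.
move=> lamC; split.
  move=> [t_ [W_ [t0 tc Wc hW]]].
  have [uc ec] : (fun i => lsubmx (W_ i)) @ \oo --> u /\ (fun i => rsubmx (W_ i)) @ \oo --> eta.
    by apply/cvg_row_mx; under eq_fun do rewrite hsubmxK.
  apply: (csub_ray_limit plqP _ tc uc ec); first exact: filterE.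
  apply: filterE => i; apply/(theta_subdifferential setP); have := hW i.
  rewrite /gph /= -{1 2}[W_ i]hsubmxK scale_row_mx add_row_mx row_mxKl row_mxKr.
  by [].
move=> [e e0 he]; apply: (@tangent_filter _ _ _ _ _ (0 : R)^'+ _ id (fun=> row_mx u eta)).
- by apply: filterS (right_small e0) => t /andP[].
- exact: cvg_right0.
- exact: cvg_cst.
- apply: filterS (right_small e0) => t /he h.
  rewrite scale_row_mx add_row_mx /gph /= row_mxKl row_mxKr.
  exact/(theta_subdifferential setP).
Qed.

Lemma proto_tangent lam lamb w eta :
  max_multipliers theta f xb vb w lam -> multipliers theta f xb vb lamb ->
  ray (f xb) lamb (nabla_app f xb w) eta ->
  graphical_derivative (subdifferential phi) xb vb w
    (w *m hess_mx f xb lam + nabla_adj f xb eta).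
Proof.
move=> lamL lambL reta.
have [e [xi [e0 xiS xi0 xic]]] := proto_curve setP lamL lambL reta.
apply: (tangent_filter _ (@cvg_right0 R) xic).
  by apply: filterS (right_small e0) => t /andP[].
apply: filterS (right_small e0) => t /andP[t0 te].
by rewrite scalerA mulfV ?gt_eqF// scale1r xi0 addrC subrK; apply: xiS; rewrite (ltW t0).
Qed.

Lemma multipliers_nonempty : multipliers theta f xb vb !=set0.
Proof.
have [r2 [M [r20 M0 hm]]] := multiplier_exists setP.
have [|||lam [_]] := hm 0 vb.
- by rewrite normr0 ltW.
- by rewrite subrr normr0 invr_ge0.
- by rewrite addr0.
by rewrite addr0 => lamE lamC; exists lam; apply/(multipliersE setP).
Qed.

Lemma composite_proto_differentiable : proto_differentiable (subdifferential phi) xb vb.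
Proof.
move=> W; rewrite -[W]hsubmxK; move: (lsubmx W) (rsubmx W) => w z hW.
have [M M0 incl] := tangent_inclusion setP.
have [_ [lam [eta [_ lamL reta ->]]]] := incl _ _ hW.
exact: (proto_curve setP lamL lamL.1 reta).
Qed.

Lemma composite_proto_derivative w lamb : multipliers theta f xb vb lamb ->
  graphical_derivative (subdifferential phi) xb vb w =
  [set a + b | a in [set w *m hess (fun x => dotv lam (f x)) xb
                       | lam in max_multipliers theta f xb vb w]
             & b in nabla_adj f xb @`
                      graphical_derivative (subdifferential theta)
                        (f xb) lamb (nabla_app f xb w)].
Proof.
move=> lambL; have [lambE lambC] := (multipliersE setP _).1 lambL.
apply/seteqP; split => z.
  have [M M0 incl] := tangent_inclusion setP.
  move=> /incl[_ [lam [eta [_ lamL reta ->]]]].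
  have [lamE lamC] := (multipliersE setP _).1 lamL.1.
  (* The ray provided at [lam] is moved to the prescribed [lamb] without changing its adjoint
     image. *)
  have [|eta' reta' eta'E] := ray_exchange plqP lamC lambC _ reta.
    by rewrite -![_ *m _]/(nabla_adj _ _ _) lamE lambE.
  exists (w *m hess_mx f xb lam); first by exists lam => //; exact: (mul_hess_dotv f_C2).
  exists (nabla_adj f xb eta') => //; last by rewrite /nabla_adj eta'E.
  by exists eta' => //; apply/graphical_derivative_theta.
move=> [_ [lam lamL <-]] [_ [eta heta <-]] <-.
rewrite (mul_hess_dotv f_C2); apply: proto_tangent lamL lambL _.
exact/graphical_derivative_theta.
Qed.

Lemma composite_proto_derivative_dom :
  svdom (graphical_derivative (subdifferential phi) xb vb) = critical_cone phi xb vb.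
Proof.
have [M M0 incl] := tangent_inclusion setP.
apply/seteqP; split => w; first by move=> [z /incl[]].
move=> wK; have [lamb lambL] := multipliers_nonempty.
have [lam [eta [lamL reta]]] := critical_cone_formula setP wK lambL.
by exists (w *m hess_mx f xb lam + nabla_adj f xb eta); exact: proto_tangent lamL lambL reta.
Qed.

End ProtoDerivative.

(** * From extended-real data to [convex_plq], and the theorem *)

Lemma polyhedral_psat {R : realType} (k : nat) (Om : set 'rV[R]_k) :
  polyhedral Om -> exists L : seq ('rV[R]_k * R), forall y, Om y <-> psat L y.
Proof.
move=> [p [b [c ->]]]; exists [seq (b i, c i) | i <- enum 'I_p] => y; split.
  by move=> h _ /mapP[i _ ->]; exact: h.
by move=> h i; apply: (h (b i, c i)); apply/mapP; exists i; rewrite ?mem_enum.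
Qed.

Lemma convex_plq_intro {R : realType} (m : nat) (theta : 'rV[R]_m -> \bar R) :
  (forall y, theta y <> -oo%E) -> econvex theta -> piecewise_linear_quadratic theta ->
  exists (s : nat) (L : 'I_s -> seq ('rV[R]_m * R)) (A : 'I_s -> 'M[R]_m)
    (a : 'I_s -> 'rV[R]_m) (alpha : 'I_s -> R),
    convex_plq (edom theta) (fun y => fine (theta y)) L A a alpha.
Proof.
move=> theta_gtNy cvx [s [Om [A [a [alpha [poly A_sym domE quadE]]]]]].
have [L hL] := choice (fun i => polyhedral_psat (poly i)).
exists s, L, A, a, alpha; split=> //.
- move=> x y t t01 Dx Dy; have := cvx x y t t01.
  rewrite (fin_dom theta_gtNy Dx) (fin_dom theta_gtNy Dy) -!EFinM -EFinD => h.
  have Dt : edom theta (t *: x + (1 - t) *: y) by apply: le_lt_trans h _; rewrite ltry.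
  by split=> //; rewrite (fin_dom theta_gtNy Dt) lee_fin in h.
- move=> y; rewrite domE; split=> [[i _ /hL]|[i /hL]]; first by exists i.
  by exists i.
- by move=> i y /hL/quadE ->.
Qed.

(** Nonemptiness of the multiplier set is part of the conclusion, so that the formula for an
    arbitrary [lamb] is never an empty assertion. *)
Theorem theorem7p2 (R : realType) (n m : nat)
    (phi : 'rV[R]_n -> \bar R) (theta : 'rV[R]_m -> \bar R)
    (f : 'rV[R]_n -> 'rV[R]_m) (xb vb : 'rV[R]_n)
    (phi_gtNy : forall x, phi x <> -oo%E)
    (theta_gtNy : forall y, theta y <> -oo%E)
    (phi_comp : \forall x \near xb, phi x = theta (f x))
    (theta_convex : econvex theta)
    (theta_plq : piecewise_linear_quadratic theta)
    (f_C2 : C2_around f xb)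
    (fxb_dom : edom theta (f xb))
    (msqc : MSQC theta f xb)
    (vb_sub : subdifferential phi xb vb) :
  [/\ proto_differentiable (subdifferential phi) xb vb,
      multipliers theta f xb vb !=set0,
      forall w, critical_cone phi xb vb w ->
      forall lamb, multipliers theta f xb vb lamb ->
        graphical_derivative (subdifferential phi) xb vb w =
        [set a + b | a in [set w *m hess (fun x => dotv lam (f x)) xb
                             | lam in max_multipliers theta f xb vb w]
                   & b in nabla_adj f xb @`
                            graphical_derivative (subdifferential theta)
                              (f xb) lamb (nabla_app f xb w)]
    & svdom (graphical_derivative (subdifferential phi) xb vb) =
        critical_cone phi xb vb].
Proof.
have [s [L [A [a [alpha plqP]]]]] := convex_plq_intro theta_gtNy theta_convex theta_plq.
have setP : composite_setting phi theta f xb vb L A a alpha by split.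
split.
- exact: composite_proto_differentiable setP.
- exact: multipliers_nonempty setP.
- by move=> w _ lamb; exact: composite_proto_derivative setP _ _.
- exact: composite_proto_derivative_dom setP.
Qed.
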